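(* Let $n\ge1$, $1\le k\le n$ and $m\ge1$ an integer. Then near (generic points of) the divisor $\{q^mt_1\cdots t_k=1\}$ in the region $\{|t_i|>1\ \forall i\}$, $$F(t_1,\ldots,t_n)=(-1)^m\frac{q^{m^2/2}m^{k-1}}{q^mt_1\cdots t_k-1}\cdot\frac{F(t_{k+1},\ldots,t_n)}{(t_{k+1}\cdots t_n)^m}+(\text{a function holomorphic along that divisor}),$$ with the convention $F(t_{k+1},\ldots,t_n)=1$ when $k=n$.
   Context: Fix $q$, $0<|q|<1$, with a chosen $q^{1/2}$. $\langle f\rangle_q:=\sum_\lambda f(\lambda)q^{|\lambda|}/\sum_\lambda q^{|\lambda|}$ over all partitions $\lambda$. $F(t_1,\ldots,t_r)=\big\langle\prod_{k=1}^r\sum_{i\ge1}t_k^{\lambda_i-i+1/2}\big\rangle_q$; this series converges uniformly on compact subsets of $\{|t_i|>1\}$ minus the divisors $q^{m}\prod_{k\in S}t_k=1$ ($m\ge1$, $S\subset\{1,\dots,r\}$), and defines a meromorphic function on $\{|t_i|>1\}$ with at most simple poles along these divisors.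
   Formalization: The roots t_i^{1/2} are chosen with q^{m/2}(t_1⋯t_k)^{1/2}=1, since on the other branch the polar part changes sign and the formula fails; F is the holomorphic continuation of the series from |q t_1⋯t_n|<1, as the series diverges beyond. *)

(* Defs.v *)
(* MathComp + MathComp-Analysis; complex numbers are R[i] (real-closed
   library) for an arbitrary R : realType, used through the copy R[i]^o, which
   carries the normed-module structure over the field R[i] itself, so that
   [derivable f z 1] is complex differentiability. *)
From HB Require Import structures.
From mathcomp Require Import all_boot all_order all_algebra.
From mathcomp Require Import complex.
From mathcomp Require Import all_classical all_reals all_analysis.
Set Implicit Arguments. Unset Strict Implicit. Unset Printing Implicit Defensive.
Import Order.TTheory GRing.Theory Num.Theory.
Import numFieldNormedType.Exports.
Local Open Scope classical_set_scope.
Local Open Scope ring_scope.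

Notation Cx R := ((R[i])^o).

(* Points of C^r are represented by functions nat -> C, coordinate j
   (0-indexed) being the paper's t_{j+1}; only coordinates j < r matter. *)

(* A partition of N, padded with zeros to length N, is a nonincreasing
   N-tuple of numbers <= N with sum N; this is a bijection with the
   partitions lambda of N (lambda_i = i-th entry, zero beyond). *)
Definition ptuple (N : nat) (s : N.-tuple 'I_N.+1) : bool :=
  sorted geq (map (@nat_of_ord N.+1) s) && (sumn (map (@nat_of_ord N.+1) s) == N).

(* lambda_{i+1} (0-indexed), zero beyond the length *)
Definition lam (N : nat) (s : N.-tuple 'I_N.+1) (i : nat) : nat :=
  nth 0%N (map (@nat_of_ord N.+1) s) i.

(* u = t^{1/2}; the inner sum  sum_{i>=1} t^{lambda_i - i + 1/2}
   = sum_{i>=1} u^{2(lambda_i - i) + 1}  (convergent for |u| > 1) *)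
Definition inner_sum (R : realType) (l : nat -> nat) (u : Cx R) : Cx R :=
  limn (series (fun i : nat => u ^ (2 * ((l i)%:Z - (i.+1)%:Z) + 1)%R)).

Definition pcoef (R : realType) (r : nat) (u : nat -> Cx R) (N : nat) : Cx R :=
  \sum_(s : N.-tuple 'I_N.+1 | ptuple s) \prod_(k < r) inner_sum (lam s) (u k).

(* the q-bracket series  < prod_{k<r} sum_i t_k^{lambda_i - i + 1/2} >_q ,
   summed over partitions grouped by size |lambda| = N *)
Definition Fseries (R : realType) (q : Cx R) (r : nat) (u : nat -> Cx R) : Cx R :=
  limn (series (fun N => q ^+ N * pcoef r u N)) /
  limn (series (fun N => q ^+ N * pcoef 0 u N)).

Definition outside_disc (R : realType) (r : nat) (u : nat -> Cx R) : Prop :=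
  forall i, (i < r)%N -> 1 < `|u i|.

Definition on_divisor (R : realType) (q : Cx R) (r : nat) (u : nat -> Cx R) : Prop :=
  exists m : nat, (0 < m)%N /\
    exists S : {set 'I_r}, (0 < #|S|)%N /\ q ^+ m * \prod_(i in S) (u i) ^+ 2 = 1.

Definition good_domain (R : realType) (q : Cx R) (r : nat) (u : nat -> Cx R) : Prop :=
  outside_disc r u /\ ~ on_divisor q r u.

Definition polydisc (R : realType) (r : nat) (p : nat -> Cx R) (d : Cx R)
    (u : nat -> Cx R) : Prop :=
  forall i, (i < r)%N -> `|u i - p i| < d.

Definition upd (R : realType) (u : nat -> Cx R) (i : nat) (z : Cx R) : nat -> Cx R :=
  fun j => if j == i then z else u j.

(* holomorphic on W (Osgood): continuous, and complex differentiable in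
   each variable separately *)
Definition holomorphic_on (R : realType) (r : nat) (W : (nat -> Cx R) -> Prop)
    (G : (nat -> Cx R) -> Cx R) : Prop :=
  (forall u, W u -> forall e : Cx R, 0 < e -> exists d : Cx R, 0 < d /\
      forall v, polydisc r u d v -> `|G v - G u| < e) /\
  (forall u, W u -> forall i, (i < r)%N ->
      derivable (fun z : Cx R => G (upd u i z)) (u i) 1).

(* G is (the function of) the r-point function F(t_1,...,t_r), in the
   variables u_i = t_i^{1/2}: it depends only on the first r coordinates,
   is holomorphic on {|t_i|>1} minus the divisors, and coincides with the
   defining series on the nonempty open set {|t_i| > 1, |q| |t_1...t_r| < 1}
   where that series converges absolutely.  (By connectedness this
   determines the meromorphic continuation uniquely.) *)
Definition is_F (R : realType) (q : Cx R) (r : nat) (G : (nat -> Cx R) -> Cx R) : Prop :=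
  (forall u v, (forall i, (i < r)%N -> u i = v i) -> G u = G v) /\
  holomorphic_on r (good_domain q r) G /\
  (forall u, outside_disc r u -> `|q| * \prod_(i < r) `|u i| ^+ 2 < 1 ->
     G u = Fseries q r u).

(* Main.v *)
(** Write t_a = u_a^2 and T_S for the product of the t_a over a set S. Placing the n
    factors in rows of the partition and summing over the numbers of columns of each height,
    the partition sum restricted to M rows becomes an explicit rational function
    [Phi q x t M S], obtained by adding one row at a time; the numerator of the bracket is
    [u_1 ... u_n] times the limit [PhiL] of [Phi q 1 t M setT] as M grows. The limit is
    locally uniform off the divisors, so it continues the series, and F equals it by the
    identity theorem applied one variable at a time.

    Cutting the partition after row m gives
      Phi q x t (m + M) S = sum_(A <= S) Phi q x t m A * T_(S\A)^-m * Phi q (q^m x T_A) t M (S\A),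
    and near a generic point of q^m t_1 ... t_k = 1 only the term A = {1..k} is singular,
    through the factor 1 / (1 - q^m T_A). On the divisor its numerator is
    (-1)^(m-1) q^(m(m+1)/2) m^(k-1): it is a sum over maps {1..k} -> Z/m of products of
    x_h / (1 - x_h), which rotating Z/m turns into Lagrange's identity
    sum_c prod_(h <> c) x_h / (x_h - x_c) = 1. Numerator minus its value on the divisor
    is a holomorphic multiple of q^m T_A - 1, uniformly in M by Cauchy's estimate.

    Complex analysis is done without integrals: contour integrals over squares are replaced
    by midpoint sums, which are exactly additive under bisection and exact on affine
    functions, as Goursat's argument requires. *)

(* The defining series is ordered by size, whereas the product formula is ordered by rows and
   columns; partitions confined to boxes link the two, and the majorant comes from the same formula
   evaluated at the moduli of [q] and of the [t_a]. [is_F] prescribes values of [F] only on a small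
   open set, so uniqueness of the continuation requires paths that visibly avoid the divisors.
   Nothing is computed in the limit: identities are proved for finite [M], together with increments
   bounded by [B * r ^+ M] on a whole polydisc, and this rate transports both holomorphy and
   identities. That the numerator is divisible by the equation of the divisor is pure algebra for
   each [M], since sums, products and inverses of divisible differences are again such. The chosen
   root [qh] fixes the constant: the numerator contains [u_1 ... u_k], which on the branch through
   [p] equals [qh ^- m] and turns the exponent [m (m + 1)] of [qh] into [m ^ 2]. *)
Require Import Defs.
From HB Require Import structures.
From mathcomp Require Import all_boot all_order all_algebra.
From mathcomp Require Import complex ring lra zify.
Set Implicit Arguments. Unset Strict Implicit. Unset Printing Implicit Defensive.
Import Order.TTheory GRing.Theory Num.Theory.
Local Open Scope ring_scope.

(** * Row sums of partitions *)

Section RowSums.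
Variable K : fieldType.

Section Def.
Variable I : finType.
Implicit Types (S A B : {set I}) (t : I -> K).

(** The factors in [A] sit in rows before row [M], those of [S :\: A] in row [M], where each
    contributes [t_a ^- M]. [kap h S] is the total weight of the columns of height [h], which
    lengthen the rows of all factors placed so far. It is left arbitrary because the same recursion
    serves for full geometric series, for truncated ones and for moduli. *)
Fixpoint rows (kap : nat -> {set I} -> K) t M S : K :=
  if M is M'.+1 then
    kap M S * \sum_(A : {set I} | A \subset S)
       rows kap t M' A * (\prod_(a in S :\: A) t a) ^- M
  else (S == set0)%:R.

(** The multiplicity of the columns of height [h] is summed as a geometric series. [x] carries what
    lies above a cut: [q] to the number of rows there, times the [t_a] of the factors placed there.
    It is 1 for a whole partition. *)
Definition Phi (q x : K) t := rows (fun h S => (1 - q ^+ h * x * \prod_(a in S) t a)^-1) t.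

Lemma Phi0 q x t S : Phi q x t 0 S = (S == set0)%:R. Proof. by []. Qed.
Lemma PhiS q x t M S : Phi q x t M.+1 S = (1 - q ^+ M.+1 * x * \prod_(a in S) t a)^-1 *
  \sum_(A : {set I} | A \subset S) Phi q x t M A * (\prod_(a in S :\: A) t a) ^- M.+1.
Proof. by []. Qed.

Lemma prod_setD t A S : A \subset S ->
  \prod_(a in S) t a = (\prod_(a in A) t a) * \prod_(a in S :\: A) t a.
Proof. by move=> AS; rewrite (big_setID A) /= (setIidPr AS). Qed.

(** [A] collects the factors in the first [m] rows. A column reaching below row [m] crosses all
    these rows and lengthens each by 1, whence the weight [q ^+ m * x * T_A]; the other factors have
    their row index shifted by [m], whence the power [- m]. *)
Lemma Phi_comp q x t m M S : (forall a, t a != 0) ->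
  Phi q x t (m + M) S = \sum_(A : {set I} | A \subset S)
    Phi q x t m A * (\prod_(a in S :\: A) t a) ^- m *
    Phi q (q ^+ m * x * \prod_(a in A) t a) t M (S :\: A).
Proof.
move=> t0; elim: M S => [|M IH] S.
  rewrite addn0 (bigD1 S) //= setDv !Phi0 big_set0 expr1n invr1 eqxx !mulr1 big1 ?addr0 // => A /andP[AS AnS].
  by rewrite Phi0 setD_eq0 [S \subset A]negbTE ?mulr0 //; move: AnS; rewrite eqEsubset AS.
rewrite addnS PhiS mulr_sumr.
transitivity (\sum_(B : {set I} | B \subset S) \sum_(A : {set I} | A \subset B)
  (1 - q ^+ (m + M).+1 * x * \prod_(a in S) t a)^-1 *
   (Phi q x t m A * (\prod_(a in B :\: A) t a) ^- m *
    Phi q (q ^+ m * x * \prod_(a in A) t a) t M (B :\: A) *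
     (\prod_(a in S :\: B) t a) ^- (m + M).+1)).
  by apply: eq_bigr => B BS; rewrite IH mulr_suml mulr_sumr.
rewrite (exchange_big_dep (fun A => A \subset S)) /=; last first.
  by move=> B A BS AB; exact: subset_trans AB BS.
apply: eq_bigr => A AS.
(* A set between [A] and [S] is [A :|: B] with [B] inside [S :\: A]; in terms of [B] the inner sum
   is the recursion for the rows below the cut. *)
rewrite PhiS !mulr_sumr (reindex_onto (fun B => A :|: B) (fun B => B :\: A)) /=; last first.
  move=> B /andP[_ /subsetP AB]; apply/setP => a; rewrite !inE.
  by have := AB a; case: (a \in A) => //= ->.
apply: eq_big => [B|B].
  rewrite subUset AS subsetUl andbT subsetD /=; congr (_ && _).
  apply/eqP/idP => [<-|dBA]; first by rewrite disjoint_sym disjoints_subset; apply/subsetP => a; rewrite !inE => ->.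
  apply/setP => a; rewrite !inE; have := disjointFr dBA (x := a).
  by case: (a \in B) => [->|_] //; rewrite orbF andNb.
move=> /andP[/andP[ABS _] /eqP AB]; rewrite AB setDDl.
have SA : S :\: A = B :|: (S :\: (A :|: B)).
  apply/setP => a; move/setP: AB => /(_ a); move/subsetP: ABS => /(_ a); rewrite !inE.
  by case: (a \in A); case: (a \in B); case: (a \in S) => //= h; have := h isT.
have dB : \prod_(a in S :\: A) t a = (\prod_(a in B) t a) * \prod_(a in S :\: (A :|: B)) t a.
  rewrite (@prod_setD t B) ?setDDl // SA subsetUl //.
have -> : 1 - q ^+ M.+1 * (q ^+ m * x * \prod_(a in A) t a) * \prod_(a in S :\: A) t a =
   1 - q ^+ (m + M).+1 * x * \prod_(a in S) t a.
  by rewrite (prod_setD t AS) -addnS exprD; ring.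
rewrite dB -addnS [in _ ^- (m + M.+1)]exprD exprMn !invfM; ring.
Qed.

End Def.

(** [Phi] with [M.+1] rows, stripped of its outermost factor. For [M.+1 = m] that factor holds the
    denominator that vanishes on the divisor, so this is the numerator there. *)
Definition rowsum (I : finType) (q x : K) (t : I -> K) M (S : {set I}) : K :=
  \sum_(A : {set I} | A \subset S) Phi q x t M A * (\prod_(a in S :\: A) t a) ^- M.+1.

Lemma sum_subset_inj (I J : finType) (f : I -> J) (V : nmodType) (G : {set J} -> V)
    (S : {set I}) : injective f ->
  \sum_(A : {set J} | A \subset f @: S) G A = \sum_(A : {set I} | A \subset S) G (f @: A).
Proof.
move=> fI.
rewrite (reindex_onto (fun A : {set I} => f @: A) (fun A => f @^-1: A)) /=; last first.
  move=> A /subsetP AS; apply/setP => b; apply/imsetP/idP => [[a]|bA].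
    by rewrite inE => ? ->.
  by have /imsetP[a aS ba] := AS b bA; exists a => //; rewrite inE -ba.
have imK (A : {set I}) : f @^-1: (f @: A) = A.
  by apply/setP => a; rewrite inE mem_imset.
apply: eq_bigl => A; rewrite imK eqxx andbT.
by apply/idP/idP => [/(preimsetS f)|/(imsetS f) //]; rewrite !imK.
Qed.

Lemma prod_setD_inj (I J : finType) (f : I -> J) (t : J -> K) (S A : {set I}) :
  injective f -> \prod_(b in f @: S :\: f @: A) t b = \prod_(a in S :\: A) t (f a).
Proof.
move=> fI; rewrite -(big_imset (fun b => t b) (in2W fI)) /=.
apply: eq_bigl => b; rewrite inE.
apply/andP/imsetP => [[bA /imsetP[a aS ba]]|[a]].
  by exists a => //; rewrite inE aS andbT; apply: contra bA => aA; rewrite ba imset_f.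
by rewrite inE => /andP[aA aS] ->; rewrite !mem_imset.
Qed.

(** With [rowsum_inj], this trades subsets of ['I_n] for full sets of smaller ordinals: the first
    [k] indices in the residue, the last [n - k] in the remaining function. *)
Lemma Phi_inj (I J : finType) (f : I -> J) (q x : K) (t : J -> K) M (S : {set I}) :
  injective f -> Phi q x t M (f @: S) = Phi q x (t \o f) M S.
Proof.
move=> fI; elim: M S => [|M IH] S.
  by rewrite !Phi0 -(inj_eq (imset_inj fI)) imset0.
rewrite !PhiS (big_imset t (in2W fI)).
congr (_ * _); rewrite sum_subset_inj //.
by apply: eq_bigr => A _; rewrite IH prod_setD_inj.
Qed.

Lemma rowsum_inj (I J : finType) (f : I -> J) (q x : K) (t : J -> K) M (S : {set I}) :
  injective f -> rowsum q x t M (f @: S) = rowsum q x (t \o f) M S.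
Proof.
move=> fI; rewrite /rowsum sum_subset_inj //.
by apply: eq_bigr => A _; rewrite Phi_inj // prod_setD_inj.
Qed.

End RowSums.

(** * The residue identity *)

(** The summands are the Lagrange basis polynomials of the nodes [x], evaluated at 0. These
    polynomials add up to 1, since the difference has degree at most [m] and [m + 1] roots. *)
Lemma lagrange_sum (K : fieldType) m (x : 'I_m.+1 -> K) : injective x ->
  \sum_c \prod_(h | h != c) (x h / (x h - x c)) = 1.
Proof.
move=> xI.
pose L c : {poly K} := (\prod_(h | h != c) (x h - x c))^-1 *:
  \prod_(h | h != c) ((x h)%:P - 'X).
pose p := \sum_c L c - 1.
have Lx c d : (L c).[x d] = (c == d)%:R.
  rewrite /L hornerZ horner_prod; case: eqVneq => [->|cd].
    rewrite [X in _ * X](eq_bigr (fun h => x h - x d)); last first.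
      by move=> h _; rewrite hornerD hornerN hornerX hornerC.
    by rewrite mulVf //; apply/prodf_neq0 => h hd; rewrite subr_eq0 (inj_eq xI).
  by rewrite [X in _ * X](bigD1 d) 1?eq_sym //= hornerD hornerN hornerX hornerC subrr mul0r mulr0.
have sizeL c : (size (L c) <= m.+1)%N.
  rewrite (leq_trans (size_scale_leq _ _)) //.
  have := size_poly_prod_leq (fun h => h != c) (fun h => (x h)%:P - 'X : {poly K}).
  have s2 h : size ((x h)%:P - 'X : {poly K}) = 2.
    by rewrite -opprB size_polyN size_XsubC.
  rewrite (eq_bigr (fun=> 2) (fun h _ => s2 h)).
  by rewrite sum_nat_const cardC1 card_ord muln2 -addnn subSn ?leq_addr // addnK.
have p0 : p = 0.
  apply: (@roots_geq_poly_eq0 _ _ [seq x i | i <- enum 'I_m.+1]).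
  - apply/allP => _ /mapP[d _ ->]; rewrite rootE /p hornerD hornerN hornerC horner_sum.
    rewrite (eq_bigr (fun c => (c == d)%:R)) => [|c _]; last exact: Lx.
    by rewrite (bigD1 d) //= eqxx big1 ?addr0 ?subrr // => c /negbTE ->.
  - by rewrite map_inj_uniq // enum_uniq.
  - rewrite size_map size_enum_ord (leq_trans (size_polyD _ _)) // size_polyN size_poly1.
    by rewrite geq_max andbT; apply/(leq_trans (size_sum _ _ _))/bigmax_leqP.
have := congr1 (horner^~ 0) p0; rewrite /p hornerD hornerN hornerC horner0 horner_sum.
move/eqP; rewrite subr_eq0 => /eqP sum1; rewrite -[RHS]sum1; apply: eq_bigr => c _.
rewrite /L hornerZ horner_prod -prodfV -big_split; apply: eq_bigr => h _ /=.
by rewrite hornerD hornerN hornerX hornerC subr0 mulrC.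
Qed.

Lemma modn_lt2 a d : (a < d + d)%N -> (a %% d = if (d <= a)%N then a - d else a)%N.
Proof.
move=> h; case: leqP => [le|lt]; last by rewrite modn_small.
by rewrite -{1}(subnK le) modnDr modn_small //; lia.
Qed.

Section CyclicSum.
Variables (K : fieldType) (I : finType) (q : K) (t : I -> K) (m : nat).
Implicit Types (i j : {ffun I -> 'I_m.+1}) (S A : {set I}).

Let kap h S := (1 - q ^+ h * 1 * \prod_(a in S) t a)^-1.
Definition below h i : {set I} := [set a | (i a < h)%N].
(** [i a] is the row of the factor [a], counted from 0. While [M <= m] the value [ord_max] means not
    yet placed; in [last_row_sum] it becomes the genuine row [m + 1]. *)
Definition placed M S i :=
  [forall a, if a \in S then (i a < M)%N else i a == ord_max].
Definition weight M i :=
  (\prod_(a | (i a < M)%N) t a ^- (i a).+1) * \prod_(h < M) kap h.+1 (below h.+1 i).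

Lemma placed_below M S i : (M <= m)%N -> placed M S i -> below M i = S.
Proof.
move=> Mm /forallP h; apply/setP => a; rewrite inE; have := h a.
case: (a \in S) => [->//|/eqP ->] /=; apply/negbTE; by rewrite -leqNgt.
Qed.

(** Unrolls the recursion: an increasing chain of subsets is the same thing as a map sending each
    factor to its row, the subsets being the sublevel sets of the map. *)
Lemma Phi_fun M S : (M <= m)%N -> Phi q 1 t M S = \sum_(i | placed M S i) weight M i.
Proof.
elim: M S => [|M IH] S Mm.
  rewrite Phi0; have [->|S0] := eqVneq S set0.
    rewrite (bigD1 [ffun=> ord_max]) /=; last by apply/forallP => a; rewrite inE ffunE.
    rewrite /weight big_ord0 mulr1 big_pred0 // big1 ?addr0 //.
    move=> i /andP[/forallP h /eqP[]]; apply/ffunP => a; rewrite ffunE.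
    by have := h a; rewrite inE => /eqP.
  have /set0Pn[a aS] := S0; rewrite big_pred0 // => i.
  by apply/negP => /forallP /(_ a); rewrite aS.
have ltM : (M < m.+1)%N by rewrite ltnW.
pose oM : 'I_m.+1 := Ordinal ltM.
rewrite PhiS (partition_big (fun i => below M i) (fun A => A \subset S)) /=; last first.
  move=> i /forallP h; apply/subsetP => a; rewrite inE => ia; have := h a.
  case: (a \in S) => // /eqP E; move: ia; rewrite E /=; lia.
rewrite mulr_sumr; apply: eq_bigr => A AS; rewrite IH 1?ltnW // mulr_suml mulr_sumr.
(* [up] moves the factors of [S :\: A] from the marker to the new row and [dn] moves them back; they
   are inverse to each other on placements whose sublevel set is [A]. *)
pose up j : {ffun I -> 'I_m.+1} := [ffun a => if a \in S :\: A then oM else j a].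
pose dn i : {ffun I -> 'I_m.+1} := [ffun a => if a \in S :\: A then ord_max else i a].
rewrite [RHS](reindex_onto up dn) /=; last first.
  move=> i /andP[/forallP hi /eqP iA]; apply/ffunP => a; rewrite !ffunE.
  case aSA: (a \in S :\: A) => //; move: aSA; rewrite inE => /andP[aA aS]; apply/val_inj => /=.
  have := hi a; rewrite aS; move: aA; rewrite -iA inE; lia.
have subA a : a \in A -> a \in S by move/(subsetP AS).
apply: eq_big => [j|j pj].
  apply/forallP/andP => [h|[/andP[/forallP h /eqP bA] /eqP dj] a].
    split; [apply/andP; split|].
    - apply/forallP => a; rewrite ffunE inE; have := h a; have := subA a.
      case: (a \in A) => /=; first by move=> /(_ isT) ->; lia.
      by case: (a \in S) => //= _ _.
    - apply/eqP/setP => a; rewrite !inE ffunE inE; have := h a; have := subA a.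
      case: (a \in A) => /= [_ -> //|_].
      by case: (a \in S) => /= /eqP; rewrite ?ltnn // => -> /=; lia.
    - apply/eqP/ffunP => a; rewrite !ffunE inE; have := h a.
      by case: (a \in A) => //= /eqP ->; case: (a \in S).
  have ha := h a; move/setP: bA => /(_ a); move/ffunP: dj => /(_ a); move: ha.
  rewrite !inE !ffunE !inE.
  by case: (a \in A); case: (a \in S) => //= _ <-.
have upv a : up j a = (if a \in S :\: A then oM else j a) by rewrite ffunE.
have bj := placed_below (ltnW Mm) pj.
have bup h : (h <= M)%N -> below h (up j) = below h j.
  move=> hM; apply/setP => a; rewrite !inE upv inE.
  case aA : (a \in A) => //=; case aS : (a \in S) => //=.
  have := forallP pj a; rewrite aA => /eqP -> /=; lia.
have bS : below M.+1 (up j) = S.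
  apply/setP => a; rewrite !inE upv inE; have := forallP pj a; have := subA a.
  case: (a \in A) => /= [/(_ isT) ->|_]; first lia.
  case: (a \in S) => /= [|/eqP -> /=]; lia.
rewrite /weight big_ord_recr /= bS.
rewrite [X in _ = _ * (X * _)](eq_bigr (fun h : 'I_M => kap h.+1 (below h.+1 j))); last first.
  by move=> h _; rewrite bup.
have -> : \prod_(a | (up j a < M.+1)%N) t a ^- (up j a).+1 =
   \prod_(a in S) t a ^- (up j a).+1.
  by apply: eq_bigl => a; move/setP: bS => /(_ a); rewrite inE.
have -> : \prod_(a | (j a < M)%N) t a ^- (j a).+1 = \prod_(a in A) t a ^- (j a).+1.
  by apply: eq_bigl => a; move/setP: bj => /(_ a); rewrite inE.
rewrite (prod_setD (fun a => t a ^- (up j a).+1) AS).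
have -> : \prod_(a in A) t a ^- (up j a).+1 = \prod_(a in A) t a ^- (j a).+1.
  by apply: eq_bigr => a aA; rewrite upv inE aA.
have -> : \prod_(a in S :\: A) t a ^- (up j a).+1 = (\prod_(a in S :\: A) t a) ^- M.+1.
  rewrite -exprVn -prodfV -prodrXl; apply: eq_bigr => a aSA.
  by rewrite upv aSA /= exprVn.
by rewrite /kap; ring.
Qed.

Lemma placedE S i : placed m S i = (S == below m i).
Proof.
apply/idP/eqP => [/placed_below -> //|->]; apply/forallP => a; rewrite inE.
by case: ltnP => // h; apply/eqP/val_inj => /=; have := ltn_ord (i a); lia.
Qed.

(** The factors outside [B] go to row [m + 1], whose index is the marker itself. No constraint
    remains, so the sum runs over all maps to ['I_m.+1], and rotation acts on these. *)
Lemma last_row_sum : \sum_(B : {set I}) Phi q 1 t m B * (\prod_(a in ~: B) t a) ^- m.+1 =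
  \sum_(i : {ffun I -> 'I_m.+1}) (\prod_a t a ^- (i a).+1) * \prod_(h < m) kap h.+1 (below h.+1 i).
Proof.
transitivity (\sum_(B : {set I}) \sum_(i | placed m B i)
   weight m i * (\prod_(a in ~: B) t a) ^- m.+1).
  by apply: eq_bigr => B _; rewrite Phi_fun // mulr_suml.
rewrite (exchange_big_dep xpredT) //=; apply: eq_bigr => i _.
rewrite (big_pred1 (below m i)) => [|B]; last exact: placedE.
rewrite /weight mulrAC; congr (_ * _).
rewrite [RHS](bigID (fun a => i a < m)%N) /=; congr (_ * _).
rewrite -exprVn -prodfV -prodrXl; apply: eq_big => [a|a]; first by rewrite !inE.
by rewrite !inE exprVn => ia; congr (_ ^- _.+1); have := ltn_ord (i a); lia.
Qed.

(** The [x_h] of Lagrange's identity. Exponents 0 and 1 replace the set [below h i], so that the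
    effect of a rotation can be checked exponent by exponent. *)
Definition chain h i : K := q ^+ h * \prod_a t a ^+ (i a < h)%N.

Lemma chainE h i : chain h i = q ^+ h * 1 * \prod_(a in below h i) t a.
Proof.
rewrite mulr1 /chain; congr (_ * _); rewrite [RHS]big_mkcond; apply: eq_bigr => a _.
by rewrite inE; case: (i a < h)%N; rewrite ?expr1 ?expr0.
Qed.

Hypothesis q0 : q != 0.
Hypothesis t0 : forall a, t a != 0.
Hypothesis qT : q ^+ m.+1 * \prod_a t a = 1.
Hypothesis m0 : m.+1%:R != 0 :> K.
Hypothesis hne : forall h (B : {set I}), (0 < h <= m)%N -> q ^+ h * \prod_(a in B) t a != 1.

Definition rot (c : 'I_m.+1) i : {ffun I -> 'I_m.+1} := [ffun a => i a - c].

(** Rotation rescales the whole chain by one constant. When [h + c] passes [m], the exponent of [q]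
    drops by [m + 1] and that of every [t_a] by 1, which is harmless because [q ^+ m.+1 * T = 1]. *)
Lemma rot_chain c (h : 'I_m.+1) i :
  chain h (rot c i) * chain c i = chain ((h + c)%R : 'I_m.+1) i.
Proof.
have pq : q ^+ h * q ^+ c = q ^+ (h + c)%R * (q ^+ m.+1) ^+ (m < h + c)%N.
  rewrite -!exprD -exprM -exprD; congr (_ ^+ _) => /=.
  have := ltn_ord h; have := ltn_ord c => h1 h2.
  by rewrite modn_lt2; [case: ltnP; lia | lia].
have pt a : t a ^+ (rot c i a < h)%N * t a ^+ (i a < c)%N =
   t a ^+ (i a < (h + c)%R)%N * t a ^+ (m < h + c)%N.
  rewrite -!exprD; congr (_ ^+ _); rewrite ffunE /=.
  have := ltn_ord h; have := ltn_ord c; have := ltn_ord (i a).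
  move: (i a : nat) (h : nat) (c : nat) => j h' c' hj hc hh.
  rewrite !modn_lt2; try lia; last by case: (ltnP m (m.+1 - c')); lia.
  case: (leqP m.+1 (h' + c')) => e1; case: (leqP m.+1 (m.+1 - c')) => e2.
  - case: (ltnP m (j + (m.+1 - c' - m.+1))) => e3; lia.
  - case: (ltnP m (j + (m.+1 - c'))) => e3; lia.
  - case: (ltnP m (j + (m.+1 - c' - m.+1))) => e3; lia.
  - case: (ltnP m (j + (m.+1 - c'))) => e3; lia.
rewrite /chain mulrACA pq -big_split /=.
rewrite (eq_bigr _ (fun a _ => pt a)) big_split /= mulrACA.
rewrite [X in _ * X](_ : _ = 1) ?mulr1 //.
by rewrite (prodrXl (m < h + c)%N _ xpredT) -exprMn qT expr1n.
Qed.

Lemma chain_neq0 h i : chain h i != 0.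
Proof. by rewrite mulf_neq0 ?expf_neq0 //; apply/prodf_neq0 => a _; rewrite expf_neq0. Qed.

Lemma chain_neq1 (h : 'I_m.+1) i : h != 0 -> 1 - chain h i != 0.
Proof.
move=> h0; rewrite chainE mulr1 subr_eq0 eq_sym; apply: hne.
have := ltn_ord h; rewrite ltnS => ->; rewrite andbT lt0n.
by apply: contra h0 => /eqP e; apply/eqP/val_inj.
Qed.

(** The sum is counted [m + 1] times, once after each rotation; for fixed [i] the [m + 1] rotated
    terms add up to [(-1) ^+ m] by [lagrange_sum]. Dividing the number [(m + 1) ^ #|I|] of maps by
    [m + 1] lowers the exponent to [#|I| - 1]. *)
Lemma cyclic_sum : (0 < #|I|)%N ->
  \sum_(i : {ffun I -> 'I_m.+1}) \prod_(h < m.+1 | h != 0) (chain h i / (1 - chain h i)) =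
    (-1) ^+ m * (m.+1 ^ (#|I| - 1))%:R.
Proof.
move=> I0; pose X i := \prod_(h < m.+1 | h != 0) (chain h i / (1 - chain h i)).
have rI c : bijective (rot c).
  exists (rot (- c)) => i; apply/ffunP => a; rewrite !ffunE opprK.
    by rewrite subrK.
  by rewrite addrK.
have mX : m.+1%:R * \sum_(i : {ffun I -> 'I_m.+1}) X i = (m.+1 ^ #|I|)%:R * (-1) ^+ m.
  transitivity (\sum_(c < m.+1) \sum_(i : {ffun I -> 'I_m.+1}) X (rot c i)).
    rewrite [RHS](eq_bigr (fun=> \sum_(i : {ffun I -> 'I_m.+1}) X i)) => [|c _]; last first.
      by rewrite [RHS](reindex (rot c)) //; exact: onW_bij.
    by rewrite sumr_const card_ord mulr_natl.
  rewrite exchange_big /= (eq_bigr (fun=> (-1) ^+ m)) => [|i _].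
    by rewrite sumr_const card_ffun card_ord mulr_natl.
  have -> : (-1) ^+ m = (-1) ^+ m * \sum_c \prod_(h < m.+1 | h != c)
      (chain h i / (chain h i - chain c i)) :> K.
    (* The nodes are distinct: equal values at [h] and [c] would make [chain (h - c)] of a rotated
       map equal to 1. *)
    rewrite lagrange_sum ?mulr1 // => h c hc.
    apply/eqP; rewrite -subr_eq0; apply: contraT => hc0.
    have := chain_neq1 (rot c i) hc0; rewrite subr_eq0 => /eqP[].
    by apply: (mulIf (chain_neq0 c i)); rewrite mul1r rot_chain subrK.
  rewrite mulr_sumr; apply: eq_bigr => c _.
  rewrite [RHS](_ : _ = \prod_(h < m.+1 | h != c) (chain h i / (chain c i - chain h i))); last first.
    have -> : (-1) ^+ m = \prod_(h < m.+1 | h != c) (-1) :> K.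
      by rewrite prodr_const cardC1 card_ord.
    rewrite -big_split; apply: eq_bigr => h _ /=.
    by rewrite -[chain c i - _]opprB invrN mulrN mulN1r.
  rewrite [RHS](reindex_inj (addIr c)) /=; apply: eq_big => [h|h h0].
    by rewrite -[in RHS]subr_eq0 addrK.
  have c0 := chain_neq0 c i.
  rewrite -(rot_chain c h i); move: (chain h (rot c i)) (chain c i) c0 => x y y0.
  have -> : y - x * y = (1 - x) * y by rewrite mulrBl mul1r.
  by rewrite invfM mulrACA divff // mulr1.
apply: (mulfI m0); rewrite [LHS]mX mulrCA -natrM -expnS mulrC; congr (_ * (_ ^ _)%:R).
by rewrite subn1 prednK.
Qed.

(** The product of the chain is [q ^+ 'C(m.+1, 2)] times the powers [t_a ^+ (m - i a)]. Multiplied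
    by [q ^+ 'C(m.+2, 2)] it contains [q] to the power [(m + 1) ^ 2], which is [T ^- m.+1] on the
    divisor; what is left is the weight [t_a ^- (i a).+1] of the placement. *)
Lemma residue_identity : (0 < #|I|)%N ->
  rowsum q 1 t m finset.setT = (-1) ^+ m * q ^+ 'C(m.+2, 2) * (m.+1 ^ (#|I| - 1))%:R.
Proof.
have -> : rowsum q 1 t m finset.setT =
  \sum_(B : {set I}) Phi q 1 t m B * (\prod_(a in ~: B) t a) ^- m.+1.
  apply: eq_big => [B|B _]; first exact: subsetT.
  by congr (_ / _ ^+ _); apply: eq_bigl => a; rewrite !inE andbT.
move=> I0; rewrite last_row_sum mulrAC -cyclic_sum // mulr_suml; apply: eq_bigr => i _.
have ordS (F : nat -> K) : \prod_(h < m.+1 | h != 0) F h = \prod_(h < m) F h.+1.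
  by rewrite big_mkcond big_ord_recl /= mul1r.
rewrite (ordS (fun h => chain h i / (1 - chain h i))) big_split /=.
rewrite [RHS]mulrAC; congr (_ * _); last by apply: eq_bigr => h _; rewrite chainE.
have prodchain : \prod_(h < m.+1) chain h i =
   q ^+ 'C(m.+1, 2) * \prod_a t a ^+ (m - i a).
  rewrite big_split /= prodrXr -bin2_sum -(big_mkord xpredT id); congr (_ * _).
  rewrite exchange_big; apply: eq_bigr => a _ /=; rewrite prodrXr; congr (_ ^+ _).
  have := ltn_ord (i a); move: (i a : nat) => j jm.
  have h n : (\sum_(h < n) (j < h) = n.-1 - j)%N.
    elim: n => [|n IH]; first by rewrite big_ord0.
    by rewrite big_ord_recr /= IH; case: ltnP; lia.
  by rewrite h.
have -> : \prod_(h < m) chain h.+1 i = \prod_(h < m.+1) chain h i.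
  by rewrite [RHS]big_ord_recl /chain expr0 mul1r [X in X * _]big1 ?mul1r.
rewrite prodchain mulrAC -exprD.
have -> : ('C(m.+1, 2) + 'C(m.+2, 2) = m.+1 * m.+1)%N.
  move: (m.+1) => n; elim: n => // n IH; rewrite binS bin1 in IH.
  by rewrite !(binS, bin1, bin0); lia.
rewrite exprM.
have -> : q ^+ m.+1 = (\prod_a t a)^-1.
  by apply: (mulIf (x := \prod_a t a)); [apply/prodf_neq0 | rewrite qT mulVf //; apply/prodf_neq0].
rewrite -prodfV -prodrXl -big_split; apply: eq_bigr => a _ /=.
have := ltn_ord (i a); rewrite ltnS => ia.
have -> : (t a)^-1 ^+ m.+1 = (t a)^-1 ^+ (m - i a) * (t a)^-1 ^+ (i a).+1.
  by rewrite -exprD; congr (_ ^+ _); lia.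
by rewrite !exprVn mulrAC mulVf ?expf_neq0 // mul1r.
Qed.

End CyclicSum.

(** * Partitions as lists *)

Section PartitionLists.
Local Open Scope nat_scope.
Implicit Types (l : seq nat) (M L N : nat).

Definition part l := sorted geq l && all (fun x => 0 < x) l.
(** Common normal form for two paddings by zeros: to length [N] in [ptuple] and to length [M] in
    [box]. *)
Definition trim l := [seq x <- l | 0 < x].

Lemma path_geq0 l : path geq 0 l -> l = nseq (size l) 0.
Proof.
elim: l => //= x l IH /andP[]; rewrite /geq /= leqn0 => /eqP -> /IH E.
by rewrite {1}E.
Qed.

Lemma trimK l : sorted geq l -> l = trim l ++ nseq (size l - size (trim l)) 0.
Proof.
elim: l => //= x l IH px; have [x0|x0] := posnP x; last first.
  by rewrite /= subSS -IH //; exact: path_sorted px.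
have E : l = nseq (size l) 0 by apply: path_geq0; rewrite -x0.
have -> : trim l = [::] by rewrite /trim E filter_nseq.
by rewrite /= {1}E x0.
Qed.

Lemma nth_trim l i : sorted geq l -> nth 0 (trim l) i = nth 0 l i.
Proof.
move=> /trimK E; rewrite [in RHS]E nth_cat; case: ltnP => // h.
by rewrite nth_nseq if_same nth_default.
Qed.

Lemma sumn_trim l : sumn (trim l) = sumn l.
Proof. by elim: l => //= x l IH; case: posnP => [->//|_] /=; rewrite IH. Qed.

Lemma part_trim l : sorted geq l -> part (trim l).
Proof.
move=> s; rewrite /part filter_all andbT; apply: sorted_filter => // x y z.
by rewrite /geq /= => h1 h2; exact: leq_trans h2 h1.
Qed.

Lemma trim_inj l l' : sorted geq l -> sorted geq l' -> size l = size l' ->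
  trim l = trim l' -> l = l'.
Proof. by move=> /trimK E /trimK E' s e; rewrite E E' s e. Qed.

Lemma trim_pad l k : part l -> trim (l ++ nseq k 0) = l.
Proof.
case/andP=> _ h; rewrite /trim filter_cat filter_nseq cats0; exact/all_filterP.
Qed.

Lemma sorted_pad l k : sorted geq l -> sorted geq (l ++ nseq k 0).
Proof.
have pz x : path geq x (nseq k 0) by elim: k x => //= k IH x; rewrite /geq /= leq0n IH.
case: l => [_|x l] /=; first by case: k pz => //= k pz; have /= := pz 0.
by rewrite cat_path => -> /=.
Qed.

Lemma size_part l : part l -> size l <= sumn l.
Proof.
case/andP=> _; elim: l => //= x l IH /andP[x0 /IH h]; rewrite -add1n; exact: leq_add.
Qed.

Lemma le_sumn l x : x \in l -> x <= sumn l.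
Proof.
elim: l => //= y l IH; rewrite in_cons => /orP[/eqP ->|/IH h]; first exact: leq_addr.
exact: leq_trans h (leq_addl _ _).
Qed.

Lemma nth_le_sumn l i : nth 0 l i <= sumn l.
Proof.
have [h|h] := ltnP i (size l); last by rewrite nth_default.
by apply: le_sumn; exact: mem_nth.
Qed.

Definition parts_of N : seq (seq nat) :=
  [seq trim (map (@nat_of_ord N.+1) s) | s : N.-tuple 'I_N.+1 <- enum (@ptuple N)].

Lemma parts_of_uniq N : uniq (parts_of N).
Proof.
rewrite map_inj_in_uniq ?enum_uniq // => s s'; rewrite !mem_enum => /andP[h _] /andP[h' _].
move/(trim_inj h h'); rewrite !size_map !size_tuple => /(_ erefl) e.
by apply/val_inj/(inj_map (@ord_inj _)).
Qed.

Lemma mem_parts_of N l : (l \in parts_of N) = part l && (sumn l == N).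
Proof.
apply/mapP/andP => [[s]|[pl /eqP sl]].
  rewrite mem_enum => /andP[h e] ->; split; first exact: part_trim.
  by rewrite sumn_trim.
have szN : size l <= N by rewrite -sl; exact: size_part.
pose l' := l ++ nseq (N - size l) 0.
have sz' : size l' = N by rewrite size_cat size_nseq subnKC.
have sz'' : size [seq inord x : 'I_N.+1 | x <- l'] == N by rewrite size_map sz'.
have E : map (@nat_of_ord N.+1) (Tuple sz'') = l'.
  rewrite /= -map_comp -[RHS]map_id; apply/eq_in_map => x /=.
  rewrite mem_cat => xl; rewrite inordK // ltnS; case/orP: xl => [/le_sumn|].
    by rewrite sl.
  by rewrite mem_nseq => /andP[_ /eqP ->].
exists (Tuple sz''); last by rewrite E trim_pad.
rewrite mem_enum /in_mem /= /ptuple E sorted_pad; last by case/andP: pl.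
by rewrite sumn_cat sumn_nseq mul0n addn0 sl eqxx.
Qed.

Definition parts_below K := flatten [seq parts_of N | N <- iota 0 K].

Lemma mem_parts_below K l : (l \in parts_below K) = part l && (sumn l < K).
Proof.
apply/flattenP/andP => [[s /mapP[N]]|[pl lK]].
  rewrite mem_iota /= add0n => NK ->; rewrite mem_parts_of => /andP[-> /eqP ->]; by [].
exists (parts_of (sumn l)); last by rewrite mem_parts_of pl /=.
by apply/map_f; rewrite mem_iota.
Qed.

Lemma parts_belowS K : parts_below K.+1 = parts_below K ++ parts_of K.
Proof. by rewrite /parts_below -{1}addn1 iotaD map_cat flatten_cat /= cats0. Qed.

Lemma parts_below_uniq K : uniq (parts_below K).
Proof.
elim: K => // K IH; rewrite parts_belowS cat_uniq IH parts_of_uniq andbT /=.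
apply/hasPn => l; rewrite mem_parts_of mem_parts_below => /andP[-> /eqP ->] /=.
by rewrite ltnn.
Qed.

(* Nonincreasing sequences of length M with consecutive differences (and last term) <= L. *)
Fixpoint box L M : seq (seq nat) :=
  if M is M'.+1 then
    [seq map (addn c) (rcons l 0) | c <- iota 0 L.+1, l <- box L M']
  else [:: [::]].

Lemma box_prop L M l : l \in box L M -> size l = M /\ sorted geq l.
Proof.
elim: M l => [|M IH] l; first by rewrite inE => /eqP ->.
case/allpairsP => -[c l'] /= [_ /IH [sz st] ->]; rewrite size_map size_rcons sz; split=> //.
rewrite sorted_map (@eq_sorted _ _ geq) => [|x y]; last by rewrite /geq /= leq_add2l.
by have := @sorted_pad l' 1 st; rewrite cats1.
Qed.

Lemma box_uniq L M : uniq (box L M).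
Proof.
elim: M => // M IH; apply: allpairs_uniq => //; first exact: iota_uniq.
move=> [c l] [c' l'] _ _ /=.
rewrite !map_rcons !addn0 => /rcons_inj [e ec]; subst c'; congr pair.
by apply: (inj_map _ e); exact: addnI.
Qed.

(** The last entry counts the columns of full height. Subtracting it leaves a shorter nonincreasing
    sequence whose entries are still at most [L]. *)
Lemma mem_box L M l : size l = M -> sorted geq l -> all (fun x => x <= L) l -> l \in box L M.
Proof.
elim: M l => [|M IH] l; first by move/size0nil ->.
case/lastP: l => // l c; rewrite size_rcons => -[sz] st; rewrite all_rcons => /andP[cL aL].
have st' : sorted geq l by case: (l) st => //= x s; rewrite rcons_path => /andP[].
have cl : all (fun x => c <= x) l.
  have tr : transitive geq by move=> x y z h1 h2; exact: leq_trans h2 h1.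
  move: st; rewrite (sorted_pairwise tr) -cats1 pairwise_cat => /andP[h _].
  by apply/allP => x xl; move/allrelP: h => /(_ x c xl); apply; rewrite inE.
apply/allpairsP; exists (c, map (subn^~ c) l); split.
- by rewrite mem_iota.
- apply: IH => /=; first by rewrite size_map.
    rewrite sorted_map; apply: sub_sorted st' => y z.
    by rewrite /geq /=; exact: leq_sub2r.
  by rewrite all_map; apply: sub_all aL => x /=; exact: leq_trans (leq_subr _ _).
- rewrite /= map_rcons addn0 -map_comp; congr rcons; rewrite -[LHS]map_id.
  by apply/eq_in_map => x /(allP cl) /= h; rewrite subnKC.
Qed.

End PartitionLists.

Lemma prodD_subset (K : comNzRingType) (I : finType) (F G : I -> K) (S : {set I}) :
  \prod_(a in S) (F a + G a) = \sum_(A : {set I} | A \subset S)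
    (\prod_(a in A) F a) * \prod_(a in S :\: A) G a.
Proof.
transitivity (\prod_a ((if a \in S then F a else 0) + (if a \in S then G a else 1))).
  by rewrite big_mkcond; apply: eq_bigr => a _; case: ifP => // _; rewrite add0r.
rewrite bigA_distr [RHS]big_mkcond; apply: eq_bigr => A _; case: ifP => AS.
  rewrite [X in X * _]big_mkcond [X in _ * X]big_mkcond -big_split; apply: eq_bigr => a _ /=.
  rewrite inE; have := subsetP AS a; case: (a \in A) => [/(_ isT) ->|_] /=; first by rewrite mulr1.
  by rewrite mul1r.
have /subsetPn[a aA aS] := negbT AS.
by rewrite (bigD1 a) //= aA (negbTE aS) mul0r.
Qed.

(** Bounding the column multiplicities by [L] truncates each geometric series, which keeps the
    identity between finite sums. *)
Lemma box_sum (K : fieldType) (I : finType) (q : K) (t : I -> K) L M (S : {set I}) :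
  (forall a, t a != 0) ->
  \sum_(l <- box L M) q ^+ sumn l * \prod_(a in S) \sum_(i < M) t a ^+ nth 0%N l i * t a ^- i.+1
  = rows (fun h A => \sum_(c < L.+1) (q ^+ h * \prod_(a in A) t a) ^+ c) t M S.
Proof.
move=> t0; elim: M S => [|M IH] S.
  rewrite /= big_seq1 expr0 mul1r; have [->|/set0Pn[a aS]] := eqVneq S set0.
    by rewrite big_set0.
  by rewrite (bigD1 a) //= big_ord0 mul0r.
have sumn_add c l : sumn (map (addn c) l) = (c * size l + sumn l)%N.
  by elim: l => [|y l IHl] /=; [rewrite muln0 | rewrite IHl; lia].
(* Adding [c] to all [M + 1] rows multiplies the term by [(q ^+ M.+1 * T_S) ^+ c]. Before that the
   new row has length 0, so expanding the product over [S] separates the factors placed in it. *)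
have step c l : size l = M -> q ^+ sumn (map (addn c) (rcons l 0%N)) *
   \prod_(a in S) \sum_(i < M.+1) t a ^+ nth 0%N (map (addn c) (rcons l 0%N)) i * t a ^- i.+1 =
   (q ^+ M.+1 * \prod_(a in S) t a) ^+ c *
   \sum_(A : {set I} | A \subset S) (q ^+ sumn l *
      \prod_(a in A) \sum_(i < M) t a ^+ nth 0%N l i * t a ^- i.+1)
      * (\prod_(a in S :\: A) t a) ^- M.+1.
  move=> sl; rewrite sumn_add size_rcons sl sumn_rcons addn0 exprD exprMn -exprM [(M.+1 * c)%N]mulnC.
  have -> : \sum_(A : {set I} | A \subset S) (q ^+ sumn l *
      \prod_(a in A) \sum_(i < M) t a ^+ nth 0%N l i * t a ^- i.+1) *
      (\prod_(a in S :\: A) t a) ^- M.+1 = q ^+ sumn l * \prod_(a in S)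
     ((\sum_(i < M) t a ^+ nth 0%N l i * t a ^- i.+1) + t a ^- M.+1).
    rewrite prodD_subset mulr_sumr; apply: eq_bigr => A _; rewrite -mulrA; congr (_ * (_ * _)).
    by rewrite -exprVn -prodfV -prodrXl; apply: eq_bigr => a _; rewrite exprVn.
  rewrite [RHS]mulrACA; congr (_ * _).
  rewrite -prodrXl -big_split; apply: eq_bigr => a _ /=.
  rewrite big_ord_recr /= (nth_map 0%N) ?size_rcons ?sl // nth_rcons sl ltnn eqxx addn0.
  rewrite mulrDr mulr_sumr; congr (_ + _); apply: eq_bigr => i _.
  by rewrite (nth_map 0%N) ?size_rcons ?sl ?ltnS 1?ltnW // nth_rcons sl ltn_ord exprD mulrA.
rewrite [LHS]big_allpairs_dep /= mulr_suml.
transitivity (\sum_(c <- iota 0 L.+1) \sum_(l <- box L M)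
   (q ^+ M.+1 * \prod_(a in S) t a) ^+ c *
   \sum_(A : {set I} | A \subset S) (q ^+ sumn l *
      \prod_(a in A) \sum_(i < M) t a ^+ nth 0%N l i * t a ^- i.+1)
      * (\prod_(a in S :\: A) t a) ^- M.+1).
  apply: eq_bigr => c _; rewrite big_seq [RHS]big_seq; apply: eq_bigr => l /box_prop [sl _].
  exact: step.
rewrite -(big_mkord xpredT (fun c => (q ^+ M.+1 * \prod_(a in S) t a) ^+ c * _)) /index_iota subn0.
apply: eq_bigr => c _; rewrite -mulr_sumr; congr (_ * _).
rewrite exchange_big /=; apply: eq_bigr => A _.
by rewrite -mulr_suml IH.
Qed.

From mathcomp Require Import all_classical all_reals all_analysis.
Import Order.TTheory GRing.Theory Num.Theory.
Import numFieldNormedType.Exports.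
Local Open Scope classical_set_scope.
Local Open Scope ring_scope.

(** * Complex moduli and limits *)

Section ComplexModulus.
Variable R : realType.
Local Notation C := (Cx R).
Implicit Types (x y z w : C) (a b : R).

Definition rc a : C := a%:C%C.
Definition ci : C := 'i%C.
(** The norm of [Cx R] takes its values in [Cx R]; a modulus with values in [R] opens the estimates
    to [lra] and [nra]. *)
Definition cabs z : R := Num.sqrt (complex.Re z ^+ 2 + complex.Im z ^+ 2).

Lemma normE z : `|z| = rc (cabs z).
Proof. exact: normc_def. Qed.

Lemma rc_inj : injective rc. Proof. exact: complexI. Qed.
Lemma rc0 : rc 0 = 0. Proof. by []. Qed.
Lemma rc1 : rc 1 = 1. Proof. by []. Qed.
Lemma rcD a b : rc (a + b) = rc a + rc b. Proof. exact: (rmorphD (real_complex R)). Qed.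
Lemma rcN a : rc (- a) = - rc a. Proof. exact: (rmorphN (real_complex R)). Qed.
Lemma rcB a b : rc (a - b) = rc a - rc b. Proof. exact: (rmorphB (real_complex R)). Qed.
Lemma rcM a b : rc (a * b) = rc a * rc b. Proof. exact: (rmorphM (real_complex R)). Qed.
Lemma rcV a : rc a^-1 = (rc a)^-1. Proof. exact: (fmorphV (real_complex R)). Qed.
Lemma rcX a n : rc (a ^+ n) = rc a ^+ n. Proof. exact: (rmorphXn (real_complex R)). Qed.
Lemma rc_nat n : rc n%:R = n%:R. Proof. exact: (rmorph_nat (real_complex R)). Qed.
Lemma rc_lt a b : (rc a < rc b) = (a < b). Proof. exact: ltcR. Qed.
Lemma rc_le a b : (rc a <= rc b) = (a <= b). Proof. exact: lecR. Qed.
Lemma rc_eq0 a : (rc a == 0) = (a == 0). Proof. exact: (inj_eq rc_inj a 0). Qed.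

Lemma Re_rc a : complex.Re (rc a) = a. Proof. by []. Qed.
Lemma Im_rc a : complex.Im (rc a) = 0. Proof. by []. Qed.
Lemma ReD z w : complex.Re (z + w) = complex.Re z + complex.Re w.
Proof. by case: z w => ? ? []. Qed.
Lemma ImD z w : complex.Im (z + w) = complex.Im z + complex.Im w.
Proof. by case: z w => ? ? []. Qed.
Lemma ReN z : complex.Re (- z) = - complex.Re z. Proof. by case: z. Qed.
Lemma ImN z : complex.Im (- z) = - complex.Im z. Proof. by case: z. Qed.
Lemma ReM z w : complex.Re (z * w) =
  complex.Re z * complex.Re w - complex.Im z * complex.Im w.
Proof. by case: z w => ? ? []. Qed.
Lemma ImM z w : complex.Im (z * w) =
  complex.Re z * complex.Im w + complex.Im z * complex.Re w.
Proof. by case: z w => ? ? [] * /=; rewrite addrC. Qed.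
Lemma Re_ci : complex.Re ci = 0. Proof. by []. Qed.
Lemma Im_ci : complex.Im ci = 1. Proof. by []. Qed.
Definition RIE := (ReD, ImD, ReN, ImN, ReM, ImM, Re_rc, Im_rc, Re_ci, Im_ci).
Lemma ci2 : ci * ci = -1. Proof. by rewrite -expr2; exact: sqr_i. Qed.
Lemma complexRI z : z = rc (complex.Re z) + ci * rc (complex.Im z).
Proof. exact: complexE. Qed.

Lemma cabs_ge0 z : 0 <= cabs z. Proof. exact: sqrtr_ge0. Qed.
Lemma cabs_rc a : cabs (rc a) = `|a|.
Proof. by rewrite /cabs /= expr0n addr0 sqrtr_sqr. Qed.
Lemma cabsM z w : cabs (z * w) = cabs z * cabs w.
Proof. by apply: rc_inj; rewrite rcM -!normE; exact: (@normrM R[i]). Qed.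
Lemma cabs0 : cabs 0 = 0. Proof. by rewrite -rc0 cabs_rc normr0. Qed.
Lemma cabs1 : cabs 1 = 1. Proof. by rewrite -rc1 cabs_rc normr1. Qed.
Lemma cabs_eq0 z : (cabs z == 0) = (z == 0).
Proof. by rewrite -rc_eq0 -normE; exact: (@normr_eq0 R[i]). Qed.
Lemma cabs_gt0 z : (0 < cabs z) = (z != 0).
Proof. by rewrite lt_def cabs_ge0 andbT cabs_eq0. Qed.
Lemma cabsV z : cabs z^-1 = (cabs z)^-1.
Proof. by apply: rc_inj; rewrite rcV -!normE; exact: (@normfV R[i]). Qed.
Lemma cabsX z n : cabs (z ^+ n) = cabs z ^+ n.
Proof. by elim: n => [|n IH]; rewrite ?expr0 ?cabs1// !exprS cabsM IH. Qed.
Lemma cabsN z : cabs (- z) = cabs z.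
Proof. by apply: rc_inj; rewrite -!normE; exact: (@normrN R[i]). Qed.
Lemma cabsD z w : cabs (z + w) <= cabs z + cabs w.
Proof. by rewrite -rc_le rcD -!normE; exact: (@ler_normD R[i]). Qed.
Lemma cabsC z w : cabs (z - w) = cabs (w - z).
Proof. by rewrite -cabsN opprB. Qed.
Lemma cabsB z w : cabs (z - w) <= cabs z + cabs w.
Proof. by rewrite -(cabsN w); exact: cabsD. Qed.
Lemma cabsB_ge z w : cabs z - cabs w <= cabs (z - w).
Proof. by rewrite lerBlDr -{1}(subrK w z); exact: cabsD. Qed.
Lemma cabs_tri y z w : cabs (z - w) <= cabs (z - y) + cabs (y - w).
Proof. by rewrite -[z - w](subrKA y); exact: cabsD. Qed.
Lemma cabs_sum (I : Type) (s : seq I) (P : pred I) (F : I -> C) :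
  cabs (\sum_(i <- s | P i) F i) <= \sum_(i <- s | P i) cabs (F i).
Proof.
elim/big_ind2: _ => [|? ? ? ? h1 h2|//]; first by rewrite cabs0.
exact: le_trans (cabsD _ _) (lerD h1 h2).
Qed.
Lemma cabs_prod (I : Type) (s : seq I) (P : pred I) (F : I -> C) :
  cabs (\prod_(i <- s | P i) F i) = \prod_(i <- s | P i) cabs (F i).
Proof. by elim/big_ind2: _ => [|? ? ? ? <- <-|//]; rewrite ?cabs1 ?cabsM. Qed.
Lemma cabs_nat n : cabs n%:R = n%:R.
Proof. by rewrite -rc_nat cabs_rc normr_nat. Qed.
Lemma cabs_ci : cabs ci = 1.
Proof. by rewrite /cabs /= expr0n add0r expr1n sqrtr1. Qed.
Lemma cabs_le_ReIm z : cabs z <= `|complex.Re z| + `|complex.Im z|.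
Proof.
rewrite [in cabs z](complexRI z) (le_trans (cabsD _ _))//.
by rewrite cabsM cabs_ci mul1r !cabs_rc.
Qed.
Lemma Re_le_cabs z : `|complex.Re z| <= cabs z.
Proof. by rewrite -sqrtr_sqr ler_sqrt ?lerDl ?sqr_ge0 ?addr_ge0 ?sqr_ge0. Qed.
Lemma Im_le_cabs z : `|complex.Im z| <= cabs z.
Proof. by rewrite -sqrtr_sqr ler_sqrt ?lerDr ?sqr_ge0 ?addr_ge0 ?sqr_ge0. Qed.

Lemma norm_lt z a : (`|z| < rc a) = (cabs z < a).
Proof. by rewrite normE; exact: rc_lt. Qed.
Lemma norm_gt z a : (rc a < `|z|) = (a < cabs z).
Proof. by rewrite normE; exact: rc_lt. Qed.
Lemma pos_rc (e : C) : 0 < e -> exists2 a, 0 < a & e = rc a.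
Proof.
case: e => a b; rewrite (@ltcE R) /= => /andP[/eqP -> h]; by exists a.
Qed.

End ComplexModulus.

Section ComplexLimits.
Variable R : realType.
Local Notation C := (Cx R).

Definition ccvg (f : nat -> C) (l : C) :=
  forall e : R, 0 < e -> exists N, forall n, (N <= n)%N -> cabs (f n - l) < e.

Lemma ccvgP (f : nat -> C) (l : C) : f @ \oo --> l <-> ccvg f l.
Proof.
split.
  move=> /cvgrPdist_lt h e e0.
  have := h (rc e); rewrite rc_lt => /(_ e0) [N _ hN].
  by exists N => n nN; have := hN n nN; rewrite /= norm_lt cabsC.
move=> h; apply/cvgrPdist_lt => e /pos_rc [a a0 ->].
by have [N hN] := h a a0; exists N => // n /= nN; rewrite norm_lt cabsC hN.
Qed.

Lemma ccvg_lim (f : nat -> C) (l : C) : ccvg f l -> limn f = l.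
Proof. by move/ccvgP/cvg_lim; apply; exact: norm_hausdorff. Qed.

Lemma ccvg_unique (f : nat -> C) (l l' : C) : ccvg f l -> ccvg f l' -> l = l'.
Proof. by move=> /ccvg_lim <- /ccvg_lim <-. Qed.

Lemma ccvgD (f g : nat -> C) (l l' : C) :
  ccvg f l -> ccvg g l' -> ccvg (fun n => f n + g n) (l + l').
Proof.
move=> h h' e e0; have e2 : 0 < e / 2 by lra.
have [N hN] := h _ e2; have [M hM] := h' _ e2.
exists (maxn N M) => n; rewrite geq_max => /andP[nN nM].
rewrite opprD addrACA (le_lt_trans (cabsD _ _))// [ltRHS]splitr.
exact: ltrD (hN n nN) (hM n nM).
Qed.

Lemma ccvgM (f g : nat -> C) (l l' : C) :
  ccvg f l -> ccvg g l' -> ccvg (fun n => f n * g n) (l * l').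
Proof.
move=> h h' e e0; pose K := 1 + cabs l + cabs l'.
have K0 : 0 < K by rewrite /K; have := cabs_ge0 l; have := cabs_ge0 l'; lra.
pose d := Num.min 1 (e / K).
have d0 : 0 < d by rewrite lt_min ltr01 divr_gt0.
have [N hN] := h _ d0; have [M hM] := h' _ d0.
exists (maxn N M) => n; rewrite geq_max => /andP[nN nM].
have -> : f n * g n - l * l' =
  (f n - l) * (g n - l') + l * (g n - l') + (f n - l) * l' by ring.
have h1 := hN n nN; have h2 := hM n nM.
have dK : d * K <= e by rewrite -ler_pdivlMr // ge_min lexx orbT.
have d1 : d <= 1 by rewrite ge_min lexx.
apply: le_lt_trans (cabsD _ _) _.
apply: (@le_lt_trans _ _ (cabs ((f n - l) * (g n - l')) + cabs (l * (g n - l'))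
  + cabs ((f n - l) * l'))); first by rewrite lerD2r cabsD.
rewrite !cabsM; have := cabs_ge0 l; have := cabs_ge0 l'.
have := cabs_ge0 (f n - l); have := cabs_ge0 (g n - l').
rewrite /K in dK; nra.
Qed.

Lemma ccvg_cst (l : C) : ccvg (fun=> l) l.
Proof. by move=> e e0; exists 0%N => n _; rewrite subrr cabs0. Qed.

Lemma ccvg_sum (I : Type) (s : seq I) (P : pred I) (F : I -> nat -> C) (l : I -> C) :
  (forall i, P i -> ccvg (F i) (l i)) ->
  ccvg (fun n => \sum_(i <- s | P i) F i n) (\sum_(i <- s | P i) l i).
Proof.
move=> h; elim: s => [|a s IH].
  rewrite big_nil; under eq_fun do rewrite big_nil; exact: ccvg_cst.
rewrite big_cons; under eq_fun do rewrite big_cons.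
by case: ifP => // Pa; apply: ccvgD => //; apply: h.
Qed.

Lemma ccvg_prod (I : Type) (s : seq I) (P : pred I) (F : I -> nat -> C) (l : I -> C) :
  (forall i, P i -> ccvg (F i) (l i)) ->
  ccvg (fun n => \prod_(i <- s | P i) F i n) (\prod_(i <- s | P i) l i).
Proof.
move=> h; elim: s => [|a s IH].
  rewrite big_nil; under eq_fun do rewrite big_nil; exact: ccvg_cst.
rewrite big_cons; under eq_fun do rewrite big_cons.
by case: ifP => // Pa; apply: ccvgM => //; apply: h.
Qed.

Lemma ccvg_shift (f : nat -> C) (l : C) m :
  ccvg f l -> ccvg (fun n => f (m + n)%N) l.
Proof.
move=> h e /h [N hN]; exists N => n Nn; apply: hN.
exact: leq_trans Nn (leq_addl _ _).
Qed.

Lemma ccvg_le (f : nat -> C) (l : C) (b : R) N :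
  ccvg f l -> (forall n, (N <= n)%N -> cabs (f n) <= b) -> cabs l <= b.
Proof.
move=> h hb; rewrite leNgt; apply/negP => bl.
have [|M hM] := h (cabs l - b); first by rewrite subr_gt0.
have := hM (maxn M N) (leq_maxl _ _).
have := hb (maxn M N) (leq_maxr _ _).
have := cabsB_ge l (f (maxn M N)); rewrite cabsC; lra.
Qed.

Lemma expr_small (r e : R) : 0 <= r < 1 -> 0 < e ->
  exists N, forall n, (N <= n)%N -> r ^+ n < e.
Proof.
move=> /andP[r0 r1] e0.
have /cvgrPdist_lt /(_ e e0) [N _ hN] : (fun n : nat => r ^+ n) @ \oo --> 0.
  by apply: cvg_expr; rewrite ger0_norm.
exists N => n nN; have := hN n nN.
by rewrite /= sub0r normrN ger0_norm // exprn_ge0.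
Qed.

Lemma geo_small (A r e : R) : 0 <= r < 1 -> 0 < e ->
  exists N, forall n, (N <= n)%N -> A * r ^+ n < e.
Proof.
move=> hr e0; have A1 : 0 < `|A| + 1 by rewrite ltr_wpDl.
have [N hN] := expr_small hr (divr_gt0 e0 A1).
exists N => n /hN; rewrite ltr_pdivlMr // mulrC; apply: le_lt_trans.
have /andP[r0 _] := hr.
apply: ler_wpM2r; first exact: exprn_ge0.
by rewrite (le_trans (ler_norm _))// lerDl.
Qed.

Lemma geo_sum_le (r : R) n m : 0 <= r < 1 ->
  \sum_(n <= i < n + m) r ^+ i <= r ^+ n / (1 - r).
Proof.
move=> /andP[r0 r1]; have r1' : 0 < 1 - r by rewrite subr_gt0.
rewrite ler_pdivlMr //.
suff -> : (\sum_(n <= i < n + m) r ^+ i) * (1 - r) = r ^+ n - r ^+ (n + m).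
  by rewrite lerBlDr lerDl exprn_ge0.
elim: m => [|m IH]; first by rewrite addn0 big_geq // mul0r subrr.
rewrite addnS big_nat_recr ?leq_addr //= mulrDl IH exprS; ring.
Qed.

(** Taken through real and imaginary parts, so that convergence follows from the completeness of
    [R]. *)
Definition climit (f : nat -> C) : C :=
  Complex (limn (fun n => complex.Re (f n))) (limn (fun n => complex.Im (f n))).

Lemma real_geo_cvg (f : nat -> R) (A r : R) : 0 <= r < 1 ->
  (forall n, `|f n.+1 - f n| <= A * r ^+ n) -> f @ \oo --> limn f.
Proof.
move=> hr hf; have /andP[r0 r1] := hr; have r1' : 0 < 1 - r by rewrite subr_gt0.
have hdiff n m : `|f (n + m)%N - f n| <= A * (r ^+ n / (1 - r)).
  have A0 : 0 <= A by have := hf 0%N; rewrite expr0 mulr1; apply: le_trans.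
  apply: le_trans (ler_wpM2l A0 (geo_sum_le n m hr)); rewrite mulr_sumr.
  elim: m => [|m IH]; first by rewrite addn0 subrr normr0 big_geq.
  rewrite addnS big_nat_recr ?leq_addr //=.
  rewrite -(subrK (f (n + m)%N) (f (n + m).+1)) -addrA addrC.
  exact: le_trans (ler_normD _ _) (lerD IH (hf _)).
apply/cauchy_cvgP/cauchy_exP => e e0.
have [N hN] := geo_small (A / (1 - r)) hr e0.
exists (f N); exists N => // n /= Nn; rewrite /ball /= distrC -(subnKC Nn).
by apply: le_lt_trans (hdiff _ _) _; rewrite mulrA mulrAC hN.
Qed.

(** Locally uniform convergence is expressed below by one pair [A], [r] in such a bound, valid at
    all points of a polydisc. *)
Lemma climitP (f : nat -> C) (A r : R) : 0 <= r < 1 ->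
  (forall n, cabs (f n.+1 - f n) <= A * r ^+ n) -> ccvg f (climit f).
Proof.
move=> hr hf.
have hRe : (fun n => complex.Re (f n)) @ \oo --> limn (fun n => complex.Re (f n)).
  apply: (real_geo_cvg hr) => n; rewrite -ReN -ReD.
  exact: le_trans (Re_le_cabs _) (hf n).
have hIm : (fun n => complex.Im (f n)) @ \oo --> limn (fun n => complex.Im (f n)).
  apply: (real_geo_cvg hr) => n; rewrite -ImN -ImD.
  exact: le_trans (Im_le_cabs _) (hf n).
move=> e e0; have e2 : 0 < e / 2 by lra.
have /cvgrPdist_lt /(_ _ e2) [N _ hN] := hRe.
have /cvgrPdist_lt /(_ _ e2) [M _ hM] := hIm.
exists (maxn N M) => n; rewrite geq_max => /andP[nN nM].
have h1 := hN n nN; have h2 := hM n nM.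
apply: le_lt_trans (cabs_le_ReIm _) _; rewrite !RIE /= [ltRHS]splitr.
by apply: ltrD; rewrite distrC.
Qed.

Lemma geo_dist (f : nat -> C) (A r : R) n m : 0 <= r < 1 ->
  (forall n, cabs (f n.+1 - f n) <= A * r ^+ n) ->
  cabs (f (n + m)%N - f n) <= A / (1 - r) * r ^+ n.
Proof.
move=> hr hf.
have A0 : 0 <= A by have := hf 0%N; rewrite expr0 mulr1; apply: le_trans; exact: cabs_ge0.
rewrite -mulrA [_^-1 * _]mulrC; apply: le_trans (ler_wpM2l A0 (geo_sum_le n m hr)).
rewrite mulr_sumr; elim: m => [|m IH]; first by rewrite addn0 subrr cabs0 big_geq.
rewrite addnS big_nat_recr ?leq_addr //=.
apply: le_trans (cabs_tri (f (n + m)%N) _ _) _; rewrite addrC; exact: lerD.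
Qed.

Lemma climit_dist (f : nat -> C) (A r : R) n : 0 <= r < 1 ->
  (forall n, cabs (f n.+1 - f n) <= A * r ^+ n) ->
  cabs (f n - climit f) <= A / (1 - r) * r ^+ n.
Proof.
move=> hr hf; rewrite cabsC.
apply: (@ccvg_le (fun m => f (n + m)%N - f n) _ _ 0).
  apply: ccvgD (ccvg_shift _ (climitP hr hf)) (ccvg_cst _).
by move=> m _; exact: geo_dist.
Qed.

End ComplexLimits.

(** * Complex differentiability *)

Section ComplexDiff.
Variable R : realType.
Local Notation C := (Cx R).
Implicit Types (f g : C -> C) (z w a v l : C).

(** The first-order error is bounded without a quotient, so the point [w = z] needs no exception. *)
Definition cderiv f z l := forall e : R, 0 < e -> exists2 d : R, 0 < d &
  forall w, cabs (w - z) < d -> cabs (f w - f z - l * (w - z)) <= e * cabs (w - z).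
Definition cdiff f z := exists l, cderiv f z l.

Lemma cdiffP f z : cdiff f z <-> derivable f z 1.
Proof.
split.
  move=> [l hl]; apply/cvg_ex; exists l; apply/cvgrPdist_lt => e /pos_rc [b b0 ->].
  have b2 : 0 < b / 2 by lra.
  have [d d0 hd] := hl _ b2.
  exists (rc d) => /=; first by rewrite (rc_lt 0 d).
  move=> h /=; rewrite sub0r normrN norm_lt => hh h0.
  have := hd (h + z); rewrite addrK => /(_ hh) hfz.
  rewrite norm_lt /= [h *: 1]mulr1.
  rewrite -(mulKf h0 l) -[h^-1 *: _]/(h^-1 * _) -mulrBr cabsM cabsV [cabs (_ * l - _)]cabsC.
  rewrite ltr_pdivrMl ?cabs_gt0 //.
  have := cabs_gt0 h; rewrite h0 => /idP h0'.
  by rewrite [h * l]mulrC (le_lt_trans hfz)// mulrC ltr_pM2l //; lra.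
move=> /cvg_ex[l /cvgrPdist_lt hl]; exists l => e e0.
have := hl (rc e); rewrite rc_lt => /(_ e0) [d /= /pos_rc [b b0 ->] hb].
exists b => // w wb.
have [->|wz] := eqVneq w z; first by rewrite !subrr mulr0 subrr cabs0 mulr0.
have wz0 : w - z != 0 by rewrite subr_eq0.
have := hb (w - z); rewrite /= sub0r normrN norm_lt => /(_ wb wz0).
rewrite norm_lt /= [(w - z) *: 1]mulr1 subrK.
rewrite -{1}(mulKf wz0 l) -[(w - z)^-1 *: _]/((w - z)^-1 * _) -mulrBr cabsM cabsV [cabs (_ * l - _)]cabsC.
rewrite ltr_pdivrMl ?cabs_gt0 // => h.
by rewrite [l * _]mulrC [leRHS]mulrC ltW.
Qed.

Lemma cderiv_cst l z : cderiv (fun=> l) z 0.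
Proof.
by move=> e e0; exists 1 => // w _; rewrite subrr mul0r subrr cabs0 mulr_ge0 // ?cabs_ge0 ?ltW.
Qed.
Lemma cdiff_cst l z : cdiff (fun=> l) z. Proof. by exists 0; exact: cderiv_cst. Qed.
Lemma cdiff_id z : cdiff id z.
Proof.
by exists 1 => e e0; exists 1 => // w _; rewrite mul1r subrr cabs0 mulr_ge0 // ?cabs_ge0 ?ltW.
Qed.
Lemma cderivD f g z l m : cderiv f z l -> cderiv g z m ->
  cderiv (fun w => f w + g w) z (l + m).
Proof.
move=> hf hg e e0; have e2 : 0 < e / 2 by lra.
have [d d0 hd] := hf _ e2; have [d' d'0 hd'] := hg _ e2.
exists (Num.min d d'); first by rewrite lt_min d0.
move=> w; rewrite lt_min => /andP[/hd h1 /hd' h2].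
have -> : f w + g w - (f z + g z) - (l + m) * (w - z) =
 (f w - f z - l * (w - z)) + (g w - g z - m * (w - z)) by ring.
rewrite (le_trans (cabsD _ _))//; lra.
Qed.
Lemma cdiffD f g z : cdiff f z -> cdiff g z -> cdiff (fun w => f w + g w) z.
Proof. by move=> [l hl] [m hm]; exists (l + m); exact: cderivD. Qed.

Lemma cderiv_lip f z l : cderiv f z l -> exists2 d : R, 0 < d &
  forall w, cabs (w - z) < d -> cabs (f w - f z) <= (cabs l + 1) * cabs (w - z).
Proof.
move=> hl; have [d d0 hd] := hl 1 ltr01; exists d => // w /hd.
rewrite mul1r => h; rewrite -[f w - f z](subrK (l * (w - z))).
by rewrite (le_trans (cabsD _ _))// cabsM mulrDl mul1r addrC lerD2l.
Qed.

Lemma cdiff_cont f z : cdiff f z -> forall e : R, 0 < e ->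
  exists2 d : R, 0 < d & forall w, cabs (w - z) < d -> cabs (f w - f z) <= e.
Proof.
move=> [l /cderiv_lip [d d0 hd]] e e0.
have K0 : 0 < cabs l + 1 by rewrite ltr_wpDl ?cabs_ge0.
exists (Num.min d (e / (cabs l + 1))); first by rewrite lt_min d0 divr_gt0.
move=> w; rewrite lt_min => /andP[/hd h]; rewrite ltr_pdivlMr // => h2.
by rewrite (le_trans h)// mulrC ltW.
Qed.

Lemma cderivM f g z l m : cderiv f z l -> cderiv g z m ->
  cderiv (fun w => f w * g w) z (l * g z + f z * m).
Proof.
move=> hf hg e e0.
have [d d0 hd] := cderiv_lip hf; have [d' d'0 hd'] := cderiv_lip hg.
pose K := 1 + cabs (f z) + cabs (g z) + (cabs l + 1) * (cabs m + 1).
have Kl := cabs_ge0 l; have Km := cabs_ge0 m.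
have Kf := cabs_ge0 (f z); have Kg := cabs_ge0 (g z).
have K0 : 0 < K by rewrite /K; nra.
have eK : 0 < e / K by rewrite divr_gt0.
have [d1 d10 hd1] := hf _ eK; have [d2 d20 hd2] := hg _ eK.
exists (Num.min (Num.min d d') (Num.min (Num.min d1 d2) (e / K))).
  by rewrite !lt_min d0 d'0 d10 d20.
move=> w; rewrite !lt_min => /andP[/andP[/hd h1 /hd' h2] /andP[/andP[/hd1 h3 /hd2 h4] h5]].
have -> : f w * g w - f z * g z - (l * g z + f z * m) * (w - z) =
  (f w - f z - l * (w - z)) * g z + f z * (g w - g z - m * (w - z))
  + (f w - f z) * (g w - g z) by ring.
apply: le_trans (cabsD _ _) _.
apply: (@le_trans _ _ (cabs ((f w - f z - l * (w - z)) * g z)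
  + cabs (f z * (g w - g z - m * (w - z))) + cabs ((f w - f z) * (g w - g z)))).
  by rewrite lerD2r cabsD.
rewrite !cabsM; have Kw := cabs_ge0 (w - z); set t := cabs (w - z) in h1 h2 h3 h4 h5 Kw *.
have eKK : e / K * K = e by rewrite divfK // gt_eqF.
set c := e / K in eKK h3 h4 h5 eK.
have H1 : cabs (f w - f z - l * (w - z)) * cabs (g z) <= c * t * cabs (g z) by apply: ler_wpM2r.
have H2 : cabs (f z) * cabs (g w - g z - m * (w - z)) <= cabs (f z) * (c * t) by apply: ler_wpM2l.
have H3 : cabs (f w - f z) * cabs (g w - g z) <=
  ((cabs l + 1) * t) * ((cabs m + 1) * t).
  by apply: ler_pM => //; exact: cabs_ge0.
have H4 : ((cabs l + 1) * t) * ((cabs m + 1) * t) <= ((cabs l + 1) * (cabs m + 1)) * (c * t).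
  rewrite mulrACA; apply: ler_wpM2l; first by rewrite mulr_ge0 // addr_ge0.
  by apply: ler_wpM2r => //; exact: ltW.
have H5 : 0 <= c * t by rewrite mulr_ge0 // ltW.
have -> : e * t = (c * t) * K by rewrite -eKK; ring.
rewrite /K; lra.
Qed.
Lemma cdiffM f g z : cdiff f z -> cdiff g z -> cdiff (fun w => f w * g w) z.
Proof. by move=> [l hl] [m hm]; exists (l * g z + f z * m); exact: cderivM. Qed.

Lemma cdiffV f z : f z != 0 -> cdiff f z -> cdiff (fun w => (f w)^-1) z.
Proof. by move=> f0 /cdiffP h; apply/cdiffP; exact: derivableV. Qed.

Lemma cderiv_near f g z l : cderiv f z l ->
  (exists2 d : R, 0 < d & forall w, cabs (w - z) < d -> f w = g w) -> cderiv g z l.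
Proof.
move=> hf [d d0 hd] e e0; have [d' d'0 hd'] := hf e e0.
exists (Num.min d d'); first by rewrite lt_min d0.
move=> w; rewrite lt_min => /andP[h1 h2].
by rewrite -hd // -hd ?subrr ?cabs0 //; exact: hd'.
Qed.
Lemma cdiff_near f g z : cdiff f z ->
  (exists2 d : R, 0 < d & forall w, cabs (w - z) < d -> f w = g w) -> cdiff g z.
Proof. by move=> [l hl] h; exists l; exact: cderiv_near hl h. Qed.
Lemma cdiffX f z n : cdiff f z -> cdiff (fun w => f w ^+ n) z.
Proof.
move=> hf; elim: n => [|n IH]; first exact: cdiff_cst.
have -> : (fun w => f w ^+ n.+1) = (fun w => f w * f w ^+ n).
  by apply/funext => w; rewrite exprS.
exact: cdiffM.
Qed.
Lemma cderivZ f z l c : cderiv f z l -> cderiv (fun w => c * f w) z (c * l).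
Proof.
by move=> /(cderivM (cderiv_cst c z)); rewrite mul0r add0r.
Qed.
Lemma cderivB f g z l m : cderiv f z l -> cderiv g z m ->
  cderiv (fun w => f w - g w) z (l - m).
Proof.
move=> hf /(@cderivZ _ _ _ (-1)); rewrite mulN1r => /(cderivD hf) h.
by apply: cderiv_near h _; exists 1 => // w _; rewrite mulN1r.
Qed.
Lemma cdiffB f g z : cdiff f z -> cdiff g z -> cdiff (fun w => f w - g w) z.
Proof. by move=> [l hl] [m hm]; exists (l - m); exact: cderivB. Qed.
End ComplexDiff.

(** * Bisection on the unit square, and on the unit interval when the second coordinate is
    ignored *)

Section Cousin.
Variable R : realType.

Lemma nested_intervals (a b : nat -> R) :
  (forall n, a n <= a n.+1) -> (forall n, b n.+1 <= b n) ->
  (forall n, a n <= b n) -> exists x, forall n, a n <= x <= b n.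
Proof.
move=> ha hb hab.
have ma : forall n m, a n <= a (n + m)%N.
  by move=> n; elim=> [|m IH]; rewrite ?addn0 ?addnS //; exact: le_trans IH (ha _).
have mb : forall n m, b (n + m)%N <= b n.
  by move=> n; elim=> [|m IH]; rewrite ?addn0 ?addnS //; exact: le_trans (hb _) IH.
have ab n m : a n <= b m.
  have [nm|/ltnW mn] := leqP n m.
    by rewrite (le_trans _ (hab m)) // -(subnKC nm).
  by rewrite (le_trans (hab n)) // -(subnKC mn).
exists (sup (range a)) => n; apply/andP; split.
  by apply: ub_le_sup; [exists (b 0%N) => _ [k _ <-] | exists n].
by apply: ge_sup; [exists (a 0%N), 0%N | move=> _ [k _ <-]].
Qed.

Variable P : R -> R -> R -> Prop.
Hypothesis Hadd : forall x y s, P x y (s / 2) -> P (x + s / 2) y (s / 2) ->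
  P x (y + s / 2) (s / 2) -> P (x + s / 2) (y + s / 2) (s / 2) -> P x y s.
Hypothesis Hloc : forall x0 y0, 0 <= x0 <= 1 -> 0 <= y0 <= 1 ->
  exists2 d : R, 0 < d & forall x y s, 0 < s < d ->
    0 <= x <= x0 -> x0 <= x + s <= 1 -> 0 <= y <= y0 -> y0 <= y + s <= 1 -> P x y s.

(* Bisection: a square on which [P] fails contains a quarter on which [P] fails. *)
Lemma cousin : P 0 0 1.
Proof.
apply: contrapT => nP.
(* The corner of a quarter on which [P] still fails. The alternative [s < 0] makes the statement
   true for every real [s], as [choice] requires; it is ruled out at the sides [2 ^- n]. *)
have next (p : R * R) (s : R) : exists p' : R * R, ~ P p.1 p.2 s ->
    ~ P p'.1 p'.2 (s / 2) /\ p.1 <= p'.1 <= p.1 + s / 2 /\ p.2 <= p'.2 <= p.2 + s / 2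
    \/ s < 0.
  have [s0|s0] := ltP s 0; first by exists p => _; right.
  have [h1|h1] := pselect (P p.1 p.2 (s / 2)); last first.
    exists p => _; left; split=> //; lra.
  have [h2|h2] := pselect (P (p.1 + s / 2) p.2 (s / 2)); last first.
    exists (p.1 + s / 2, p.2) => _; left; split=> //=; lra.
  have [h3|h3] := pselect (P p.1 (p.2 + s / 2) (s / 2)); last first.
    exists (p.1, p.2 + s / 2) => _; left; split=> //=; lra.
  have [h4|h4] := pselect (P (p.1 + s / 2) (p.2 + s / 2) (s / 2)); last first.
    exists (p.1 + s / 2, p.2 + s / 2) => _; left; split=> //=; lra.
  by exists p => h; case: h; exact: Hadd.
have [nx hnx] := choice (fun ps : (R * R) * R => next ps.1 ps.2).
pose q := fix q n : R * R := if n is n'.+1 then nx (q n', 2 ^- n') else (0, 0).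
have p2 n : 0 < 2 ^- n :> R by rewrite invr_gt0 exprn_gt0.
have p2S n : 2 ^- n.+1 = 2 ^- n / 2 :> R by rewrite exprS invfM mulrC.
have step n : ~ P (q n).1 (q n).2 (2 ^- n) ->
  ~ P (q n.+1).1 (q n.+1).2 (2 ^- n.+1) /\
  (q n).1 <= (q n.+1).1 <= (q n).1 + 2 ^- n / 2 /\
  (q n).2 <= (q n.+1).2 <= (q n).2 + 2 ^- n / 2.
  move=> h; have := hnx (q n, 2 ^- n) h; rewrite p2S => -[//|/=].
  by rewrite ltNge (ltW (p2 n)).
have nPq n : ~ P (q n).1 (q n).2 (2 ^- n).
  by elim: n => [|n /step [] //]; rewrite expr0 invr1.
have sq n := (step n (nPq n)).2.
have [x0 hx0] := @nested_intervals (fun n => (q n).1) (fun n => (q n).1 + 2 ^- n)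
  (fun n => ltac:(have := sq n; lra))
  (fun n => ltac:(have := sq n; rewrite p2S; lra)) (fun n => ltac:(have := p2 n; lra)).
have [y0 hy0] := @nested_intervals (fun n => (q n).2) (fun n => (q n).2 + 2 ^- n)
  (fun n => ltac:(have := sq n; lra))
  (fun n => ltac:(have := sq n; rewrite p2S; lra)) (fun n => ltac:(have := p2 n; lra)).
have b1 n : 0 <= (q n).1 /\ (q n).1 + 2 ^- n <= 1.
  elim: n => [|n IH]; first by rewrite /= expr0 invr1; lra.
  have := sq n; rewrite p2S; lra.
have b2 n : 0 <= (q n).2 /\ (q n).2 + 2 ^- n <= 1.
  elim: n => [|n IH]; first by rewrite /= expr0 invr1; lra.
  have := sq n; rewrite p2S; lra.
have hx := hx0 0%N; have hy := hy0 0%N; rewrite /= expr0 invr1 in hx hy.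
have [||d d0 hd] := Hloc (x0 := x0) (y0 := y0); [lra|lra|].
have h12 : 0 <= (2^-1 : R) < 1 by lra.
have [N hN] := expr_small h12 d0.
have h := hx0 N; have h' := hy0 N; have g := b1 N; have g' := b2 N.
apply: (nPq N); apply: hd; rewrite ?p2 -?exprVn ?hN //= ?exprVn; lra.
Qed.
End Cousin.

(** * Goursat's lemma *)

Section EdgeSums.
Variable R : realType.
Local Notation C := (Cx R).
Implicit Types (f g : C -> C) (z w a v l : C).

Definition mid n i : R := (i.*2.+1)%:R / (n.*2)%:R.
(** Midpoint sum for the integral of [f] along the segment from [a] to [a + v]. The number of pieces
    will be a power of 2, halved at each bisection. *)
Definition edge f n a v : C := \sum_(i < n) f (a + v * rc (mid n i)) * (v / n%:R).

Lemma mid_bounds n i : (i < n)%N -> 0 < mid n i < 1.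
Proof.
move=> lin; have n0 : 0 < (n.*2)%:R :> R by rewrite ltr0n double_gt0; case: n lin.
rewrite /mid; apply/andP; split; first by apply: divr_gt0 n0; rewrite ltr0n.
by rewrite ltr_pdivrMr // mul1r ltr_nat -doubleS leq_double.
Qed.

Lemma mid_addl n i : mid (n + n) i = mid n i / 2.
Proof. by rewrite /mid addnn -(muln2 n.*2) natrM invfM mulrA. Qed.
Lemma mid_addr n i : (0 < n)%N -> mid (n + n) (n + i) = 2^-1 + mid n i / 2.
Proof.
move=> n0; rewrite -mid_addl /mid doubleD -addnS natrD mulrDl; congr (_ + _).
have n0' : n.*2%:R != 0 :> R by rewrite pnatr_eq0 double_eq0 -lt0n.
by rewrite addnn -(muln2 n.*2) natrM invfM mulrA divff // mul1r.
Qed.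

Lemma edge_split f n a v : (0 < n)%N ->
  edge f (n + n) a v = edge f n a (v / 2) + edge f n (a + v / 2) (v / 2).
Proof.
move=> n0; rewrite /edge big_split_ord /=.
have n0' : n%:R != 0 :> C by rewrite pnatr_eq0 -lt0n.
have hv : v / (n + n)%:R = v / 2 / n%:R by rewrite addnn -muln2 natrM; field.
have h2 : rc (2^-1 : R) = 2^-1 by rewrite rcV rc_nat.
congr (_ + _); apply: eq_bigr => i _; rewrite hv; congr (f _ * _).
  by rewrite mid_addl rcM h2; ring.
by rewrite mid_addr // rcD rcM h2; ring.
Qed.

Lemma edge_le f n a v (B : R) : 0 <= B ->
  (forall t, 0 < t < 1 -> cabs (f (a + v * rc t)) <= B) ->
  cabs (edge f n a v) <= cabs v * B.
Proof.
move=> B0 hB; case: n => [|n].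
  by rewrite /edge big_ord0 cabs0 mulr_ge0 // cabs_ge0.
rewrite /edge (le_trans (cabs_sum _ _ _))//.
apply: (@le_trans _ _ (\sum_(i < n.+1) cabs v * B / n.+1%:R)).
  apply: ler_sum => i _; rewrite !cabsM cabsV cabs_nat mulrA mulrC.
  rewrite [leRHS]mulrC ler_wpM2l ?invr_ge0 ?ler0n // mulrC.
  by apply: ler_wpM2l; [exact: cabs_ge0 | apply: hB; exact: mid_bounds].
by rewrite sumr_const card_ord -[leLHS]mulr_natr divfK // pnatr_eq0.
Qed.

Lemma edgeD f g n a v :
  edge (fun z => f z + g z) n a v = edge f n a v + edge g n a v.
Proof. by rewrite -big_split; apply: eq_bigr => i _; rewrite mulrDl. Qed.

Lemma edgeZ c f n a v : edge (fun z => c * f z) n a v = c * edge f n a v.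
Proof. by rewrite /edge mulr_sumr; apply: eq_bigr => i _; rewrite -mulrA. Qed.

Lemma sum_mid n : \sum_(i < n) mid n i = n%:R / 2.
Proof.
case: n => [|n]; first by rewrite big_ord0 mul0r.
have n0 : n.+1%:R != 0 :> R by rewrite pnatr_eq0.
have h m : \sum_(i < m) (i.*2.+1)%:R = m%:R ^+ 2 :> R.
  elim: m => [|m IH]; first by rewrite big_ord0 expr0n.
  by rewrite big_ord_recr /= IH -[(m.*2.+1)%:R]natr1 -muln2 natrM -natr1; ring.
by rewrite /mid -mulr_suml h -muln2 natrM; field.
Qed.

Lemma edge_affine (al be : C) n a v : (0 < n)%N ->
  edge (fun z => al + be * z) n a v = v * (al + be * (a + v / 2)).
Proof.
move=> n0; rewrite /edge -mulr_suml.
have n0' : n%:R != 0 :> C by rewrite pnatr_eq0 -lt0n.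
have -> : \sum_(i < n) (al + be * (a + v * rc (mid n i))) =
  n%:R * (al + be * a) + be * v * rc (\sum_(i < n) mid n i).
  rewrite (big_morph (@rc R) (@rcD R) (@rc0 R)) mulr_sumr.
  have -> : n%:R * (al + be * a) = \sum_(i < n) (al + be * a).
    by rewrite sumr_const card_ord mulr_natl.
  by rewrite -big_split; apply: eq_bigr => i _ /=; ring.
rewrite sum_mid rcM rcV !rc_nat; field.
exact: n0'.
Qed.

(* The two edges traversed backwards are counted with a minus sign. *)
Definition bnd f n a v : C :=
  edge f n a v + edge f n (a + v) (ci R * v) - edge f n (a + ci R * v) v
  - edge f n a (ci R * v).

Definition sqpt a v (x y : R) : C := a + v * (rc x + ci R * rc y).

Lemma bnd_split f n a v : (0 < n)%N ->
  bnd f (n + n) a v = bnd f n a (v / 2) + bnd f n (a + v / 2) (v / 2)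
   + bnd f n (a + ci R * v / 2) (v / 2) + bnd f n (a + v / 2 + ci R * v / 2) (v / 2).
Proof.
move=> n0; rewrite /bnd !edge_split //.
have -> : a + ci R * (v / 2) = a + ci R * v / 2 by ring.
have -> : a + ci R * v / 2 + v / 2 = a + v / 2 + ci R * v / 2 by ring.
have -> : a + v / 2 + v / 2 = a + v by field.
have -> : a + v / 2 + ci R * (v / 2) = a + v / 2 + ci R * v / 2 by ring.
have -> : a + ci R * v / 2 + ci R * (v / 2) = a + ci R * v by field.
have -> : a + v / 2 + ci R * v / 2 + ci R * (v / 2) = a + ci R * v + v / 2 by field.
have -> : a + v / 2 + ci R * v / 2 + v / 2 = a + v + ci R * v / 2 by field.
have -> : ci R * (v / 2) = ci R * v / 2 by ring.
ring.
Qed.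

Lemma bndD f g n a v :
  bnd (fun z => f z + g z) n a v = bnd f n a v + bnd g n a v.
Proof. by rewrite /bnd !edgeD; ring. Qed.

Lemma bnd_affine (al be : C) n a v : (0 < n)%N ->
  bnd (fun z => al + be * z) n a v = 0.
Proof. by move=> n0; rewrite /bnd !edge_affine //; field. Qed.

Lemma bnd_le f n a v (B : R) : 0 <= B ->
  (forall x y, 0 <= x <= 1 -> 0 <= y <= 1 -> cabs (f (sqpt a v x y)) <= B) ->
  cabs (bnd f n a v) <= 4 * (cabs v * B).
Proof.
move=> B0 hB.
have h0 : 0 <= (0 : R) <= 1 by lra.
have h1 : 0 <= (1 : R) <= 1 by lra.
have e1 : cabs (edge f n a v) <= cabs v * B.
  apply: edge_le => // t t01; have -> : a + v * rc t = sqpt a v t 0.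
    by rewrite /sqpt rc0; ring.
  by apply: hB; lra.
have e2 : cabs (edge f n (a + v) (ci R * v)) <= cabs v * B.
  have -> : cabs v = cabs (ci R * v) by rewrite cabsM cabs_ci mul1r.
  apply: edge_le => // t t01; have -> : a + v + ci R * v * rc t = sqpt a v 1 t.
    by rewrite /sqpt rc1; ring.
  by apply: hB; lra.
have e3 : cabs (edge f n (a + ci R * v) v) <= cabs v * B.
  apply: edge_le => // t t01; have -> : a + ci R * v + v * rc t = sqpt a v t 1.
    by rewrite /sqpt rc1; ring.
  by apply: hB; lra.
have e4 : cabs (edge f n a (ci R * v)) <= cabs v * B.
  have -> : cabs v = cabs (ci R * v) by rewrite cabsM cabs_ci mul1r.
  apply: edge_le => // t t01; have -> : a + ci R * v * rc t = sqpt a v 0 t.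
    by rewrite /sqpt rc0; ring.
  by apply: hB; lra.
rewrite /bnd; apply: le_trans (cabsB _ _) _.
have := cabsB (edge f n a v + edge f n (a + v) (ci R * v)) (edge f n (a + ci R * v) v).
have := cabsD (edge f n a v) (edge f n (a + v) (ci R * v)); lra.
Qed.

Lemma sqpt_sub a v (x y s x' y' : R) :
  sqpt (sqpt a v x y) (v * rc s) x' y' = sqpt a v (x + s * x') (y + s * y').
Proof. by rewrite /sqpt !rcD !rcM; ring. Qed.

Lemma eventually2 (P Q : nat -> Prop) :
  (exists J, forall j, (J <= j)%N -> P j) -> (exists J, forall j, (J <= j)%N -> Q j) ->
  exists J, forall j, (J <= j)%N -> P j /\ Q j.
Proof.
move=> [J hJ] [K hK]; exists (maxn J K) => j; rewrite geq_max => /andP[h1 h2].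
by split; [exact: hJ | exact: hK].
Qed.

(** A midpoint sum need not vanish, so the integral theorem becomes smallness for all fine enough
    subdivisions. This property passes from the quarters to the square at the cost of one level of
    subdivision, and near a point only the deviation from the tangent map contributes. *)
Lemma goursat f a v :
  (forall x y, 0 <= x <= 1 -> 0 <= y <= 1 -> cdiff f (sqpt a v x y)) ->
  forall e : R, 0 < e -> exists J, forall j, (J <= j)%N ->
    cabs (bnd f (2 ^ j) a v) <= e.
Proof.
move=> hf e e0.
suff : exists J, forall j, (J <= j)%N ->
    cabs (bnd f (2 ^ j) (sqpt a v 0 0) (v * rc 1)) <= e * 1 ^+ 2.
  by rewrite expr1n mulr1 rc1 mulr1 /sqpt rc0 mulr0 addr0 mulr0 addr0.
(* The bound is proportional to the area, so the bounds of four quarters add up to that of the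
   square. *)
pose P (x y s : R) := exists J, forall j, (J <= j)%N ->
    cabs (bnd f (2 ^ j) (sqpt a v x y) (v * rc s)) <= e * s ^+ 2.
apply: (@cousin R P).
  move=> x y s h1 h2 h3 h4.
  have [J hJ] := eventually2 (eventually2 h1 h2) (eventually2 h3 h4).
  exists J.+1 => -[//|j]; rewrite ltnS => /hJ [[g1 g2] [g3 g4]].
  rewrite expnS mul2n -addnn bnd_split ?expn_gt0 //.
  have E1 : v * rc s / 2 = v * rc (s / 2) by rewrite rcM rcV rc_nat; ring.
  have E2 : sqpt a v x y + v * rc s / 2 = sqpt a v (x + s / 2) y.
    by rewrite E1 /sqpt rcD; ring.
  have E3 : sqpt a v x y + ci R * (v * rc s) / 2 = sqpt a v x (y + s / 2).
    by rewrite -mulrA E1 /sqpt !rcD; ring.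
  rewrite E2 E3.
  have -> : sqpt a v (x + s / 2) y + ci R * (v * rc s) / 2 =
     sqpt a v (x + s / 2) (y + s / 2) by rewrite -mulrA E1 /sqpt !rcD; ring.
  rewrite E1; apply: le_trans (cabsD _ _) _.
  set c1 := bnd _ _ _ _; set c2 := bnd _ _ _ _ in g2 *; set c3 := bnd _ _ _ _ in g3 *.
  set c4 := bnd _ _ _ _ in g4 *.
  have := cabsD (c1 + c2) c3; have := cabsD c1 c2.
  have -> : s ^+ 2 = 4 * (s / 2) ^+ 2 by field.
  rewrite -/c1 in g1; lra.
move=> x0 y0 hx hy; have [l hl] := hf x0 y0 hx hy; set z0 := sqpt a v x0 y0 in hl.
(* Four sides of length [cabs v * s], times a distance to [z0] of at most [2 * cabs v * s], give
   [8 * cabs v ^+ 2 * s ^+ 2]; the added 1 keeps [K] positive. *)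
have v0 := cabs_ge0 v; pose K := 8 * cabs v ^+ 2 + 1.
have K0 : 0 < K by rewrite /K; nra.
have [d d0 hd] := hl _ (divr_gt0 e0 K0).
have K1 : 0 < 2 * cabs v + 1 by lra.
exists (d / (2 * cabs v + 1)); first by rewrite divr_gt0.
move=> x y s /andP[s0 sd] hxx hxs hyy hys; exists 0%N => j _.
rewrite ltr_pdivlMr // in sd.
(* The tangent map is affine, so its boundary sum is exactly 0 and only the remainder is
   estimated. *)
have -> : f = fun z => (f z0 - l * z0 + l * z) + (f z - f z0 - l * (z - z0)).
  by apply/funext => z; ring.
rewrite bndD bnd_affine ?expn_gt0 // add0r.
have hB : 0 <= e / K * (2 * cabs v * s) by rewrite !mulr_ge0 ?invr_ge0 // ltW.
apply: le_trans (bnd_le _ hB _) _.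
  move=> x' y' hx' hy'; rewrite sqpt_sub.
  have hz : cabs (sqpt a v (x + s * x') (y + s * y') - z0) <= 2 * cabs v * s.
    have -> : sqpt a v (x + s * x') (y + s * y') - z0 =
      v * (rc (x + s * x' - x0) + ci R * rc (y + s * y' - y0)).
      by rewrite /z0 /sqpt !rcB; ring.
    rewrite cabsM mulrAC mulrC; apply: ler_wpM2r => //.
    apply: le_trans (cabsD _ _) _; rewrite cabsM cabs_ci mul1r !cabs_rc.
    have : `|x + s * x' - x0| <= s by rewrite ler_norml; nra.
    have : `|y + s * y' - y0| <= s by rewrite ler_norml; nra.
    lra.
  apply: le_trans (hd _ _) _; first by apply: le_lt_trans hz _; lra.
  by rewrite ler_wpM2l // ltW // divr_gt0.
have -> : cabs (v * rc s) = cabs v * s by rewrite cabsM cabs_rc gtr0_norm.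
have -> : 4 * (cabs v * s * (e / K * (2 * cabs v * s))) =
  (8 * cabs v ^+ 2 / K) * (e * s ^+ 2) by ring.
rewrite ger_pMl ?mulr_gt0 ?exprn_gt0 // ler_pdivrMr // mul1r /K; lra.
Qed.

(** Compactness in the form of bisection: a bound on each quarter gives one on the square, and
    continuity gives a bound near each point. *)
Lemma bounded_sq f a v :
  (forall x y, 0 <= x <= 1 -> 0 <= y <= 1 -> cdiff f (sqpt a v x y)) ->
  exists2 B : R, 0 <= B &
    forall x y, 0 <= x <= 1 -> 0 <= y <= 1 -> cabs (f (sqpt a v x y)) <= B.
Proof.
move=> hf.
pose P (x y s : R) := exists2 B : R, 0 <= B &
    forall x' y', x <= x' <= x + s -> y <= y' <= y + s -> cabs (f (sqpt a v x' y')) <= B.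
have [] := @cousin R P.
- move=> x y s [B1 p1 h1] [B2 p2 h2] [B3 p3 h3] [B4 p4 h4].
  exists (B1 + B2 + B3 + B4); first lra.
  move=> x' y' hx hy.
  have [x1|x1] := leP x' (x + s / 2); have [y1|y1] := leP y' (y + s / 2).
  + have := h1 x' y'; lra.
  + have := h3 x' y'; lra.
  + have := h2 x' y'; lra.
  + have := h4 x' y'; lra.
- move=> x0 y0 hx hy; have [d d0 hd] := cdiff_cont (hf _ _ hx hy) ltr01.
  have v0 := cabs_ge0 v; have K1 : 0 < 2 * cabs v + 1 by lra.
  exists (d / (2 * cabs v + 1)); first by rewrite divr_gt0.
  move=> x y s /andP[s0 sd] hxx hxs hyy hys; rewrite ltr_pdivlMr // in sd.
  exists (cabs (f (sqpt a v x0 y0)) + 1); first by rewrite addr_ge0 ?cabs_ge0.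
  move=> x' y' hx' hy'; rewrite -(subrK (f (sqpt a v x0 y0)) (f (sqpt a v x' y'))).
  apply: le_trans (cabsD _ _) _; rewrite addrC lerD2l; apply: hd.
  have -> : sqpt a v x' y' - sqpt a v x0 y0 = v * (rc (x' - x0) + ci R * rc (y' - y0)).
    by rewrite /sqpt !rcB; ring.
  rewrite cabsM.
  have h : cabs (rc (x' - x0) + ci R * rc (y' - y0)) <= 2 * s.
    apply: le_trans (cabsD _ _) _; rewrite cabsM cabs_ci mul1r !cabs_rc.
    have : `|x' - x0| <= s by rewrite ler_norml; lra.
    have : `|y' - y0| <= s by rewrite ler_norml; lra.
    lra.
  have := cabs_ge0 (rc (x' - x0) + ci R * rc (y' - y0)); nra.
by move=> B B0 h; exists B => // x y hx hy; apply: h; rewrite !add0r.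
Qed.
End EdgeSums.

(** * Cauchy's estimate *)

Section CauchyCentre.
Variable R : realType.
Local Notation C := (Cx R).
Implicit Types (f g k h : C -> C) (z w a v l : C).
Local Notation ci := (ci R).

(** Of the four quarters only the one at the corner [a] may meet a singularity; [goursat] makes the
    other three negligible. The [l] halvings use up the factor [2 ^ l] in the number of pieces. *)
Lemma bnd_corner k a (l : nat) v :
  (forall x y, 0 <= x <= 1 -> 0 <= y <= 1 -> (x != 0) || (y != 0) ->
     cdiff k (sqpt a v x y)) ->
  forall e : R, 0 < e -> exists J, forall j, (J <= j)%N ->
    cabs (bnd k (2 ^ (j + l)) a v - bnd k (2 ^ j) a (v / 2 ^+ l)) <= e.
Proof.
elim: l v => [|l IH] v hk e e0.
  by exists 0%N => j _; rewrite addn0 expr0 divr1 subrr cabs0 ltW.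
have E1 x y : sqpt a (v / 2) x y = sqpt a v (x / 2) (y / 2).
  by rewrite /sqpt !rcM rcV rc_nat; ring.
have E2 x y : sqpt (a + v / 2) (v / 2) x y = sqpt a v (2^-1 + x / 2) (y / 2).
  by rewrite /sqpt !(rc_nat, rcV, rcD, rcM); ring.
have E3 x y : sqpt (a + ci * v / 2) (v / 2) x y = sqpt a v (x / 2) (2^-1 + y / 2).
  by rewrite /sqpt !(rc_nat, rcV, rcD, rcM); ring.
have E4 x y : sqpt (a + v / 2 + ci * v / 2) (v / 2) x y =
    sqpt a v (2^-1 + x / 2) (2^-1 + y / 2).
  by rewrite /sqpt !(rc_nat, rcV, rcD, rcM); ring.
have e4 : 0 < e / 4 by lra.
have [|J1 hJ1] := IH (v / 2) _ (e / 4) e4.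
  move=> x y hx hy xy; rewrite E1; apply: hk; [lra|lra|].
  by move: xy; rewrite !mulf_eq0 invr_eq0 pnatr_eq0 !orbF.
have [|J2 hJ2] := @goursat R k (a + v / 2) (v / 2) _ (e / 4) e4.
  move=> x y hx hy; rewrite E2; apply: hk; [lra|lra|].
  by apply/orP; left; rewrite gt_eqF //; lra.
have [|J3 hJ3] := @goursat R k (a + ci * v / 2) (v / 2) _ (e / 4) e4.
  move=> x y hx hy; rewrite E3; apply: hk; [lra|lra|].
  by apply/orP; right; rewrite gt_eqF //; lra.
have [|J4 hJ4] := @goursat R k (a + v / 2 + ci * v / 2) (v / 2) _ (e / 4) e4.
  move=> x y hx hy; rewrite E4; apply: hk; [lra|lra|].
  by apply/orP; right; rewrite gt_eqF //; lra.
exists (maxn (maxn J1 J2) (maxn J3 J4)) => j.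
rewrite !geq_max => /andP[/andP[/hJ1 h1 j2] /andP[j3 j4]].
have h2 := hJ2 (j + l)%N (leq_trans j2 (leq_addr _ _)).
have h3 := hJ3 (j + l)%N (leq_trans j3 (leq_addr _ _)).
have h4 := hJ4 (j + l)%N (leq_trans j4 (leq_addr _ _)).
rewrite addnS expnS mul2n -addnn bnd_split ?expn_gt0 // exprS invfM mulrA.
set c2 := bnd _ _ (a + v / 2) _ in h2 *.
set c3 := bnd _ _ (a + ci * v / 2) _ in h3 *.
set c4 := bnd _ _ (a + v / 2 + _) _ in h4 *.
set c1 := bnd _ _ _ _ in h1 *; set c0 := bnd _ _ _ _ in h1 *.
have -> : c1 + c2 + c3 + c4 - c0 = (c1 - c0) + c2 + c3 + c4 by ring.
have := cabsD (c1 - c0 + c2 + c3) c4; have := cabsD (c1 - c0 + c2) c3.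
have := cabsD (c1 - c0) c2; lra.
Qed.

(** The two sides, not meeting [w], of the square with corner [w] and side [v]. The four rotated
    copies form the boundary of the square centred at [w]. *)
Definition outer k n w v : C :=
  edge k n (w + v) (ci * v) - edge k n (w + ci * v) v.
Definition around k n w v : C :=
  outer k n w v + outer k n w (ci * v) + outer k n w (- v) + outer k n w (- (ci * v)).

Lemma ciM v : ci * (ci * v) = - v.
Proof. by rewrite mulrA ci2 mulN1r. Qed.

(* The four quadrants share the edges issued from [w], which cancel. *)
Lemma aroundE k n w v : around k n w v =
  bnd k n w v + bnd k n w (ci * v) + bnd k n w (- v) + bnd k n w (- (ci * v)).
Proof. by rewrite /around /outer /bnd !mulrN !ciM opprK; ring. Qed.

Definition rim w v z := exists x y : R, [/\ z = sqpt w v x y,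
  -1 <= x <= 1, -1 <= y <= 1 & (`|x| = 1) \/ (`|y| = 1)].

Lemma rim_dist w v z : rim w v z -> cabs v <= cabs (z - w) <= 2 * cabs v.
Proof.
move=> [x [y [-> hx hy h]]].
rewrite /sqpt addrAC subrr add0r cabsM.
have v0 := cabs_ge0 v.
have h1 : 1 <= cabs (rc x + ci * rc y).
  case: h => <-; last first.
    by apply: le_trans (Im_le_cabs _); rewrite !RIE !(mul0r, mul1r, mulr0, add0r, addr0, subr0).
  by apply: le_trans (Re_le_cabs _); rewrite !RIE !(mul0r, mul1r, mulr0, add0r, addr0, subr0).
have h2 : cabs (rc x + ci * rc y) <= 2.
  apply: le_trans (cabsD _ _) _; rewrite cabsM cabs_ci mul1r !cabs_rc.
  have : `|x| <= 1 by rewrite ler_norml.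
  have : `|y| <= 1 by rewrite ler_norml.
  lra.
nra.
Qed.

Lemma rim_rot w v z : rim w (ci * v) z -> rim w v z.
Proof.
move=> [x [y [-> hx hy h]]]; exists (- y), x; split; rewrite ?normrN; [|lra|lra|].
- rewrite /sqpt rcN; have -> : w + ci * v * (rc x + ci * rc y) =
    w + ci * v * rc x + (ci * ci) * v * rc y by ring.
  by rewrite ci2; ring.
- by case: h; [right|left].
Qed.

Lemma outer_le k n w v (B : R) : 0 <= B ->
  (forall z, rim w v z -> cabs (k z) <= B) -> cabs (outer k n w v) <= 2 * (cabs v * B).
Proof.
move=> B0 hB.
have h1 : cabs (edge k n (w + v) (ci * v)) <= cabs v * B.
  have -> : cabs v = cabs (ci * v) by rewrite cabsM cabs_ci mul1r.
  apply: edge_le => // t t01; apply: hB; exists 1, t; split; [|lra|lra|].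
    by rewrite /sqpt rc1; ring.
  by left; rewrite normr1.
have h2 : cabs (edge k n (w + ci * v) v) <= cabs v * B.
  apply: edge_le => // t t01; apply: hB; exists t, 1; split; [|lra|lra|].
    by rewrite /sqpt rc1; ring.
  by right; rewrite normr1.
rewrite /outer; apply: le_trans (cabsB _ _) _; lra.
Qed.

Lemma around_le k n w v (B : R) : 0 <= B ->
  (forall z, rim w v z -> cabs (k z) <= B) -> cabs (around k n w v) <= 8 * (cabs v * B).
Proof.
move=> B0 hB.
have r1 z : rim w (ci * v) z -> rim w v z := @rim_rot w v z.
have r2 z : rim w (- v) z -> rim w v z.
  by rewrite -ciM => /rim_rot /rim_rot.
have r3 z : rim w (- (ci * v)) z -> rim w v z.
  by rewrite -mulrN => /rim_rot /r2.
have h1 := outer_le n B0 hB.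
have h2 := outer_le n B0 (fun z hz => hB z (r1 z hz)).
have h3 := outer_le n B0 (fun z hz => hB z (r2 z hz)).
have h4 := outer_le n B0 (fun z hz => hB z (r3 z hz)).
rewrite !cabsN !cabsM cabs_ci !mul1r in h2 h3 h4.
rewrite /around; apply: le_trans (cabsD _ _) _.
have := cabsD (outer k n w v + outer k n w (ci * v)) (outer k n w (- v)).
have := cabsD (outer k n w v) (outer k n w (ci * v)); lra.
Qed.

Lemma ImZr (x : R) z : complex.Im (rc x * z) = x * complex.Im z.
Proof. by rewrite !RIE mul0r addr0. Qed.
Lemma Im_sum (I : Type) (s : seq I) (F : I -> C) :
  complex.Im (\sum_(i <- s) F i) = \sum_(i <- s) complex.Im (F i).
Proof. by elim/big_ind2: _ => // ? ? ? ? <- <-; rewrite ImD. Qed.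

(* The discretized winding integral of [1 / (z - w)] stays away from 0. *)
Lemma Im_outer_inv n w v : (0 < n)%N -> v != 0 ->
  1 <= complex.Im (outer (fun z => (z - w)^-1) n w v).
Proof.
move=> n0 v0; have n0' : (0 : R) < n%:R by rewrite ltr0n.
have nC : n%:R != 0 :> C by rewrite pnatr_eq0 -lt0n.
(* Along the edge through [w + v] the form [dz / (z - w)] has imaginary part [1 / (1 + t ^ 2)], at
   least 1/2, and the other edge is symmetric. The four corners together give 4 instead of [2 pi],
   which only affects constants. *)
have term t : 0 < t < 1 -> 2^-1 <= complex.Im (ci / (1 + ci * rc t) : C).
  move=> ht; set z : C := 1 + _.
  have z0 : z != 0.
    apply/eqP => /(congr1 (@complex.Re R)); rewrite /z -rc1 !RIE /= => h; lra.
  have -> : ci / z = rc ((1 + t ^+ 2)^-1) * (ci + rc t).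
    rewrite rcV; apply: (mulIf z0); rewrite divfK // -mulrA.
    have -> : (ci + rc t) * z = ci * (1 + rc t * rc t) + rc t * (1 + ci * ci) by rewrite /z; ring.
    rewrite ci2 subrr mulr0 addr0 -rcM -expr2 -rc1 -rcD mulrCA -rcV -rcM mulVf ?mulr1 //.
    by rewrite gt_eqF //; nra.
  rewrite ImZr !RIE addr0 mulr1 lef_pV2 ?posrE; nra.
have term2 t : 0 < t < 1 -> 2^-1 <= complex.Im (- (1 / (ci + rc t)) : C).
  move=> ht; set z : C := ci + _.
  have z0 : z != 0.
    apply/eqP => /(congr1 (@complex.Im R)); rewrite /z !RIE /= => h; lra.
  have -> : - (1 / z) = rc ((1 + t ^+ 2)^-1) * (ci - rc t).
    rewrite rcV; apply: (mulIf z0); rewrite mulNr divfK // -mulrA.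
    have -> : (ci - rc t) * z = ci * ci - rc t * rc t by rewrite /z; ring.
    rewrite ci2 -rcM -expr2 -rc1 -rcN -rcB -rcV -rcM; congr rc.
    by field; rewrite gt_eqF //; nra.
  rewrite ImZr !RIE oppr0 addr0 mulr1 lef_pV2 ?posrE; nra.
rewrite /outer ImD ImN /edge !Im_sum.
have -> : (1 : R) = \sum_(i < n) n%:R^-1 * 2^-1 + \sum_(i < n) n%:R^-1 * 2^-1.
  by rewrite !sumr_const card_ord -[_ *+ n]mulr_natl; field; rewrite gt_eqF.
have scal (z c : C) : (v * z)^-1 * (c * v / n%:R) = rc n%:R^-1 * (c / z).
  rewrite invfM rcV rc_nat.
  have -> : v^-1 * z^-1 * (c * v / n%:R) = (v^-1 * v) * (n%:R^-1 * (c / z)) by ring.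
  by rewrite mulVf // mul1r.
rewrite -sumrN; apply: lerD; apply: ler_sum => i _.
  have -> : (w + v + ci * v * rc (mid R n i) - w)^-1 * (ci * v / n%:R) =
     rc (n%:R^-1) * (ci / (1 + ci * rc (mid R n i))).
    have -> : w + v + ci * v * rc (mid R n i) - w = v * (1 + ci * rc (mid R n i)) by ring.
    exact: scal.
  rewrite ImZr; apply: ler_wpM2l; first by rewrite invr_ge0 ltW.
  by apply: term; exact: mid_bounds.
have -> : (w + ci * v + v * rc (mid R n i) - w)^-1 * (v / n%:R) =
     - (rc (n%:R^-1) * (- (1 / (ci + rc (mid R n i))))).
  have -> : w + ci * v + v * rc (mid R n i) - w = v * (ci + rc (mid R n i)) by ring.
  by have := scal (ci + rc (mid R n i)) 1; rewrite mul1r => ->; rewrite mulrN opprK.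
rewrite ImN opprK ImZr; apply: ler_wpM2l; first by rewrite invr_ge0 ltW.
by apply: term2; exact: mid_bounds.
Qed.

Lemma around_inv_ge n w v : (0 < n)%N -> v != 0 ->
  4 <= cabs (around (fun z => (z - w)^-1) n w v).
Proof.
move=> n0 v0; apply: le_trans (le_trans (ler_norm _) (Im_le_cabs _)).
have iv0 : ci * v != 0 by rewrite -cabs_eq0 cabsM cabs_ci mul1r cabs_eq0.
have h1 := Im_outer_inv w n0 v0; have h2 := Im_outer_inv w n0 iv0.
have h3 : 1 <= complex.Im (outer (fun z => (z - w)^-1) n w (- v)).
  by apply: Im_outer_inv; rewrite ?oppr_eq0.
have h4 : 1 <= complex.Im (outer (fun z => (z - w)^-1) n w (- (ci * v))).
  by apply: Im_outer_inv; rewrite ?oppr_eq0.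
rewrite /around; move: h1 h2 h3 h4.
move: (outer _ n w v) (outer _ n w (ci * v)) (outer _ n w (- v)) (outer _ n w (- (ci * v))).
by move=> o1 o2 o3 o4; rewrite !ImD; lra.
Qed.

Lemma around_lin (f g k : C -> C) c n w v : (forall z, f z = c * g z + k z) ->
  around f n w v = c * around g n w v + around k n w v.
Proof.
move=> /funext ->; rewrite /around /outer !edgeD !edgeZ; ring.
Qed.

(** The sums of [h z / (z - w)] around a large and a small square nearly agree. On the small square
    the sum is close to [h w] times a number of modulus at least 4; on the large one it is at most
    [8 * B], the perimeter being [8 * cabs v]. At [w] itself only continuity is asked, so that the
    lemma applies to divided differences. *)
Lemma cauchy_centre h w v (B : R) : v != 0 ->
  (forall x y, -1 <= x <= 1 -> -1 <= y <= 1 -> (x != 0) || (y != 0) ->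
     cdiff h (sqpt w v x y)) ->
  (forall e : R, 0 < e -> exists2 d : R, 0 < d &
     forall z, cabs (z - w) < d -> cabs (h z - h w) <= e) ->
  (forall z, rim w v z -> cabs (h z) <= B) ->
  cabs (h w) <= 2 * B.
Proof.
move=> v0 hdiff hcont hB.
have vp : 0 < cabs v by rewrite cabs_gt0.
have B0 : 0 <= B.
  apply: le_trans (cabs_ge0 _) (hB (w + v) _); exists 1, 0; split; [|lra|lra|].
    by rewrite /sqpt rc1 rc0; ring.
  by left; rewrite normr1.
pose k z := h z / (z - w).
(* Of the error [9 * e], one [e] comes from passing between the squares and [8 * e] from replacing
   [h z] by [h w] on the small one. *)
suff main (e : R) : 0 < e -> 4 * cabs (h w) <= 8 * B + 9 * e.
  rewrite -subr_le0 leNgt; apply/negP => hlt.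
  by have := main ((cabs (h w) - 2 * B) / 3); lra.
move=> e0; have [d d0 hd] := hcont e e0.
have h12 : 0 <= (2^-1 : R) < 1 by lra.
(* After [l] halvings the square lies in the disc where [h] differs from [h w] by at most [e]. *)
have [l hl] := geo_small (2 * cabs v) h12 d0.
have hkd (u : C) : (u = v \/ u = ci * v) \/ (u = - v \/ u = - (ci * v)) ->
  forall x y, 0 <= x <= 1 -> 0 <= y <= 1 -> (x != 0) || (y != 0) ->
  cdiff k (sqpt w u x y).
  move=> hu x y hx hy xy.
  have [x' [y' [-> hx' hy' xy']]] : exists x' y', [/\ sqpt w u x y = sqpt w v x' y',
     -1 <= x' <= 1, -1 <= y' <= 1 & (x' != 0) || (y' != 0)].
    have cc (p : C) : ci * v * (p + ci * rc y) = v * (- rc y + ci * p).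
      have -> : ci * v * (p + ci * rc y) = v * (ci * p + ci * ci * rc y) by ring.
      by rewrite ci2; ring.
    case: hu => -[] ->.
    - by exists x, y; split=> //; lra.
    - exists (- y), x; split; [|lra|lra|by rewrite oppr_eq0 orbC].
      by rewrite /sqpt cc rcN.
    - exists (- x), (- y); split; [|lra|lra|by rewrite !oppr_eq0].
      by rewrite /sqpt !rcN; ring.
    - exists y, (- x); split; [|lra|lra|by rewrite oppr_eq0 orbC].
      by rewrite /sqpt mulNr cc !rcN; ring.
  apply: cdiffM; first exact: hdiff.
  apply: cdiffV; last by apply: cdiffB; [exact: cdiff_id | exact: cdiff_cst].
  rewrite /sqpt addrAC subrr add0r mulf_neq0 //.
  apply/negP => /eqP hz; have := congr1 (@complex.Re R) hz; have := congr1 (@complex.Im R) hz.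
  rewrite !RIE /= !(mul0r, mul1r, addr0, add0r, subr0) => y0 x0.
  by move: xy'; rewrite x0 y0 eqxx.
have e4 : 0 < e / 4 by lra.
have [J1 hJ1] := bnd_corner l (hkd v (or_introl (or_introl erefl))) e4.
have [J2 hJ2] := bnd_corner l (hkd (ci * v) (or_introl (or_intror erefl))) e4.
have [J3 hJ3] := bnd_corner l (hkd (- v) (or_intror (or_introl erefl))) e4.
have [J4 hJ4] := bnd_corner l (hkd (- (ci * v)) (or_intror (or_intror erefl))) e4.
pose j := (J1 + J2 + J3 + J4)%N.
have j1 : (J1 <= j)%N by rewrite /j -!addnA leq_addr.
have j2 : (J2 <= j)%N by rewrite /j addnAC [(J1 + J2)%N]addnC -!addnA leq_addr.
have j3 : (J3 <= j)%N by rewrite /j addnAC leq_addl.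
have j4 : (J4 <= j)%N by rewrite /j leq_addl.
have {hJ1} g1 := hJ1 j j1; have {hJ2} g2 := hJ2 j j2.
have {hJ3} g3 := hJ3 j j3; have {hJ4} g4 := hJ4 j j4.
pose v' := v / 2 ^+ l.
have clos : cabs (around k (2 ^ (j + l)) w v - around k (2 ^ j) w v') <= e.
  rewrite !aroundE.
  have e2 : ci * v' = ci * v / 2 ^+ l by rewrite /v' mulrA.
  have e3 : - v' = - v / 2 ^+ l by rewrite /v' mulNr.
  have e5 : - (ci * v / 2 ^+ l) = - (ci * v) / 2 ^+ l by rewrite mulNr.
  rewrite e2 e3 e5.
  set p1 := bnd _ _ _ _ in g1 *; set p2 := bnd _ _ _ _ in g2 *.
  set p3 := bnd _ _ _ _ in g3 *; set p4 := bnd _ _ _ _ in g4 *.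
  set q1 := bnd _ _ _ _ in g1 *; set q2 := bnd _ _ _ _ in g2 *.
  set q3 := bnd _ _ _ _ in g3 *; set q4 := bnd _ _ _ _ in g4 *.
  have -> : p1 + p2 + p3 + p4 - (q1 + q2 + q3 + q4) =
    (p1 - q1) + (p2 - q2) + (p3 - q3) + (p4 - q4) by ring.
  have := cabsD (p1 - q1 + (p2 - q2) + (p3 - q3)) (p4 - q4).
  have := cabsD (p1 - q1 + (p2 - q2)) (p3 - q3).
  have := cabsD (p1 - q1) (p2 - q2); lra.
have vl : cabs v' = cabs v * 2^-1 ^+ l.
  by rewrite /v' cabsM cabsV cabsX cabs_nat exprVn.
have v'0 : v' != 0 by rewrite -cabs_gt0 vl mulr_gt0 // exprn_gt0.
have v'p : 0 < cabs v' by rewrite cabs_gt0.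
have up : cabs (around k (2 ^ (j + l)) w v) <= 8 * B.
  have -> : 8 * B = 8 * (cabs v * (B / cabs v)).
    by field; rewrite gt_eqF.
  apply: around_le => [|z hz]; first by rewrite divr_ge0 // ltW.
  rewrite /k cabsM cabsV; have /andP[hz1 _] := rim_dist hz.
  by apply: ler_pM; rewrite ?cabs_ge0 ?invr_ge0 ?cabs_ge0 ?hB // lef_pV2 ?posrE // (lt_le_trans vp).
have lin : around k (2 ^ j) w v' = h w * around (fun z => (z - w)^-1) (2 ^ j) w v' +
   around (fun z => (h z - h w) / (z - w)) (2 ^ j) w v'.
  by apply: around_lin => z; rewrite /k; ring.
have rest : cabs (around (fun z => (h z - h w) / (z - w)) (2 ^ j) w v') <= 8 * e.
  have -> : 8 * e = 8 * (cabs v' * (e / cabs v')).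
    by field; rewrite gt_eqF.
  apply: around_le => [|z hz]; first by rewrite divr_ge0 // ltW.
  rewrite cabsM cabsV; have /andP[hz1 hz2] := rim_dist hz.
  apply: ler_pM; rewrite ?cabs_ge0 ?invr_ge0 ?cabs_ge0 //.
    by apply: hd; apply: le_lt_trans hz2 _; rewrite vl mulrA; exact: hl.
  by rewrite lef_pV2 ?posrE // (lt_le_trans v'p).
have n0 : (0 < 2 ^ j)%N by rewrite expn_gt0.
have low := around_inv_ge w n0 v'0.
have h0 := cabs_ge0 (h w).
have : cabs (h w) * 4 <= cabs (around k (2 ^ j) w v') + 8 * e.
  rewrite -[around k _ _ _](addrK (around (fun z => (h z - h w) / (z - w)) (2 ^ j) w v')).
  apply: (@le_trans _ _ (cabs (h w * around (fun z => (z - w)^-1) (2 ^ j) w v'))).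
    by rewrite cabsM ler_wpM2l.
  have -> : h w * around (fun z => (z - w)^-1) (2 ^ j) w v' = around k (2 ^ j) w v' -
     around (fun z => (h z - h w) / (z - w)) (2 ^ j) w v' by rewrite lin; ring.
  rewrite addrK; apply: le_trans (cabsB _ _) _; lra.
have := cabsB_ge (around k (2 ^ j) w v') (around k (2 ^ (j + l)) w v).
rewrite cabsC; lra.
Qed.

End CauchyCentre.

(** * Weierstrass theorem and analytic continuation *)

Section Weierstrass.
Variable R : realType.
Local Notation C := (Cx R).
Implicit Types (f g h : C -> C) (z w a v l c : C).
Local Notation ci := (ci R).

Lemma sqpt_dist w v (x y : R) : -1 <= x <= 1 -> -1 <= y <= 1 ->
  cabs (sqpt w v x y - w) <= 2 * cabs v.
Proof.
move=> hx hy; rewrite /sqpt addrAC subrr add0r cabsM mulrC.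
apply: ler_wpM2r; first exact: cabs_ge0.
apply: le_trans (cabsD _ _) _; rewrite cabsM cabs_ci mul1r !cabs_rc.
have : `|x| <= 1 by rewrite ler_norml.
have : `|y| <= 1 by rewrite ler_norml.
lra.
Qed.

Lemma rim_sqpt w v z : rim w v z -> exists x y : R, [/\ z = sqpt w v x y,
  -1 <= x <= 1 & -1 <= y <= 1].
Proof. by move=> [x [y [h1 h2 h3 _]]]; exists x, y. Qed.

Lemma cauchy_bound f w (s B : R) : 0 < s ->
  (forall z, cabs (z - w) <= 2 * s -> cdiff f z) ->
  (forall z, s <= cabs (z - w) <= 2 * s -> cabs (f z) <= B) -> cabs (f w) <= 2 * B.
Proof.
move=> s0 hf hB; have cs : cabs (rc s) = s by rewrite cabs_rc gtr0_norm.
apply: (@cauchy_centre R f w (rc s)).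
- by rewrite -cabs_gt0 cs.
- by move=> x y hx hy _; apply: hf; rewrite -{2}cs; exact: sqpt_dist.
- apply: cdiff_cont; apply: hf; rewrite subrr cabs0; lra.
- by move=> z /rim_dist; rewrite cs => /hB.
Qed.

(** The divided difference of [f] at [w], completed by the value [l], is continuous at [w] and
    bounded by [2 * B / s] on the rim; [cauchy_centre] doubles this. *)
Lemma cauchy_deriv f w l (s B : R) : 0 < s -> 
  (forall z, cabs (z - w) <= 2 * s -> cdiff f z) -> cderiv f w l ->
  (forall z, cabs (z - w) <= 2 * s -> cabs (f z) <= B) -> cabs l <= 4 * B / s.
Proof.
move=> s0 hf hl hB; have cs : cabs (rc s) = s by rewrite cabs_rc gtr0_norm.
pose h z := if z == w then l else (f z - f w) / (z - w).
have hw : h w = l by rewrite /h eqxx.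
rewrite -hw; have -> : 4 * B / s = 2 * (2 * B / s) by ring.
apply: (@cauchy_centre R h w (rc s)).
- by rewrite -cabs_gt0 cs.
- move=> x y hx hy xy; set z := sqpt _ _ _ _.
  have zw : z != w.
    rewrite -subr_eq0 /z /sqpt addrAC subrr add0r mulf_neq0 //.
      by rewrite -cabs_gt0 cs.
    apply/negP => /eqP hz; have := congr1 (@complex.Re R) hz; have := congr1 (@complex.Im R) hz.
    rewrite !RIE /= !(mul0r, mul1r, addr0, add0r, subr0) => y0 x0.
    by move: xy; rewrite x0 y0 eqxx.
  have zw0 : 0 < cabs (z - w) by rewrite cabs_gt0 subr_eq0.
  apply: (@cdiff_near R (fun z => (f z - f w) / (z - w))).
    apply: cdiffM.
      by apply: cdiffB; [apply: hf; rewrite -cs; exact: sqpt_dist | exact: cdiff_cst].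
    apply: cdiffV; first by rewrite subr_eq0.
    by apply: cdiffB; [exact: cdiff_id | exact: cdiff_cst].
  exists (cabs (z - w)) => // u hu; rewrite /h ifF //; apply/eqP => uw.
  by move: hu; rewrite uw cabsC ltxx.
- move=> e e0; have [d d0 hd] := hl e e0; exists d => // z hz.
  rewrite hw /h; case: eqVneq => [_|zw]; first by rewrite subrr cabs0 ltW.
  have zw0 : z - w != 0 by rewrite subr_eq0.
  have -> : (f z - f w) / (z - w) - l = (f z - f w - l * (z - w)) / (z - w).
    by rewrite [RHS]mulrBl mulfK.
  by rewrite cabsM cabsV ler_pdivrMr ?cabs_gt0 //; exact: hd.
- move=> z /rim_dist; rewrite cs => /andP[h1 h2].
  rewrite /h ifF; last first.
    by apply/eqP => zw; move: h1; rewrite zw subrr cabs0; lra.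
  rewrite cabsM cabsV; apply: ler_pM; rewrite ?cabs_ge0 ?invr_ge0 ?cabs_ge0 //.
    apply: le_trans (cabsB _ _) _; have := hB z h2.
    have := hB w; rewrite subrr cabs0 => /(_ ltac:(lra)); lra.
  by rewrite lef_pV2 ?posrE // (lt_le_trans s0).
Qed.

(** Increments along the segment add under bisection, and the slack [e] absorbs the first-order
    error near each point; it is removed at the end. *)
Lemma mean_value f a v (K : R) :
  (forall x, 0 <= x <= 1 -> exists2 l, cderiv f (a + rc x * v) l & cabs l <= K) ->
  cabs (f (a + v) - f a) <= K * cabs v.
Proof.
move=> hf; have v0 := cabs_ge0 v.
suff main (e : R) : 0 < e -> cabs (f (a + v) - f a) <= (K + e) * cabs v.
  rewrite leNgt; apply/negP => hlt.
  have K1 : 0 < cabs v + 1 by lra.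
  pose e := (cabs (f (a + v) - f a) - K * cabs v) / 2 / (cabs v + 1).
  have e0 : 0 < e by rewrite !divr_gt0 //; lra.
  have : e * cabs v <= (cabs (f (a + v) - f a) - K * cabs v) / 2.
    rewrite /e -mulrA ler_piMr //; first lra.
    by rewrite mulrC ler_pdivrMr // mul1r; lra.
  have := main e e0; lra.
move=> e0.
pose P (x y s : R) := cabs (f (a + rc (x + s) * v) - f (a + rc x * v)) <= (K + e) * (s * cabs v).
suff : P 0 0 1 by rewrite /P add0r rc0 rc1 mul0r addr0 !mul1r.
apply: (@cousin R P).
  move=> x y s; rewrite /P => h1 h2 _ _.
  have xs : x + s / 2 + s / 2 = x + s by lra.
  rewrite xs in h2; apply: le_trans (cabs_tri (f (a + rc (x + s / 2) * v)) _ _) _.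
  lra.
move=> x0 y0 hx _; have [l hl lK] := hf x0 hx.
have [d d0 hd] := hl e e0.
have K1 : 0 < cabs v + 1 by lra.
exists (d / (cabs v + 1)); first by rewrite divr_gt0.
move=> x y s /andP[s0 sd] hx1 hx2 _ _; rewrite ltr_pdivlMr // in sd.
rewrite /P.
have near (x' : R) : `|x' - x0| <= s ->
   cabs (f (a + rc x' * v) - f (a + rc x0 * v)) <= (K + e) * (`|x' - x0| * cabs v).
  move=> hx'; have E : a + rc x' * v - (a + rc x0 * v) = rc (x' - x0) * v.
    by rewrite rcB; ring.
  have := hd (a + rc x' * v); rewrite E cabsM cabs_rc => /(_ ltac:(nra)) h.
  rewrite -[f _ - f _](subrK (l * (rc (x' - x0) * v))).
  apply: le_trans (cabsD _ _) _; rewrite cabsM cabsM cabs_rc.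
  have : cabs l * (`|x' - x0| * cabs v) <= K * (`|x' - x0| * cabs v).
    by apply: ler_wpM2r => //; rewrite mulr_ge0.
  lra.
have h1 := near (x + s); rewrite ger0_norm in h1; last lra.
have h2 := near x; rewrite ler0_norm in h2; last lra.
apply: le_trans (cabs_tri (f (a + rc x0 * v)) _ _) _; rewrite [cabs (_ - f (a + rc x * v))]cabsC.
have {}h1 := h1 ltac:(lra); have {}h2 := h2 ltac:(lra).
apply: le_trans (lerD h1 h2) _; rewrite -mulrDr -mulrDl.
by have -> : x + s - x0 + - (x - x0) = s by ring.
Qed.

(** The Cauchy estimate converts the uniform bound on [f j - f i] into one on derivatives, so the
    derivatives at [w] converge. By [mean_value] the difference quotients of [f i - f j] are small
    uniformly in [i], and this survives [i] tending to infinity. *)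
Lemma weierstrass (f : nat -> C -> C) g w (rho A r : R) : 0 < rho -> 0 <= r < 1 ->
  (forall j z, cabs (z - w) <= rho -> cdiff (f j) z) ->
  (forall j z, cabs (z - w) <= rho -> cabs (f j z - g z) <= A * r ^+ j) ->
  cdiff g w.
Proof.
move=> rho0 hr hf hg; have /andP[r0 r1] := hr.
have A0 : 0 <= A.
  by have := hg 0%N w; rewrite subrr cabs0 expr0 mulr1 => /(_ (ltW rho0)); apply: le_trans; exact: cabs_ge0.
have rj j : 0 <= r ^+ j by exact: exprn_ge0.
have rjj i j : (i <= j)%N -> r ^+ j <= r ^+ i by move=> ij; apply: ler_wiXn2l => //; exact: ltW.
(* The constant is [4 * (2 * A) / (rho / 4)]: [f j - f i] is at most [2 * A * r ^+ i], and squares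
   of half side [rho / 4] about a point of the half disc stay in the disc. *)
have diff2 i j z l : (i <= j)%N -> cabs (z - w) <= rho / 2 ->
   cderiv (fun z => f j z - f i z) z l -> cabs l <= (32 * A / rho) * r ^+ i.
  move=> ij hz hl.
  have -> : 32 * A / rho * r ^+ i = 4 * (2 * A * r ^+ i) / (rho / 4) by field; rewrite gt_eqF.
  have hin u : cabs (u - z) <= 2 * (rho / 4) -> cabs (u - w) <= rho.
    by move=> hu; apply: le_trans (cabs_tri z _ _) _; lra.
  apply: (@cauchy_deriv _ z l (rho / 4) _ _ _ hl); first lra.
    by move=> u /hin hu; apply: cdiffB; exact: hf.
  move=> u /hin hu; apply: le_trans (cabs_tri (g u) _ _) _.
  have h1 := hg j u hu; have h2 := hg i u hu; rewrite cabsC in h2.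
  have := ler_wpM2l A0 (rjj _ _ ij); lra.
have [l hl] := choice (fun j => hf j w (ltac:(rewrite subrr cabs0; lra))).
have hl1 n : cabs (l n.+1 - l n) <= (32 * A / rho) * r ^+ n.
  apply: (@diff2 n n.+1 w) => //; first by rewrite subrr cabs0; lra.
  exact: cderivB.
exists (climit l) => e e0.
have e3 : 0 < e / 3 by lra.
have [N hN] := geo_small (32 * A / rho) hr e3.
have [M hM] := climitP hr hl1 e3.
pose j := maxn N M.
have [d d0 hd] := hl j _ e3.
exists (Num.min d (rho / 2)); first by rewrite lt_min d0; lra.
move=> z; rewrite lt_min => /andP[zd zr].
have hjz := hd z zd.
have hlj : cabs (l j - climit l) < e / 3 by apply: hM; rewrite leq_maxr.
have hmv i : (j <= i)%N ->
   cabs ((f i z - f j z) - (f i w - f j w)) <= e / 3 * cabs (z - w).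
  move=> ji; have := @mean_value (fun z => f i z - f j z) w (z - w) (32 * A / rho * r ^+ j).
  rewrite addrCA subrr addr0 => h; apply: le_trans (h _) _.
    move=> x hx.
    have hin : cabs (w + rc x * (z - w) - w) <= rho / 2.
      rewrite addrAC subrr add0r cabsM cabs_rc ger0_norm; last lra.
      have := cabs_ge0 (z - w); nra.
    have [|p hp] := hf i (w + rc x * (z - w)); first lra.
    have [|p' hp'] := hf j (w + rc x * (z - w)); first lra.
    exists (p - p'); first exact: cderivB.
    by apply: diff2 ji hin _; exact: cderivB.
  apply: ler_wpM2r; first exact: cabs_ge0.
  by apply/ltW/hN; rewrite leq_maxl.
have hzr : cabs (z - w) <= rho by lra.
have hlim : cabs ((g z - f j z) - (g w - f j w)) <= e / 3 * cabs (z - w).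
  apply: (@ccvg_le _ (fun i => (f i z - f j z) - (f i w - f j w)) _ _ j) => //.
  have cv u : cabs (u - w) <= rho -> ccvg (fun i => f i u) (g u).
    move=> hu e' e'0; have [N' hN'] := geo_small A hr e'0.
    by exists N' => n /hN'; apply: le_lt_trans; exact: hg.
  have cw : ccvg (fun i => f i w) (g w) by apply: cv; rewrite subrr cabs0; lra.
  have -> : (fun i => (f i z - f j z) - (f i w - f j w)) =
     (fun i => (f i z + (-1) * f i w) + (f j w - f j z)) by apply/funext => i; ring.
  have -> : (g z - f j z) - (g w - f j w) = (g z + (-1) * g w) + (f j w - f j z) by ring.
  apply: ccvgD (ccvg_cst _); apply: ccvgD; first exact: cv.
  exact: ccvgM (ccvg_cst _) cw.
have -> : g z - g w - climit l * (z - w) = ((g z - f j z) - (g w - f j w)) +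
   (f j z - f j w - l j * (z - w)) + (l j - climit l) * (z - w) by ring.
have h3 : cabs ((l j - climit l) * (z - w)) <= e / 3 * cabs (z - w).
  by rewrite cabsM; apply: ler_wpM2r; [exact: cabs_ge0 | exact: ltW].
apply: le_trans (cabsD _ _) _.
have := cabsD ((g z - f j z) - (g w - f j w)) (f j z - f j w - l j * (z - w)).
lra.
Qed.

(* The Cauchy bound applied to [f / (z - c)^N] improves by [2^-N]. *)
Lemma identity_ball f c (rho : R) : 0 < rho ->
  (forall z, cabs (z - c) < rho -> cdiff f z) ->
  (exists2 d : R, 0 < d & forall z, cabs (z - c) < d -> f z = 0) ->
  forall w, cabs (w - c) < rho / 8 -> f w = 0.
Proof.
move=> rho0 hf [d d0 hd] w hw.
have [->|wc] := eqVneq w c; first by apply: hd; rewrite subrr cabs0.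
pose t := cabs (w - c); have t0 : 0 < t by rewrite cabs_gt0 subr_eq0.
(* The square of half side [3 * t] about [w] lies within [7 * t < rho] of [c], while its rim is at
   distance at least [2 * t] from [c], twice that of [w]: each division by [z - c] gains a factor
   1/2. *)
rewrite -/t in hw; pose s := 3 * t; have s0 : 0 < s by rewrite /s; lra.
have hin z : cabs (z - w) <= 2 * s -> cabs (z - c) < rho.
  by move=> hz; apply: le_lt_trans (cabs_tri w _ _) _; rewrite -/t; rewrite /s in hz; lra.
have [B B0 hB] : exists2 B : R, 0 <= B & forall z, rim w (rc s) z -> cabs (f z) <= B.
  have [|B B0 hB] := @bounded_sq R f (sqpt w (rc s) (-1) (-1)) (rc (2 * s)).
    move=> x y hx hy; apply: hf; apply: hin.
    have -> : sqpt (sqpt w (rc s) (-1) (-1)) (rc (2 * s)) x y = sqpt w (rc s) (2 * x - 1) (2 * y - 1).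
      by rewrite /sqpt !rcM !rcB !rcM !rcN rc_nat rc1; ring.
    have -> : 2 * s = 2 * cabs (rc s) by rewrite cabs_rc gtr0_norm.
    by apply: sqpt_dist; lra.
  exists B => // z /rim_sqpt [x [y [-> hx hy]]].
  have -> : sqpt w (rc s) x y = sqpt (sqpt w (rc s) (-1) (-1)) (rc (2 * s)) ((x + 1) / 2) ((y + 1) / 2).
    by rewrite /sqpt !rcM !rcD !rcN rcV !rc_nat rc1; field.
  by apply: hB; lra.
have main N : cabs (f w) <= 2 * B * 2^-1 ^+ N.
  pose h z := f z / (z - c) ^+ N.
  have hz0 z : cabs (z - c) < rho -> cdiff h z.
    move=> hz; have [->|zc] := eqVneq z c.
      apply: (@cdiff_near R (fun=> 0)); first exact: cdiff_cst.
      by exists d => // u hu; rewrite /h hd // mul0r.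
    apply: cdiffM; first exact: hf.
    apply: cdiffV; first by rewrite expf_neq0 // subr_eq0.
    by apply: cdiffX; apply: cdiffB; [exact: cdiff_id | exact: cdiff_cst].
  have cs : cabs (rc s) = s by rewrite cabs_rc gtr0_norm.
  have : cabs (h w) <= 2 * (B / (2 * t) ^+ N).
    apply: (@cauchy_centre R h w (rc s)).
    - by rewrite -cabs_gt0 cs.
    - move=> x y hx hy _; apply: hz0; apply: hin; rewrite -{2}cs; exact: sqpt_dist.
    - by apply: cdiff_cont; apply: hz0; rewrite -/t; lra.
    - move=> z hz; rewrite /h cabsM cabsV cabsX.
      have zc : 2 * t <= cabs (z - c).
        have /andP[h1 _] := rim_dist hz; rewrite cs /s in h1.
        have := cabs_tri c z w; rewrite [cabs (c - w)]cabsC -/t; lra.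
      have t2 : 0 < 2 * t by lra.
      apply: ler_pM; rewrite ?cabs_ge0 ?invr_ge0 ?exprn_ge0 ?cabs_ge0 ?hB //.
      rewrite lef_pV2 ?posrE ?exprn_gt0 //; last by lra.
      by apply: lerXn2r; rewrite ?nnegrE ?cabs_ge0 // ltW.
  rewrite /h cabsM cabsV cabsX -/t ler_pdivrMr ?exprn_gt0 // => hle.
  apply: le_trans hle _; rewrite exprMn invfM exprVn.
  by rewrite le_eqVlt; apply/orP; left; apply/eqP; field; rewrite !expf_neq0 // gt_eqF.
apply/eqP; rewrite -cabs_eq0; apply/eqP/le_anti; rewrite cabs_ge0 andbT leNgt.
apply/negP => hlt; have h12 : 0 <= (2^-1 : R) < 1 by lra.
have [N hN] := geo_small (2 * B) h12 hlt.
by have := main N; rewrite leNgt hN.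
Qed.

(** Vanishing near a point is propagated along the segment. Implications compose, so [cousin]
    applies to the property [Z x -> Z (x + s)]. *)
Lemma identity_segment f a v :
  (forall x : R, 0 <= x <= 1 -> exists2 rho : R, 0 < rho &
     forall z, cabs (z - (a + rc x * v)) < rho -> cdiff f z) ->
  (exists2 d : R, 0 < d & forall z, cabs (z - a) < d -> f z = 0) ->
  f (a + v) = 0.
Proof.
move=> hf h0.
pose Z (x : R) := exists2 d : R, 0 < d & forall z, cabs (z - (a + rc x * v)) < d -> f z = 0.
suff : Z 0 -> Z (0 + 1).
  rewrite add0r /Z rc0 rc1 mul0r addr0 mul1r => /(_ h0) [d d0]; apply.
  by rewrite subrr cabs0.
pose P (x y s : R) := Z x -> Z (x + s).
apply: (@cousin R P).
  move=> x y s h1 h2 _ _ /h1 /h2; rewrite -addrA -splitr //.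
move=> x0 y0 hx _; have [rho rho0 hrho] := hf x0 hx.
have v0 := cabs_ge0 v; have K1 : 0 < 32 * (cabs v + 1) by lra.
(* A step shorter than [rho / 32] followed by a disc of radius [rho / 32] stays within [rho / 16],
   the eighth of the radius [rho / 2] that [identity_ball] allows. *)
exists (rho / (32 * (cabs v + 1))); first by rewrite divr_gt0.
move=> x y s /andP[s0 sd] hx1 hx2 _ _; rewrite ltr_pdivlMr // in sd.
move=> hZ.
have E (x1 x2 : R) : cabs (a + rc x1 * v - (a + rc x2 * v)) = `|x1 - x2| * cabs v.
  by rewrite -cabs_rc -cabsM rcB; congr cabs; ring.
exists (rho / 32); first lra.
move=> z hz; apply: (@identity_ball f (a + rc x * v) (rho / 2) _ _ hZ); first lra.
  move=> u hu; apply: hrho; apply: le_lt_trans (cabs_tri (a + rc x * v) _ _) _.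
  have := E x x0; rewrite ler0_norm; last lra.
  move=> ->; nra.
apply: le_lt_trans (cabs_tri (a + rc (x + s) * v) _ _) _.
have := E (x + s) x; have -> : x + s - x = s by ring.
rewrite gtr0_norm //.
by move=> ->; nra.
Qed.
End Weierstrass.

(** * Convergence of row sums *)

Section RowBounds.
Variable R : realType.
Local Notation C := (Cx R).
Variable I : finType.
Implicit Types (S A : {set I}) (t : I -> C).

(** Passing to row [h] multiplies the sum of all [cabs (rows kap t M S)] by at most [(1 + K * r ^+
    h) * (1 + #|{set I}| * r ^+ h)], which is below [expR ((K + #|{set I}|) * r ^+ h)]; the
    exponents add up to a geometric series. *)
Definition rows_const (K r : R) : R := expR ((K + #|{set I}|%:R) / (1 - r)).

Variables (kap : nat -> {set I} -> C) (t : I -> C) (K r : R).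
Hypothesis K0 : 0 <= K.
Hypothesis hr : 0 <= r < 1.
Hypothesis hkap : forall h S, (0 < h)%N -> cabs (kap h S - 1) <= K * r ^+ h.
Hypothesis ht : forall a, 1 <= cabs (t a) * r.

Let r0 : 0 <= r. Proof. by case/andP: hr. Qed.
Let r1 : r < 1. Proof. by case/andP: hr. Qed.

Lemma inv_prod_le S : S != finset.set0 -> cabs (\prod_(a in S) t a)^-1 <= r.
Proof.
have ta a : cabs (t a)^-1 <= r.
  have rp : 0 < r by rewrite lt_def r0 andbT; apply/eqP => rz; have := ht a; rewrite rz mulr0; lra.
  have tp : 0 < cabs (t a).
    by rewrite lt_def cabs_ge0 andbT; apply/eqP => rz; have := ht a; rewrite rz mul0r; lra.
  by rewrite cabsV -[leLHS]mulr1 mulrC ler_pdivrMr // mulrC; exact: ht.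
case/set0Pn => a aS; rewrite (bigD1 a) //= invfM cabsM -[leRHS]mulr1.
apply: ler_pM; rewrite ?cabs_ge0 //.
rewrite cabsV cabs_prod -prodfV; apply: prodr_ile1 => b _.
by rewrite invr_ge0 cabs_ge0 -cabsV (le_trans (ta b)) // ltW.
Qed.

Lemma rows_rest M S :
  \sum_(A : {set I} | A \subset S)
     rows kap t M A * (\prod_(a in S :\: A) t a) ^- M.+1 =
  rows kap t M S + \sum_(A : {set I} | (A \subset S) && (A != S))
     rows kap t M A * (\prod_(a in S :\: A) t a) ^- M.+1.
Proof.
rewrite (bigD1 S) //=; congr (_ + _).
rewrite big1 ?expr1n ?invr1 ?mulr1 // => a; by rewrite finset.in_setD andNb.
Qed.

Lemma rest_le M S :
  cabs (\sum_(A : {set I} | (A \subset S) && (A != S))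
     rows kap t M A * (\prod_(a in S :\: A) t a) ^- M.+1) <=
  r ^+ M.+1 * \sum_A cabs (rows kap t M A).
Proof.
apply: le_trans (cabs_sum _ _ _) _; rewrite mulr_sumr [leLHS]big_mkcond.
apply: ler_sum => A _; case: ifP => [/andP[AS AnS]|_]; last first.
  by rewrite mulr_ge0 ?exprn_ge0 ?cabs_ge0.
rewrite cabsM mulrC; apply: ler_wpM2r; first exact: cabs_ge0.
rewrite -exprVn cabsX; apply: lerXn2r; rewrite ?nnegrE ?cabs_ge0 //.
apply: inv_prod_le; apply: contra AnS; rewrite finset.setD_eq0 => SA.
by rewrite finset.eqEsubset AS.
Qed.

Lemma rows_sum_le M : \sum_S cabs (rows kap t M S) <=
  expR ((K + #|{set I}|%:R) * \sum_(1 <= i < M.+1) r ^+ i).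
Proof.
elim: M => [|M IH].
  rewrite big_geq // mulr0 expR0 (bigD1 finset.set0) //= eqxx cabs1 big1 ?addr0 //.
  by move=> S /negbTE -> ; rewrite cabs0.
rewrite big_nat_recr //= mulrDr expRD; set b := \sum_S cabs (rows kap t M S) in IH *.
have b0 : 0 <= b by apply: sumr_ge0 => S _; exact: cabs_ge0.
have rM : 0 <= r ^+ M.+1 by exact: exprn_ge0.
apply: (@le_trans _ _ ((1 + K * r ^+ M.+1) * (b + #|{set I}|%:R * (r ^+ M.+1 * b)))).
  have -> : #|{set I}|%:R * (r ^+ M.+1 * b) = \sum_(S : {set I}) (r ^+ M.+1 * b).
    by rewrite sumr_const mulr_natl.
  rewrite {1}/b -big_split mulr_sumr; apply: ler_sum => S _.
  rewrite -/(rows kap t M) cabsM; apply: ler_pM; rewrite ?cabs_ge0 //.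
    rewrite -[kap _ _](subrK 1) addrC; apply: le_trans (cabsD _ _) _.
    by rewrite cabs1 lerD2l; exact: hkap.
  rewrite (rows_rest M S); apply: le_trans (cabsD _ _) _; rewrite lerD2l; exact: rest_le.
have h1 : 1 + K * r ^+ M.+1 <= expR (K * r ^+ M.+1) by exact: expR_ge1Dx.
have h2 : 1 + #|{set I}|%:R * r ^+ M.+1 <= expR (#|{set I}|%:R * r ^+ M.+1) by exact: expR_ge1Dx.
have -> : b + #|{set I}|%:R * (r ^+ M.+1 * b) = (1 + #|{set I}|%:R * r ^+ M.+1) * b by ring.
rewrite mulrA [leRHS]mulrC [(K + _) * r ^+ M.+1]mulrDl expRD; apply: ler_pM => //.
  by rewrite !mulr_ge0 // addr_ge0 // mulr_ge0.
by apply: ler_pM => //; rewrite addr_ge0 // mulr_ge0.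
Qed.

Lemma rows_le M S : cabs (rows kap t M S) <= rows_const K r.
Proof.
have h : cabs (rows kap t M S) <= \sum_S cabs (rows kap t M S).
  by rewrite (bigD1 S) //= lerDl sumr_ge0 // => ? _; exact: cabs_ge0.
apply: le_trans h (le_trans (rows_sum_le M) _); rewrite ler_expR.
apply: ler_wpM2l; first by rewrite addr_ge0.
have := geo_sum_le 1 M hr; rewrite add1n => h; apply: le_trans h _.
by rewrite expr1 ler_pdivrMr ?subr_gt0 // mulVf ?ltW // subr_eq0 gt_eqF.
Qed.

(** The term [A = S] reproduces the previous value up to a factor [kap] within [K * r ^+ M.+1] of 1,
    and every other term carries an inverse product of modulus at most [r ^+ M.+1]. *)
Lemma rows_step M S : cabs (rows kap t M.+1 S - rows kap t M S) <=
  (1 + 2 * K) * rows_const K r * r ^+ M.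
Proof.
have rM : 0 <= r ^+ M.+1 by exact: exprn_ge0.
have rMM : r ^+ M.+1 <= r ^+ M by rewrite exprS ler_piMl ?exprn_ge0 // ltW.
have rM1 : r ^+ M.+1 <= 1 by rewrite exprn_ile1 // ltW.
have -> : rows kap t M.+1 S = kap M.+1 S * \sum_(A : {set I} | A \subset S)
     rows kap t M A * (\prod_(a in S :\: A) t a) ^- M.+1 by [].
rewrite rows_rest; set y := \sum_(A | _) _; set x := rows kap t M S.
have hk := hkap S (ltn0Sn M).
have hy : cabs y <= r ^+ M.+1 * rows_const K r.
  apply: le_trans (rest_le M S) _; apply: ler_wpM2l => //.
  apply: le_trans (rows_sum_le M) _; rewrite ler_expR.
  apply: ler_wpM2l; first by rewrite addr_ge0.
  have := geo_sum_le 1 M hr; rewrite add1n => h; apply: le_trans h _.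
  by rewrite expr1 ler_pdivrMr ?subr_gt0 // mulVf ?ltW // subr_eq0 gt_eqF.
have hx : cabs x <= rows_const K r := rows_le M S.
have B0 : 0 <= rows_const K r by exact: expR_ge0.
have -> : kap M.+1 S * (x + y) - x = (kap M.+1 S - 1) * (x + y) + y by ring.
apply: le_trans (cabsD _ _) _; rewrite cabsM.
have h1 : cabs (x + y) <= 2 * rows_const K r.
  by apply: le_trans (cabsD _ _) _; nra.
have h2 : cabs (kap M.+1 S - 1) * cabs (x + y) <= K * r ^+ M.+1 * (2 * rows_const K r).
  by apply: ler_pM; rewrite ?cabs_ge0.
set B := rows_const K r in hy h2 B0 *.
have h3 : r ^+ M.+1 * B <= r ^+ M * B by apply: ler_wpM2r.
have h4 : (K * B) * r ^+ M.+1 <= (K * B) * r ^+ M.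
  by apply: ler_wpM2l => //; exact: mulr_ge0.
nra.
Qed.

End RowBounds.

(** * Functions of several variables *)

Section SeveralVariables.
Variable R : realType.
Local Notation C := (Cx R).
Implicit Types (u v p : nat -> C) (f g : (nat -> C) -> C) (n : nat).

Definition pd n p (d : R) u := forall i, (i < n)%N -> cabs (u i - p i) < d.
Definition nearpt n p (P : (nat -> C) -> Prop) :=
  exists2 d : R, 0 < d & forall u, pd n p d u -> P u.

Lemma pd_polydisc n p (d : R) u : polydisc n p (rc d) u <-> pd n p d u.
Proof.
by split=> h i /h; rewrite norm_lt.
Qed.

Lemma pd_le n p (d d' : R) u : d <= d' -> pd n p d u -> pd n p d' u.
Proof. by move=> dd h i /h /lt_le_trans; apply. Qed.
Lemma pd_min n p (d d' : R) u : pd n p (Num.min d d') u -> pd n p d u /\ pd n p d' u.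
Proof. by move=> h; split; apply: pd_le h; rewrite ge_min lexx ?orbT. Qed.
Lemma pd_refl n p (d : R) : 0 < d -> pd n p d p.
Proof. by move=> d0 i _; rewrite subrr cabs0. Qed.

Lemma nearpt_mono n p (P Q : (nat -> C) -> Prop) :
  (forall u, P u -> Q u) -> nearpt n p P -> nearpt n p Q.
Proof. by move=> h [d d0 hd]; exists d => // u /hd /h. Qed.
Lemma nearptI n p (P Q : (nat -> C) -> Prop) :
  nearpt n p P -> nearpt n p Q -> nearpt n p (fun u => P u /\ Q u).
Proof.
move=> [d d0 hd] [e e0 he]; exists (Num.min d e); first by rewrite lt_min d0.
by move=> u /pd_min [/hd h /he h'].
Qed.
Lemma nearptT n p (P : (nat -> C) -> Prop) : (forall u, P u) -> nearpt n p P.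
Proof. by move=> h; exists 1. Qed.
Lemma nearpt_all n p (J : finType) (P : J -> (nat -> C) -> Prop) :
  (forall j, nearpt n p (P j)) -> nearpt n p (fun u => forall j, P j u).
Proof.
move=> h; suff H (s : seq J) : nearpt n p (fun u => forall j, j \in s -> P j u).
  by case: (H (enum J)) => d d0 hd; exists d => // u /hd hu j; apply: hu; rewrite mem_enum.
elim: s => [|j s IH]; first exact: nearptT.
apply: nearpt_mono (nearptI (h j) IH) => u [h1 h2] k.
by rewrite in_cons => /orP[/eqP ->|/h2].
Qed.
Lemma nearpt_nat n p (P : nat -> (nat -> C) -> Prop) N :
  (forall j, (j < N)%N -> nearpt n p (P j)) ->
  nearpt n p (fun u => forall j, (j < N)%N -> P j u).
Proof.
elim: N => [|N IH] h; first exact: nearptT.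
apply: nearpt_mono (nearptI (h N (ltnSn N)) (IH (fun j jN => h j (ltnW jN)))).
by move=> u [h1 h2] j; rewrite ltnS leq_eqVlt => /orP[/eqP ->|/h2].
Qed.
Lemma nearpt_at n p (P : (nat -> C) -> Prop) : nearpt n p P -> P p.
Proof. by move=> [d d0]; apply; exact: pd_refl. Qed.
Lemma pd_open n p (d : R) u : pd n p d u -> nearpt n u (pd n p d).
Proof.
move=> h.
have : nearpt n u (fun v => forall j, (j < n)%N -> cabs (v j - p j) < d).
  apply: nearpt_nat => j jn; exists (d - cabs (u j - p j)); first by rewrite subr_gt0 h.
  by move=> v /(_ j jn) hv; apply: le_lt_trans (cabs_tri (u j) _ _) _; lra.
by case=> e e0 he; exists e => // v hv i; exact: he.
Qed.

Lemma upd_id u i : upd u i (u i) = u.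
Proof. by apply/funext => j; rewrite /upd; case: eqP => // ->. Qed.
Lemma upd_at u i z : upd u i z i = z.
Proof. by rewrite /upd eqxx. Qed.
Lemma upd_ne u i j z : j != i -> upd u i z j = u j.
Proof. by rewrite /upd => /negbTE ->. Qed.
Lemma upd_upd u i z w : upd (upd u i z) i w = upd u i w.
Proof. by apply/funext => j; rewrite /upd; case: eqP. Qed.
Lemma pd_upd n u i z (d : R) : 0 < d -> cabs (z - u i) < d -> pd n u d (upd u i z).
Proof.
by move=> d0 hz j _; rewrite /upd; case: eqP => [->//|_]; rewrite subrr cabs0.
Qed.

Definition ccont n f u := forall e : R, 0 < e ->
  nearpt n u (fun v => cabs (f v - f u) < e).
Definition holC n W f := forall u, W u -> ccont n f u /\
  forall i, (i < n)%N -> cdiff (fun z => f (upd u i z)) (u i).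

Lemma holomorphic_onP n W f : holomorphic_on n W f <-> holC n W f.
Proof.
split=> [[h1 h2] u Wu|h].
  split=> [e e0|i /(h2 u Wu) /cdiffP //].
  have := h1 u Wu (rc e); rewrite rc_lt => /(_ e0) [d [/pos_rc [b b0 ->] hb]].
  by exists b => // v /pd_polydisc /hb; rewrite norm_lt.
split=> u Wu.
  move=> e /pos_rc [b b0 ->]; have [d d0 hd] := (h u Wu).1 b b0.
  exists (rc d); split; first by rewrite rc_lt.
  by move=> v /pd_polydisc /hd; rewrite norm_lt.
by move=> i /((h u Wu).2 i) /cdiffP.
Qed.

Lemma ccont_cst n c u : ccont n (fun=> c) u.
Proof. by move=> e e0; apply: nearptT => v; rewrite subrr cabs0. Qed.
Lemma ccont_coord n i u : (i < n)%N -> ccont n (fun v => v i) u.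
Proof. by move=> iN e e0; exists e => // v; exact. Qed.
Lemma ccontD n f g u : ccont n f u -> ccont n g u -> ccont n (fun v => f v + g v) u.
Proof.
move=> hf hg e e0; have e2 : 0 < e / 2 by lra.
apply: nearpt_mono (nearptI (hf _ e2) (hg _ e2)) => v [h1 h2].
rewrite opprD addrACA (le_lt_trans (cabsD _ _))//; lra.
Qed.
Lemma ccontM n f g u : ccont n f u -> ccont n g u -> ccont n (fun v => f v * g v) u.
Proof.
move=> hf hg e e0; pose K := 1 + cabs (f u) + cabs (g u).
have K1 := cabs_ge0 (f u); have K2 := cabs_ge0 (g u).
have K0 : 0 < K by rewrite /K; lra.
pose d := Num.min 1 (e / K).
have d0 : 0 < d by rewrite lt_min ltr01 divr_gt0.
apply: nearpt_mono (nearptI (hf _ d0) (hg _ d0)) => v [h1 h2].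
have -> : f v * g v - f u * g u =
  (f v - f u) * (g v - g u) + f u * (g v - g u) + (f v - f u) * g u by ring.
have dK : d * K <= e by rewrite -ler_pdivlMr // ge_min lexx orbT.
have d1 : d <= 1 by rewrite ge_min lexx.
apply: le_lt_trans (cabsD _ _) _.
apply: (@le_lt_trans _ _ (cabs ((f v - f u) * (g v - g u)) + cabs (f u * (g v - g u))
  + cabs ((f v - f u) * g u))); first by rewrite lerD2r cabsD.
rewrite !cabsM; have := cabs_ge0 (f v - f u); have := cabs_ge0 (g v - g u).
rewrite /K in dK; nra.
Qed.
Lemma ccontV n f u : f u != 0 -> ccont n f u -> ccont n (fun v => (f v)^-1) u.
Proof.
rewrite -cabs_gt0 => f0 hf e e0; set a := cabs (f u) in f0.
pose d := Num.min (a / 2) (e * a ^+ 2 / 2).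
have d0 : 0 < d by rewrite lt_min !divr_gt0 // mulr_gt0 // exprn_gt0.
apply: nearpt_mono (hf _ d0) => v hv.
have dl : d <= a / 2 by rewrite ge_min lexx.
have dr : d <= e * a ^+ 2 / 2 by rewrite ge_min lexx orbT.
have fv : a / 2 < cabs (f v).
  have := cabsB_ge (f u) (f u - f v); have -> : f u - (f u - f v) = f v by ring.
  by rewrite -/a [cabs (f u - f v)]cabsC; lra.
have fv0 : f v != 0 by rewrite -cabs_gt0; lra.
have fu0 : f u != 0 by rewrite -cabs_gt0.
have -> : (f v)^-1 - (f u)^-1 = (f u - f v) / (f u * f v) by field; rewrite fv0 fu0.
rewrite cabsM cabsV cabsM -/a cabsC ltr_pdivrMr; last by rewrite mulr_gt0 //; lra.
apply: lt_le_trans hv (le_trans dr _).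
rewrite expr2; have : e * a * (a / 2) <= e * a * cabs (f v).
  by rewrite ler_pM2l ?mulr_gt0 // ltW.
lra.
Qed.

Lemma holC_sub n (W W' : (nat -> C) -> Prop) f :
  (forall u, W' u -> W u) -> holC n W f -> holC n W' f.
Proof. by move=> h hf u /h /hf. Qed.
Lemma holC_cst n W c : holC n W (fun=> c).
Proof. by move=> u _; split=> [|i _]; [exact: ccont_cst | exact: cdiff_cst]. Qed.
Lemma holC_coord n W j : (j < n)%N -> holC n W (fun u => u j).
Proof.
move=> jn u _; split=> [|i _]; first exact: ccont_coord.
have [->|ji] := eqVneq j i.
  by apply: (@cdiff_near R id); [exact: cdiff_id | exists 1 => // w _; rewrite upd_at].
by apply: (@cdiff_near R (fun=> u j)); [exact: cdiff_cst | exists 1 => // w _; rewrite upd_ne].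
Qed.
Lemma holCD n W f g : holC n W f -> holC n W g -> holC n W (fun u => f u + g u).
Proof.
move=> hf hg u Wu; have [f1 f2] := hf u Wu; have [g1 g2] := hg u Wu.
by split=> [|i iN]; [exact: ccontD | apply: cdiffD; [exact: f2 | exact: g2]].
Qed.
Lemma holCM n W f g : holC n W f -> holC n W g -> holC n W (fun u => f u * g u).
Proof.
move=> hf hg u Wu; have [f1 f2] := hf u Wu; have [g1 g2] := hg u Wu.
by split=> [|i iN]; [exact: ccontM | apply: cdiffM; [exact: f2 | exact: g2]].
Qed.
Lemma holCV n W f : (forall u, W u -> f u != 0) -> holC n W f ->
  holC n W (fun u => (f u)^-1).
Proof.
move=> f0 hf u Wu; have [f1 f2] := hf u Wu.
split=> [|i iN]; first by apply: ccontV => //; exact: f0.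
by apply: cdiffV; [rewrite upd_id; exact: f0 | exact: f2].
Qed.
Lemma holC_limit n W (f : nat -> (nat -> C) -> C) g (A r : R) : 0 <= r < 1 ->
  (forall u, W u -> nearpt n u W) ->
  (forall j, holC n W (f j)) ->
  (forall j u, W u -> cabs (f j u - g u) <= A * r ^+ j) -> holC n W g.
Proof.
move=> hr oW hf hg u Wu; split=> [e e0|i iN].
  have e4 : 0 < e / 4 by lra.
  have [N hN] := geo_small A hr e4.
  have := ((hf N u Wu).1 _ e4) => hc.
  apply: nearpt_mono (nearptI (oW u Wu) hc) => v [Wv hv].
  have h1 := hg N v Wv; have h2 := hg N u Wu; have h3 := hN N (leqnn N).
  rewrite cabsC in h1.
  apply: le_lt_trans (cabs_tri (f N v) _ _) _.
  have := cabs_tri (f N u) (f N v) (g u); lra.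
have [d d0 hd] := oW u Wu; have d2 : 0 < d / 2 by lra.
have Wd z : cabs (z - u i) <= d / 2 -> W (upd u i z).
  by move=> hz; apply: hd; apply: pd_upd => //; lra.
apply: (@weierstrass R (fun j z => f j (upd u i z)) _ _ (d / 2) A r) => // j z /Wd Wz.
  have := (hf j _ Wz).2 i iN; rewrite upd_at => /cdiff_near; apply.
  by exists 1 => // w _; rewrite upd_upd.
exact: hg.
Qed.

End SeveralVariables.

(* The functions [f] for which [f - f \o st] is a holomorphic multiple of [ep]; with
   [st = id] and [ep = 0] these are just the holomorphic functions. *)
Section DividedDifferences.
Variable R : realType.
Local Notation C := (Cx R).
Variables (n : nat) (W : (nat -> C) -> Prop) (st : (nat -> C) -> (nat -> C)).
Variable ep : (nat -> C) -> C.
Hypothesis hep : holC n W ep.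
Implicit Types f g : (nat -> C) -> C.

Definition divdiff f := holC n W f /\ exists2 H, holC n W H &
  forall u, W u -> f u - f (st u) = ep u * H u.

Lemma dd_cst c : divdiff (fun=> c).
Proof.
split; first exact: holC_cst.
by exists (fun=> 0); [exact: holC_cst | move=> u _; rewrite subrr mulr0].
Qed.
Lemma ddD f g : divdiff f -> divdiff g -> divdiff (fun u => f u + g u).
Proof.
move=> [hf [F hF eF]] [hg [G hG eG]]; split; first exact: holCD.
exists (fun u => F u + G u) => [|u Wu]; first exact: holCD.
by rewrite mulrDr -eF // -eG //; ring.
Qed.
(** The composite of [g] with [st] is written [g - ep * G], which is holomorphic without any
    regularity of [st]. *)
Lemma ddM f g : divdiff f -> divdiff g -> divdiff (fun u => f u * g u).
Proof.
move=> [hf [F hF eF]] [hg [G hG eG]]; split; first exact: holCM.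
exists (fun u => f u * G u + (g u + (-1) * (ep u * G u)) * F u).
  apply: holCD; first exact: holCM.
  apply: holCM => //; apply: holCD => //; apply: holCM; first exact: holC_cst.
  exact: holCM.
move=> u Wu; have -> : g u + -1 * (ep u * G u) = g (st u) by rewrite -eG //; ring.
have -> : ep u * (f u * G u + g (st u) * F u) =
   f u * (ep u * G u) + g (st u) * (ep u * F u) by ring.
by rewrite -eG // -eF //; ring.
Qed.
Lemma ddV f : (forall u, W u -> f u != 0) -> (forall u, W u -> f (st u) != 0) ->
  divdiff f -> divdiff (fun u => (f u)^-1).
Proof.
move=> f0 fs0 [hf [F hF eF]]; split; first exact: holCV.
exists (fun u => (-1) * F u * (f u * (f u + (-1) * (ep u * F u)))^-1).
  apply: holCM; first by apply: holCM => //; exact: holC_cst.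
  apply: holCV => [u Wu|].
    have -> : f u + -1 * (ep u * F u) = f (st u) by rewrite -eF //; ring.
    by apply: mulf_neq0; [exact: f0 | exact: fs0].
  apply: holCM => //; apply: holCD => //; apply: holCM; first exact: holC_cst.
  exact: holCM.
move=> u Wu; have -> : f u + -1 * (ep u * F u) = f (st u) by rewrite -eF //; ring.
have -> : ep u * (-1 * F u / (f u * f (st u))) = - (ep u * F u) / (f u * f (st u)) by ring.
by rewrite -eF //; field; apply/andP; split; first [exact: f0 | exact: fs0].
Qed.
Lemma ddX f k : divdiff f -> divdiff (fun u => f u ^+ k).
Proof.
move=> hf; elim: k => [|k IH]; first exact: dd_cst.
under [X in divdiff X]eq_fun do rewrite exprS; exact: ddM.
Qed.
Lemma dd_sum (I : Type) (s : seq I) (P : pred I) (F : I -> (nat -> C) -> C) :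
  (forall i, P i -> divdiff (F i)) -> divdiff (fun u => \sum_(i <- s | P i) F i u).
Proof.
move=> h; elim: s => [|a s IH].
  under [X in divdiff X]eq_fun do rewrite big_nil; exact: dd_cst.
under [X in divdiff X]eq_fun do rewrite big_cons.
by case Pa: (P a) => //; apply: ddD => //; exact: h.
Qed.
Lemma dd_prod (I : Type) (s : seq I) (P : pred I) (F : I -> (nat -> C) -> C) :
  (forall i, P i -> divdiff (F i)) -> divdiff (fun u => \prod_(i <- s | P i) F i u).
Proof.
move=> h; elim: s => [|a s IH].
  under [X in divdiff X]eq_fun do rewrite big_nil; exact: dd_cst.
under [X in divdiff X]eq_fun do rewrite big_cons.
by case Pa: (P a) => //; apply: ddM => //; exact: h.
Qed.

Lemma dd_Phi (I : finType) (q : C) (x : (nat -> C) -> C) (t : I -> (nat -> C) -> C)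
    M (S : {set I}) :
  divdiff x -> (forall a, divdiff (t a)) ->
  (forall a u, W u -> t a u != 0 /\ t a (st u) != 0) ->
  (forall h (A : {set I}) u, (0 < h <= M)%N -> A \subset S -> W u ->
     1 - q ^+ h * x u * \prod_(a in A) t a u != 0 /\
     1 - q ^+ h * x (st u) * \prod_(a in A) t a (st u) != 0) ->
  divdiff (fun u => Phi q (x u) (fun a => t a u) M S).
Proof.
move=> hx ht ht0; elim: M S => [|M IH] S hne.
  under [X in divdiff X]eq_fun do rewrite Phi0; exact: dd_cst.
under [X in divdiff X]eq_fun do rewrite PhiS.
apply: ddM.
  have hS u (Wu : W u) := hne M.+1 S u (leqnn M.+1) (fintype.subxx S) Wu.
  apply: ddV => [u /hS []|u /hS []|] //.
  under [X in divdiff X]eq_fun do rewrite -mulN1r.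
  apply: ddD; first exact: dd_cst.
  apply: ddM; first exact: dd_cst.
  by apply: ddM; [apply: ddM => //; exact: dd_cst | apply: dd_prod].
apply: dd_sum => A AS; apply: ddM.
  apply: IH => h B u hM BA Wu; apply: hne => //; last exact: fintype.subset_trans BA AS.
  by case/andP: hM => -> /leqW.
apply: ddV.
- by move=> u Wu; rewrite expf_neq0 //; apply/prodf_neq0 => a _; case: (ht0 a u Wu).
- by move=> u Wu; rewrite expf_neq0 //; apply/prodf_neq0 => a _; case: (ht0 a u Wu).
- by apply: ddX; apply: dd_prod.
Qed.

End DividedDifferences.

(** * Uniform geometric convergence near points off the divisors *)

Section RegularPoints.
Variable R : realType.
Local Notation C := (Cx R).
Implicit Types (u p : nat -> C) (q : C).

Lemma rows_ext (I : finType) (kap kap' : nat -> {set I} -> C) (t : I -> C) M (S : {set I}) :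
  (forall h (A : {set I}), A \subset S -> kap h A = kap' h A) -> rows kap t M S = rows kap' t M S.
Proof.
elim: M S => [//|M IH] S h /=; rewrite h ?fintype.subxx //; congr (_ * _).
apply: eq_bigr => A AS; rewrite IH // => k B BA; apply: h.
exact: fintype.subset_trans BA AS.
Qed.

Definition PhiL (I : finType) q x (t : I -> C) (S : {set I}) : C :=
  climit (fun M => Phi q x t M S).

Definition Phi_const (I : finType) (K r : R) := (1 + 2 * K) * rows_const I K r.

Lemma Phi_geo (I : finType) q x (t : I -> C) (S : {set I}) (K c r : R) :
  cabs q <= r -> r < 1 -> 0 < c -> 0 <= K -> (forall a, 1 <= cabs (t a) * r) ->
  (forall A : {set I}, A \subset S -> cabs (x * \prod_(a in A) t a) <= K) ->
  (forall h (A : {set I}), (0 < h)%N -> A \subset S ->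
     c <= cabs (1 - q ^+ h * x * \prod_(a in A) t a)) ->
  forall M, cabs (Phi q x t M.+1 S - Phi q x t M S) <= Phi_const I (K / c) r * r ^+ M.
Proof.
move=> qr r1 c0 K0 ht hK hc M.
(* The hypotheses concern subsets of [S] only; elsewhere the factor is replaced by 1, which does not
   change the recursion for [S]. *)
pose kap h (A : {set I}) : C :=
  if (A \subset S) then (1 - q ^+ h * x * \prod_(a in A) t a)^-1 else 1.
have E N : Phi q x t N S = rows kap t N S.
  by apply: rows_ext => h A AS; rewrite /kap AS.
have r0 : 0 <= r by apply: le_trans qr; exact: cabs_ge0.
rewrite !E; apply: rows_step => //; rewrite ?divr_ge0 ?r0 // ?ltW //.
move=> h A h0; rewrite /kap; case: ifP => AS; last first.
  by rewrite subrr cabs0 mulr_ge0 ?exprn_ge0 ?divr_ge0 // ltW.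
set X := q ^+ h * x * _; have hX : c <= cabs (1 - X) := hc h A h0 AS.
have X1 : 1 - X != 0 by rewrite -cabs_gt0 (lt_le_trans c0).
have -> : (1 - X)^-1 - 1 = X / (1 - X) by field.
have hXr : cabs X <= r ^+ h * K.
  rewrite /X -mulrA cabsM cabsX; apply: ler_pM; rewrite ?exprn_ge0 ?cabs_ge0 ?hK //.
  by apply: lerXn2r; rewrite ?nnegrE ?cabs_ge0.
rewrite cabsM cabsV mulrAC [K * _]mulrC; apply: ler_pM; rewrite ?cabs_ge0 ?invr_ge0 ?cabs_ge0 //.
by rewrite lef_pV2 ?posrE // (lt_le_trans c0).
Qed.

(** For large [h] the product [q ^+ h * X u] has modulus at most 1/2, whatever the nearby [u]; the
    finitely many remaining [h] are handled by continuity. *)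
Lemma near_factor n p q (X : (nat -> C) -> C) : cabs q < 1 -> ccont n X p ->
  (forall h, (0 < h)%N -> q ^+ h * X p != 1) ->
  exists c K : R, [/\ 0 < c, 0 <= K & nearpt n p (fun u => cabs (X u) <= K /\
     forall h, (0 < h)%N -> c <= cabs (1 - q ^+ h * X u))].
Proof.
move=> q1 cX hX; have qr : 0 <= cabs q < 1 by rewrite cabs_ge0.
pose K := cabs (X p) + 1; have K0 : 0 <= K by rewrite addr_ge0 ?cabs_ge0.
have [N hN] := geo_small K qr (ltac:(lra) : 0 < (2^-1 : R)).
have nearK : nearpt n p (fun u => cabs (X u) <= K).
  apply: nearpt_mono (cX 1 ltr01) => u hu.
  have := cabsB_ge (X u) (X p); rewrite /K; lra.
suff [c [c0 hc]] : exists c : R, 0 < c /\ nearpt n p (fun u =>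
    forall h, (h < N)%N -> (0 < h)%N -> c <= cabs (1 - q ^+ h * X u)).
  exists (Num.min c 2^-1), K; split=> //; first by rewrite lt_min c0; lra.
  apply: nearpt_mono (nearptI hc nearK) => u [h1 h2]; split=> // h h0.
  have [hN'|/hN hh] := ltnP h N.
    by apply: le_trans (h1 h hN' h0); rewrite ge_min lexx.
  apply: (@le_trans _ _ 2^-1); first by rewrite ge_min lexx orbT.
  have := cabsB_ge 1 (q ^+ h * X u); rewrite cabs1 cabsM cabsX.
  have : cabs q ^+ h * cabs (X u) <= K * cabs q ^+ h.
    by rewrite mulrC ler_wpM2r // exprn_ge0 // cabs_ge0.
  lra.
elim: N {hN} => [|N [c [c0 IH]]]; first by exists 1; split=> //; exact: nearptT.
have [->|N0] := posnP N; first by exists 1; split=> //; apply: nearptT => u [].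
pose a := cabs (1 - q ^+ N * X p).
have a0 : 0 < a by rewrite cabs_gt0 subr_eq0 eq_sym hX.
exists (Num.min c (a / 2)); split; first by rewrite lt_min c0; lra.
have e0 : 0 < a / 2 / (cabs q ^+ N + 1).
  by rewrite !divr_gt0 // ltr_wpDl // exprn_ge0 // cabs_ge0.
apply: nearpt_mono (nearptI IH (cX _ e0)) => u [h1 h2] h.
rewrite ltnS leq_eqVlt => /orP[/eqP -> _|hh /(h1 h hh)]; last first.
  by apply: le_trans; rewrite ge_min lexx.
apply: (@le_trans _ _ (a / 2)); first by rewrite ge_min lexx orbT.
have qN : 0 <= cabs q ^+ N by rewrite exprn_ge0 // cabs_ge0.
rewrite ltr_pdivlMr in h2; last lra.
have h3 : cabs (q ^+ N * (X u - X p)) <= a / 2.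
  rewrite cabsM cabsX; have := cabs_ge0 (X u - X p); nra.
have := cabsB_ge (1 - q ^+ N * X p) (q ^+ N * (X u - X p)).
have -> : 1 - q ^+ N * X p - q ^+ N * (X u - X p) = 1 - q ^+ N * X u by ring.
by rewrite -/a; lra.
Qed.

Lemma near_factors n p q (J : finType) (P : pred J) (X : J -> (nat -> C) -> C) :
  cabs q < 1 -> (forall j, ccont n (X j) p) ->
  (forall j h, P j -> (0 < h)%N -> q ^+ h * X j p != 1) ->
  exists c K : R, [/\ 0 < c, 0 <= K & nearpt n p (fun u => forall j, P j ->
     cabs (X j u) <= K /\ forall h, (0 < h)%N -> c <= cabs (1 - q ^+ h * X j u))].
Proof.
move=> q1 cX hX.
suff H (s : seq J) : exists c K : R, [/\ 0 < c, 0 <= K & nearpt n p (fun u =>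
     forall j, j \in s -> P j -> cabs (X j u) <= K /\
       forall h, (0 < h)%N -> c <= cabs (1 - q ^+ h * X j u))].
  have [c [K [c0 K0 h]]] := H (enum J); exists c, K; split=> //.
  by apply: nearpt_mono h => u h j; apply: h; rewrite mem_enum.
elim: s => [|j s [c [K [c0 K0 IH]]]].
  by exists 1, 1; split=> //; exact: nearptT.
have [Pj|nPj] := boolP (P j); last first.
  exists c, K; split=> //; apply: nearpt_mono IH => u h k.
  by rewrite in_cons => /orP[/eqP -> /(negP nPj)|/h].
have [c' [K' [c'0 K'0 h']]] := near_factor q1 (cX j) (fun h => hX j h Pj).
exists (Num.min c c'), (Num.max K K'); split; first by rewrite lt_min c0.
  by rewrite le_max K0.
apply: nearpt_mono (nearptI IH h') => u [h1 [h2 h3]] k.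
rewrite in_cons => /orP[/eqP -> _|ks Pk].
  split=> [|h h0]; first by rewrite le_max h2 orbT.
  by rewrite ge_min h3 ?orbT.
have [g1 g2] := h1 k ks Pk; split=> [|h h0]; first by rewrite le_max g1.
by rewrite ge_min g2.
Qed.

Lemma near_outside n p (b : R) (J : finType) (t : J -> (nat -> C) -> C) :
  0 <= b < 1 -> (forall j, ccont n (t j) p) -> (forall j, 1 < cabs (t j p)) ->
  exists2 r : R, b <= r < 1 & nearpt n p (fun u => forall j, 1 <= cabs (t j u) * r).
Proof.
move=> hb ct ht.
suff H (s : seq J) : exists2 r : R, b <= r < 1 & nearpt n p (fun u =>
     forall j, j \in s -> 1 <= cabs (t j u) * r).
  have [r hr h] := H (enum J); exists r => //.
  by apply: nearpt_mono h => u h j; apply: h; rewrite mem_enum.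
elim: s => [|j s [r hr IH]]; first by exists b; [lra | exact: nearptT].
(* Near [p] the modulus of [t j u] exceeds the midpoint [(1 + cabs (t j p)) / 2], whose inverse is
   [r']. *)
have tj := ht j; pose r' := 2 / (1 + cabs (t j p)).
have r'1 : r' < 1 by rewrite /r' ltr_pdivrMr; lra.
have r'0 : 0 < r' by rewrite divr_gt0 //; lra.
exists (Num.max r r'); first by rewrite le_max gt_max; lra.
have e0 : 0 < (cabs (t j p) - 1) / 2 by lra.
apply: nearpt_mono (nearptI IH (ct j _ e0)) => u [h1 h2] k.
rewrite in_cons => /orP[/eqP ->|/h1 h]; last first.
  by apply: le_trans h _; apply: ler_wpM2l; rewrite ?cabs_ge0 // le_max lexx.
apply: (@le_trans _ _ (cabs (t j u) * r')).
  rewrite /r' mulrA ler_pdivlMr; last lra.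
  by have := cabsB_ge (t j p) (t j u); rewrite cabsC; lra.
by apply: ler_wpM2l; rewrite ?cabs_ge0 // le_max lexx orbT.
Qed.

Lemma ccontX n (f : (nat -> C) -> C) p k : ccont n f p -> ccont n (fun u => f u ^+ k) p.
Proof.
move=> hf; elim: k => [|k IH]; first exact: ccont_cst.
under [X in ccont _ X]eq_fun do rewrite exprS; exact: ccontM.
Qed.
Lemma ccont_prod n (J : Type) (s : seq J) (P : pred J) (F : J -> (nat -> C) -> C) p :
  (forall j, ccont n (F j) p) -> ccont n (fun u => \prod_(j <- s | P j) F j u) p.
Proof.
move=> h; elim: s => [|a s IH].
  under [X in ccont _ X]eq_fun do rewrite big_nil; exact: ccont_cst.
under [X in ccont _ X]eq_fun do rewrite big_cons.
by case Pa: (P a) => //; apply: ccontM.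
Qed.

(** One [r] bounds both [cabs q] and the inverses of the [t_a], and one pair [c], [K] serves all
    subsets; hence [Phi_geo] holds with the same constants at all nearby points. *)
Lemma regular_near n p q (I : finType) (x : (nat -> C) -> C) (t : I -> (nat -> C) -> C)
    (S : {set I}) :
  cabs q < 1 -> ccont n x p -> (forall a, ccont n (t a) p) ->
  (forall a, 1 < cabs (t a p)) ->
  (forall h (A : {set I}), (0 < h)%N -> A \subset S ->
     q ^+ h * x p * \prod_(a in A) t a p != 1) ->
  exists B r : R, 0 <= r < 1 /\ nearpt n p (fun u =>
    (forall M, cabs (Phi q (x u) (t^~ u) M.+1 S - Phi q (x u) (t^~ u) M S) <= B * r ^+ M) /\
    (forall h (A : {set I}), (0 < h)%N -> A \subset S ->
       1 - q ^+ h * x u * \prod_(a in A) t a u != 0)).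
Proof.
move=> q1 cx ct ht hne.
have qb : 0 <= cabs q < 1 by rewrite cabs_ge0.
have [r /andP[qr r1] hr] := near_outside qb ct ht.
pose X (A : {set I}) u := x u * \prod_(a in A) t a u.
have cX A : ccont n (X A) p by apply: ccontM => //; exact: ccont_prod.
have [|c [K [c0 K0 h]]] := @near_factors n p q _ (fun A : {set I} => A \subset S) X q1 cX.
  by move=> A h AS h0; rewrite /X mulrA; exact: hne.
exists (Phi_const I (K / c) r), r; split; first by have := cabs_ge0 q; lra.
apply: nearpt_mono (nearptI hr h) => u [h1 h2]; split.
  apply: Phi_geo => // [A AS|k A k0 AS]; first by have [] := h2 A AS.
  by have [_ /(_ k k0)] := h2 A AS; rewrite /X mulrA.
move=> k A k0 AS; have [_ /(_ k k0)] := h2 A AS; rewrite /X mulrA => h3.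
by rewrite -cabs_gt0 (lt_le_trans c0).
Qed.

Lemma PhiL_cvg (I : finType) q x (t : I -> C) (S : {set I}) (B r : R) : 0 <= r < 1 ->
  (forall M, cabs (Phi q x t M.+1 S - Phi q x t M S) <= B * r ^+ M) ->
  ccvg (fun M => Phi q x t M S) (PhiL q x t S).
Proof. by move=> hr h; exact: (@climitP R (fun M => Phi q x t M S) B r hr h). Qed.

End RegularPoints.

(** * The partition series *)

Section Tannery.
Variable R : realType.
Local Notation C := (Cx R).

Lemma big_uniq_sub (V : nmodType) (T : eqType) (s s' : seq T) (F : T -> V) :
  uniq s -> uniq s' -> {subset s <= s'} ->
  \sum_(l <- s') F l = \sum_(l <- s) F l + \sum_(l <- s' | l \notin s) F l.
Proof.
move=> us us' ss; rewrite (bigID (fun l => l \in s)) /=; congr (_ + _).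
rewrite -big_filter; apply: perm_big; apply: uniq_perm => //; first exact: filter_uniq.
by move=> l; rewrite mem_filter; apply/andP/idP => [[]//|ls]; split=> //; exact: ss.
Qed.

(** Exchanges two ways of exhausting a set: [P K], with the limit weights, against [B M L] with [L]
    and then [M] tending to infinity. Domination is by weights [W] that grow with [M] but have
    uniformly bounded sums over the boxes. *)
Lemma tannery (T : eqType) (P : nat -> seq T) (B : nat -> nat -> seq T)
    (w : nat -> T -> C) (winf : T -> C) (W : nat -> T -> R) (phi : nat -> C)
    (phil : C) (C0 : R) :
  (forall K, uniq (P K)) -> (forall M L, uniq (B M L)) ->
  (forall K K', (K <= K')%N -> {subset P K <= P K'}) ->
  (forall K M L, (K <= M)%N -> (K <= L)%N -> {subset P K <= B M L}) ->
  (forall M L, exists K, {subset B M L <= P K}) ->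
  (forall M l, cabs (w M l) <= W M l) -> (forall M l, W M l <= W M.+1 l) ->
  (forall l, ccvg (fun M => w M l) (winf l)) ->
  (forall M L, \sum_(l <- B M L) W M l <= C0) ->
  (forall M, ccvg (fun L => \sum_(l <- B M L) w M l) (phi M)) -> ccvg phi phil ->
  ccvg (fun K => \sum_(l <- P K) winf l) phil.
Proof.
move=> uP uB Pm PB BP wW Wm hw hC hphi hphil.
have W0 M l : 0 <= W M l by apply: le_trans (wW M l); exact: cabs_ge0.
have WM M M' l : (M <= M')%N -> W M l <= W M' l.
  move=> /subnKC <-; elim: (M' - M)%N => [|k IH]; rewrite ?addn0 // addnS.
  exact: le_trans IH (Wm _ _).
pose a (k : nat * nat) := \sum_(l <- P k.1) W k.2 l.
have sub_le s s' M : uniq s -> uniq s' -> {subset s <= s'} ->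
    \sum_(l <- s) W M l <= \sum_(l <- s') W M l.
  by move=> h1 h2 h3; rewrite (big_uniq_sub _ h1 h2 h3) lerDl sumr_ge0.
have am K K' M M' : (K <= K')%N -> (M <= M')%N -> a (K, M) <= a (K', M').
  move=> hK hM; apply: (@le_trans _ _ (a (K, M'))).
    by apply: ler_sum => l _; exact: WM.
  by apply: sub_le => //; exact: Pm.
have aC k : a k <= C0.
  case: k => K M; apply: le_trans (am K K M (maxn M K) (leqnn _) (leq_maxl _ _)) _.
  apply: le_trans (hC (maxn M K) K); apply: sub_le => //.
  by apply: PB; rewrite ?leq_maxr.
have aub k : a k <= sup (range a).
  by apply: ub_le_sup; [exists C0 => _ [k' _ <-] | exists k].
move=> e e0; have e2 : 0 < e / 2 by lra.
(* The double family [a] is monotone and bounded. Once it is within [e / 2] of its supremum,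
   whatever a larger box adds beyond [P K] has [W]-weight below [e / 2]. *)
have [|_ [[K0 M0] _ <-] ha] := @sup_adherent R (range a) _ e2.
  by split; [exists (a (0, 0)%N), (0, 0)%N | exists C0 => _ [k' _ <-]].
exists K0 => K KK0.
have main M L : (maxn M0 K <= M)%N -> (K <= L)%N ->
    cabs (\sum_(l <- B M L) w M l - \sum_(l <- P K) w M l) <= e / 2.
  rewrite geq_max => /andP[M0M KM] KL; have PKB := PB K M L KM KL.
  rewrite (big_uniq_sub (fun l => w M l) (uP K) (uB M L) PKB) addrAC subrr add0r.
  apply: le_trans (cabs_sum _ _ _) _.
  apply: (@le_trans _ _ (\sum_(l <- B M L | l \notin P K) W M l)).
    by apply: ler_sum => l _.
  have [K1 hK1] := BP M L; pose K2 := maxn K K1.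
  have h1 : \sum_(l <- B M L) W M l <= a (K2, M).
    by apply: sub_le => // l /hK1; apply: Pm; rewrite leq_maxr.
  rewrite (big_uniq_sub (W M) (uP K) (uB M L) PKB) in h1.
  have h2 := aub (K2, M); have h3 := am K0 K M0 M KK0 M0M.
  rewrite /a /= in h1 h2 h3 ha *; lra.
have main2 M : (maxn M0 K <= M)%N -> cabs (phi M - \sum_(l <- P K) w M l) <= e / 2.
  move=> hM; apply: (@ccvg_le R (fun L => \sum_(l <- B M L) w M l - \sum_(l <- P K) w M l) _ _ K).
    exact: ccvgD (hphi M) (ccvg_cst _).
  by move=> L hL; exact: main.
rewrite cabsC; apply: (@le_lt_trans _ _ (e / 2)); last lra.
apply: (@ccvg_le R (fun M => phi M + (-1) * \sum_(l <- P K) w M l) _ _ (maxn M0 K)).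
  have -> : phil - \sum_(l <- P K) winf l = phil + (-1) * \sum_(l <- P K) winf l by rewrite mulN1r.
  apply: ccvgD hphil _; apply: ccvgM; first exact: ccvg_cst.
  by apply: ccvg_sum => l _; exact: hw.
by move=> M hM; rewrite mulN1r; exact: main2.
Qed.

Lemma inner_term (u : C) (a b : nat) : u != 0 ->
  u ^ (2 * (a%:Z - b%:Z) + 1)%R = u * ((u ^+ 2) ^+ a * (u ^+ 2) ^- b).
Proof.
move=> u0; rewrite expfzDr // expr1z mulrC -exprz_exp -exprnP expfzDr ?expf_neq0 //.
by rewrite -exprnP -exprnN.
Qed.

Definition inner_part (l : nat -> nat) (u : C) M : C :=
  u * \sum_(i < M) (u ^+ 2) ^+ l i * (u ^+ 2) ^- i.+1.

Lemma inner_cvg (l : nat -> nat) (u : C) b : 1 < cabs u -> (forall i, (l i <= b)%N) ->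
  ccvg (inner_part l u) (inner_sum l u).
Proof.
move=> u1 hl; have u0 : u != 0 by rewrite -cabs_gt0; lra.
have t1 : 1 < cabs u ^+ 2 by rewrite expr2; nra.
have E : series (fun i : nat => u ^ (2 * ((l i)%:Z - (i.+1)%:Z) + 1)%R) = inner_part l u.
  apply/funext => M; rewrite /series /= big_mkord /inner_part mulr_sumr.
  by apply: eq_bigr => i _; exact: inner_term.
have hr : 0 <= (cabs u ^+ 2)^-1 < 1.
  by rewrite invr_ge0 ltW ?invf_lt1 //=; lra.
have h : ccvg (inner_part l u) (climit (inner_part l u)).
  apply: (@climitP R _ (cabs u * (cabs u ^+ 2) ^+ b) _ hr) => M.
  rewrite /inner_part big_ord_recr /= mulrDr addrAC subrr add0r !(cabsM, cabsV, cabsX).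
  rewrite -!mulrA; apply: ler_wpM2l; first exact: cabs_ge0.
  apply: ler_pM; rewrite ?exprn_ge0 ?invr_ge0 ?exprn_ge0 ?cabs_ge0 //.
    by apply: ler_weXn2l => //; exact: ltW.
  rewrite exprVn lef_pV2 ?posrE ?exprn_gt0 //; try lra.
  by apply: ler_weXn2l => //; exact: ltW.
by rewrite /inner_sum E (ccvg_lim h).
Qed.

End Tannery.

Section PartitionSeries.
Variable R : realType.
Local Notation C := (Cx R).
Variables (q : C) (r : nat) (u : nat -> C).
Hypothesis q1 : cabs q < 1.
Hypothesis hu : forall a : 'I_r, 1 < cabs (u a).
Hypothesis hrho : cabs q * \prod_(a < r) cabs (u a) ^+ 2 < 1.

Let t (a : 'I_r) : C := u a ^+ 2.
Let T : R := \prod_(a < r) cabs (u a) ^+ 2.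

Lemma pcoef_sum K : \sum_(0 <= N < K) q ^+ N * pcoef r u N =
  \sum_(l <- parts_below K) q ^+ sumn l * \prod_(a < r) inner_sum (nth 0%N l) (u a).
Proof.
elim: K => [|K IH]; first by rewrite big_geq // big_nil.
rewrite big_nat_recr //= IH parts_belowS big_cat; congr (_ + _).
transitivity (\sum_(l <- parts_of K) q ^+ K *
   \prod_(a < r) inner_sum (nth 0%N l) (u a)); last first.
  rewrite big_seq [RHS]big_seq; apply: eq_bigr => l.
  by rewrite mem_parts_of => /andP[_ /eqP ->].
rewrite /pcoef mulr_sumr /parts_of big_map big_enum; apply: eq_bigr => s /andP[sl _].
have -> // : nth 0%N (trim (map (@nat_of_ord K.+1) s)) = lam s.
by apply/funext => i; rewrite nth_trim.
Qed.

Lemma geom_near1 (X : C) (rho : R) n : cabs X <= rho -> rho < 1 ->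
  cabs (\sum_(c < n.+1) X ^+ c - 1) <= cabs X / (1 - rho).
Proof.
move=> hX r1; have x0 := cabs_ge0 X.
rewrite big_ord_recl expr0 addrAC subrr add0r; apply: le_trans (cabs_sum _ _ _) _.
apply: (@le_trans _ _ (\sum_(c < n) cabs X * cabs X ^+ c)).
  by apply: ler_sum => c _; rewrite lift0 cabsX exprS.
rewrite -mulr_sumr; apply: ler_wpM2l => //.
have hr : 0 <= cabs X < 1 by lra.
have := geo_sum_le 0 n hr; rewrite add0n big_mkord => /le_trans; apply.
by rewrite expr0 mul1r lef_pV2 ?posrE; lra.
Qed.

Lemma geom_cvg (X : C) : cabs X < 1 ->
  ccvg (fun n => \sum_(c < n.+1) X ^+ c) (1 - X)^-1.
Proof.
move=> X1 e e0; have x0 := cabs_ge0 X.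
have nz : 1 - X != 0.
  by rewrite subr_eq0 eq_sym; apply/eqP => Xe; rewrite Xe cabs1 ltxx in X1.
have hr : 0 <= cabs X < 1 by lra.
have [N hN] := geo_small (cabs (1 - X)^-1) hr e0.
exists N => n Nn; have := hN n.+1 (leqW Nn); apply: le_lt_trans.
have -> : \sum_(c < n.+1) X ^+ c - (1 - X)^-1 = - ((1 - X)^-1 * X ^+ n.+1).
  have : (1 - X) * \sum_(c < n.+1) X ^+ c = 1 - X ^+ n.+1.
    elim: n.+1 => [|k IH]; first by rewrite big_ord0 expr0 mulr0 subrr.
    by rewrite big_ord_recr mulrDr IH exprS /=; ring.
  by move=> h; apply: (mulfI nz); rewrite mulrBr h mulfV // mulrN mulVKf //; ring.
by rewrite cabsN cabsM cabsX.
Qed.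

Lemma rows_cvg (I : finType) (kap : nat -> nat -> {set I} -> C) kapl (s : I -> C) M (S : {set I}) :
  (forall h A, (0 < h)%N -> ccvg (fun L => kap L h A) (kapl h A)) ->
  ccvg (fun L => rows (kap L) s M S) (rows kapl s M S).
Proof.
move=> h; elim: M S => [|M IH] S /=; first exact: ccvg_cst.
apply: ccvgM; first exact: h.
by apply: ccvg_sum => A _; apply: ccvgM => //; exact: ccvg_cst.
Qed.

(** [tannery] with [P K] the partitions of size below [K] and [B M L] those of a box. The box sums
    are known in closed form, and [hrho] keeps every geometric series [(q ^+ h * T_A) ^+ c] below a
    ratio [rho < 1]. *)
Lemma partition_series : ccvg (fun K => \sum_(0 <= N < K) q ^+ N * pcoef r u N)
  ((\prod_(a < r) u a) * PhiL q 1 t finset.setT).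
Proof.
have q0 := cabs_ge0 q.
have u0 a : 0 <= cabs (u a) := cabs_ge0 _.
have ta a : 1 < cabs (t a) by have := hu a; rewrite /t cabsX expr2; nra.
have t0 a : t a != 0 by rewrite -cabs_gt0; have := ta a; lra.
have T1 : 1 <= T.
  rewrite /T; apply: (big_ind (fun x : R => 1 <= x)) => // [x y hx hy|a _]; first exact: mulr_ege1.
  by have := ta a; rewrite /t cabsX; lra.
pose rho := cabs q * T; have rho1 : rho < 1 by [].
have [s /andP[qs s1] /nearpt_at hs] : exists2 s : R, cabs q <= s < 1 &
    nearpt 0 u (fun=> forall a, 1 <= cabs (t a) * s).
  apply: (@near_outside R 0 u (cabs q) _ (fun a _ => t a)) => //; first by rewrite q0 q1.
  by move=> a; exact: ccont_cst.
have hs01 : 0 <= s < 1 by lra.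
pose K := T / (1 - rho); have K0 : 0 <= K by rewrite divr_ge0 //; lra.
(* bounds valid both for (q, t) and for their moduli *)
have kbound (q' : C) (t' : 'I_r -> C) L h (S : {set 'I_r}) : cabs q' = cabs q ->
   (forall a, cabs (t' a) = cabs (t a)) -> (0 < h)%N ->
   cabs (q' ^+ h * \prod_(a in S) t' a) <= rho /\
   cabs (\sum_(c < L.+1) (q' ^+ h * \prod_(a in S) t' a) ^+ c - 1) <= K * s ^+ h.
  move=> eq et h0; set X := q' ^+ h * _.
  have ST : \prod_(a in S) cabs (t' a) <= T.
    rewrite /T big_mkcond; apply: ler_prod => a _; rewrite -cabsX -/(t a).
    case: ifP => _; rewrite ?et ?cabs_ge0 ?lexx ?ler01 //=; exact: ltW (ta a).
  have S0 : 0 <= \prod_(a in S) cabs (t' a) by apply: prodr_ge0 => a _; exact: cabs_ge0.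
  have XT : cabs X <= cabs q ^+ h * T.
    by rewrite /X cabsM cabsX cabs_prod eq; apply: ler_wpM2l => //; exact: exprn_ge0.
  have Xr : cabs X <= rho.
    apply: le_trans XT _; apply: ler_wpM2r; first lra.
    by rewrite -[leRHS]expr1; apply: ler_wiXn2l => //; exact: ltW.
  split=> //; apply: le_trans (geom_near1 L Xr rho1) _.
  rewrite /K [T / _ * _]mulrAC; apply: ler_wpM2r; first by rewrite invr_ge0; lra.
  apply: le_trans XT _; rewrite mulrC; apply: ler_wpM2l; first lra.
  by apply: lerXn2r; rewrite ?nnegrE //; lra.
pose w M (l : seq nat) : C := q ^+ sumn l * \prod_(a < r) inner_part (nth 0%N l) (u a) M.
(* The moduli are kept as complex numbers so that [box_sum] and [rows_le] apply to the majorant as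
   well. *)
pose q' : C := rc (cabs q); pose t' a : C := rc (cabs (t a)).
have cq' : cabs q' = cabs q by rewrite cabs_rc ger0_norm.
have ct' a : cabs (t' a) = cabs (t a) by rewrite cabs_rc ger0_norm ?cabs_ge0.
pose W M (l : seq nat) : R := cabs q ^+ sumn l * \prod_(a < r)
   (cabs (u a) * \sum_(i < M) cabs (t a) ^+ nth 0%N l i * cabs (t a) ^- i.+1).
have sum0 a M (l : seq nat) : 0 <= \sum_(i < M) cabs (t a) ^+ nth 0%N l i * cabs (t a) ^- i.+1.
  by apply: sumr_ge0 => i _; rewrite mulr_ge0 ?invr_ge0 ?exprn_ge0 ?cabs_ge0.
pose B M L := map trim (box L M).
have eqB (V : nmodType) (F : seq nat -> V) M L : (forall l, sorted geq l -> F (trim l) = F l) ->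
    \sum_(l <- B M L) F l = \sum_(l <- box L M) F l.
  move=> hF; rewrite big_map big_seq [RHS]big_seq; apply: eq_bigr => l /box_prop [_ sl].
  exact: hF.
have nthE l : sorted geq l -> nth 0%N (trim l) = nth 0%N l.
  by move=> sl; apply/funext => i; exact: nth_trim.
have sumw M L : \sum_(l <- B M L) w M l = (\prod_(a < r) u a) *
    rows (fun h A => \sum_(c < L.+1) (q ^+ h * \prod_(a in A) t a) ^+ c) t M finset.setT.
  rewrite eqB => [|l sl]; last by rewrite /w sumn_trim nthE.
  rewrite -(box_sum q L M finset.setT t0) mulr_sumr; apply: eq_bigr => l _.
  rewrite /w /inner_part big_split /= mulrCA; congr (_ * (_ * _)).
  by apply: eq_bigl => a; rewrite finset.in_setT.
have sumW M L : rc (\sum_(l <- B M L) W M l) = rc (\prod_(a < r) cabs (u a)) *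
    rows (fun h A => \sum_(c < L.+1) (q' ^+ h * \prod_(a in A) t' a) ^+ c) t' M finset.setT.
  rewrite eqB => [|l sl]; last by rewrite /W sumn_trim nthE.
  have t'0 a : t' a != 0 by rewrite -cabs_gt0 ct'; have := ta a; lra.
  rewrite -(box_sum q' L M finset.setT t'0) mulr_sumr (big_morph _ (@rcD R) (@rc0 R)).
  apply: eq_bigr => l _; rewrite /W big_split /= !rcM rcX mulrCA; congr (_ * (_ * _)).
  rewrite (big_morph _ (@rcM R) (@rc1 R)); apply: eq_big => [a|a _].
    by rewrite finset.in_setT.
  rewrite (big_morph _ (@rcD R) (@rc0 R)); apply: eq_bigr => i _.
  by rewrite rcM rcX rcV rcX.
have hPhi : forall M, cabs (Phi q 1 t M.+1 finset.setT - Phi q 1 t M finset.setT)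
    <= Phi_const 'I_r (T / (1 - rho)) s * s ^+ M.
  apply: Phi_geo => //; try lra.
    move=> A _; rewrite mul1r; have [h _] := kbound q t 0%N 1%N A erefl (fun=> erefl) isT.
    rewrite cabs_prod /T big_mkcond; apply: ler_prod => a _; rewrite -cabsX -/(t a).
    by case: ifP => _; rewrite ?cabs_ge0 ?lexx ?ler01 //=; exact: ltW (ta a).
  move=> h A h0 _; rewrite mulr1; have [hh _] := kbound q t 0%N h A erefl (fun=> erefl) h0.
  by have := cabsB_ge 1 (q ^+ h * \prod_(a in A) t a); rewrite cabs1; lra.
have -> : (fun K => \sum_(0 <= N < K) q ^+ N * pcoef r u N) = (fun K =>
   \sum_(l <- parts_below K) q ^+ sumn l * \prod_(a < r) inner_sum (nth 0%N l) (u a)).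
  by apply/funext => k; exact: pcoef_sum.
apply: (@tannery R _ parts_below B w _ W
   (fun M => (\prod_(a < r) u a) * Phi q 1 t M finset.setT) _
   ((\prod_(a < r) cabs (u a)) * rows_const 'I_r K s)).
- exact: parts_below_uniq.
- move=> M L; rewrite map_inj_in_uniq ?box_uniq // => l l' /box_prop[s2 g] /box_prop[s' g'].
  by apply: trim_inj; rewrite ?s2.
- move=> k k' kk l; rewrite !mem_parts_below => /andP[-> h]; exact: leq_trans h kk.
- move=> k M L kM kL l; rewrite mem_parts_below => /andP[pl lk].
  apply/mapP; exists (l ++ nseq (M - size l) 0%N); last by rewrite trim_pad.
  have szl : (size l <= M)%N.
    exact: leq_trans (size_part pl) (leq_trans (ltnW lk) kM).
  apply: mem_box; first by rewrite size_cat size_nseq subnKC.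
    by apply: sorted_pad; case/andP: pl.
  apply/allP => x; rewrite mem_cat => /orP[/le_sumn h|]; last first.
    by rewrite mem_nseq => /andP[_ /eqP ->].
  exact: leq_trans h (leq_trans (ltnW lk) kL).
- move=> M L; exists (sumn (map sumn (box L M))).+1 => _ /mapP[l lb ->].
  have [_ sl] := box_prop lb.
  rewrite mem_parts_below part_trim //= sumn_trim ltnS.
  by apply: le_sumn; exact: map_f.
- move=> M l; rewrite /w /W cabsM cabsX cabs_prod; apply: ler_wpM2l; first exact: exprn_ge0.
  apply: ler_prod => a _; rewrite cabs_ge0 /= /inner_part cabsM; apply: ler_wpM2l => //.
  apply: le_trans (cabs_sum _ _ _) _; apply: ler_sum => i _.
  by rewrite cabsM cabsV !cabsX.
- move=> M l; rewrite /W; apply: ler_wpM2l; first exact: exprn_ge0.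
  apply: ler_prod => a _; apply/andP; split; first by apply: mulr_ge0 => //; exact: sum0.
  apply: ler_wpM2l => //.
  by rewrite big_ord_recr /= lerDl mulr_ge0 ?invr_ge0 ?exprn_ge0 ?cabs_ge0.
- move=> l; apply: ccvgM; first exact: ccvg_cst.
  apply: ccvg_prod => a _; apply: (@inner_cvg R _ _ (sumn l)) => // i.
  exact: nth_le_sumn.
- move=> M L; apply: le_trans (ler_norm _) _; rewrite -cabs_rc sumW cabsM cabs_rc.
  rewrite ger0_norm; last by apply: prodr_ge0.
  apply: ler_wpM2l; first exact: prodr_ge0.
  apply: rows_le => // [h A h0|a]; first by have [] := kbound q' t' L h A cq' ct' h0.
  by rewrite ct'; exact: hs.
- move=> M; rewrite (funext (sumw M)); apply: ccvgM; first exact: ccvg_cst.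
  apply: rows_cvg => h A h0; have [hh _] := kbound q t 0%N h A erefl (fun=> erefl) h0.
  by rewrite mulr1; apply: geom_cvg; lra.
- apply: ccvgM; first exact: ccvg_cst.
  exact: PhiL_cvg hs01 hPhi.
Qed.

End PartitionSeries.

(** * Row sums as holomorphic functions *)

Section HolomorphicRowSums.
Variable R : realType.
Local Notation C := (Cx R).
Implicit Types (u v p : nat -> C) (q : C) (W : (nat -> C) -> Prop).

Lemma dd_of_hol n (W : (nat -> C) -> Prop) f : holC n W f -> divdiff n W id (fun=> 0) f.
Proof.
move=> hf; split=> //; exists (fun=> 0) => [|u _]; first exact: holC_cst.
by rewrite subrr mul0r.
Qed.

Lemma holCX n W (f : (nat -> C) -> C) k : holC n W f -> holC n W (fun u => f u ^+ k).
Proof.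
by move=> h; have [] // := @ddX R n W id (fun=> 0) (@holC_cst R n W 0) f k (dd_of_hol h).
Qed.
Lemma holC_Phi n W (I : finType) q (x : (nat -> C) -> C) (t : I -> (nat -> C) -> C)
    M (S : {set I}) :
  holC n W x -> (forall a, holC n W (t a)) -> (forall a u, W u -> t a u != 0) ->
  (forall h (A : {set I}) u, (0 < h)%N -> A \subset S -> W u ->
     1 - q ^+ h * x u * \prod_(a in A) t a u != 0) ->
  holC n W (fun u => Phi q (x u) (fun a => t a u) M S).
Proof.
move=> hx ht t0 hne.
have [] // := @dd_Phi R n W id (fun=> 0) (@holC_cst R n W 0) I q x t M S
   (dd_of_hol hx) (fun a => dd_of_hol (ht a)) _ _.
  by move=> a u Wu; split; exact: t0.
by move=> h A u /andP[h0 _] AS Wu; split; exact: hne.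
Qed.

End HolomorphicRowSums.

(** * Holomorphic functions and geometrically convergent sequences near a point *)

Section NearSequences.
Variable R : realType.
Local Notation C := (Cx R).
Variables (n : nat) (p : nat -> C).
Implicit Types (u v : nat -> C) (q : C) (c : (nat -> C) -> C).
Implicit Types (f g : nat -> (nat -> C) -> C).

Definition nearhol c := exists2 d : R, 0 < d & holC n (pd n p d) c.
Definition ugeo f := exists B r : R, [/\ 0 <= B, 0 <= r < 1 &
  nearpt n p (fun u => forall M, cabs (f M.+1 u - f M u) <= B * r ^+ M)].
(** A class stable under sums, under holomorphic multipliers and under division by a transverse
    equation, and whose limits are holomorphic near [p]. *)
Definition nseq f := (exists2 d : R, 0 < d & forall M, holC n (pd n p d) (f M)) /\ ugeo f.

Lemma nearhol2 c c' : nearhol c -> nearhol c' ->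
  exists2 d : R, 0 < d & holC n (pd n p d) c /\ holC n (pd n p d) c'.
Proof.
move=> [d d0 hd] [e e0 he]; exists (Num.min d e); first by rewrite lt_min d0.
by split; [apply: holC_sub hd | apply: holC_sub he] => u /pd_min [].
Qed.

Lemma nearhol_cst a : nearhol (fun=> a).
Proof. by exists 1 => //; exact: holC_cst. Qed.
Lemma nearhol_coord i : (i < n)%N -> nearhol (fun u => u i).
Proof. by exists 1 => //; exact: holC_coord. Qed.
Lemma nearholD c c' : nearhol c -> nearhol c' -> nearhol (fun u => c u + c' u).
Proof.
by move=> h h'; have [d d0 [h1 h2]] := nearhol2 h h'; exists d => //; exact: holCD.
Qed.
Lemma nearholM c c' : nearhol c -> nearhol c' -> nearhol (fun u => c u * c' u).
Proof.
by move=> h h'; have [d d0 [h1 h2]] := nearhol2 h h'; exists d => //; exact: holCM.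
Qed.
Lemma nearhol_ccont c : nearhol c -> ccont n c p.
Proof. by move=> [d d0 hd]; have [] := hd p (@pd_refl R n p d d0). Qed.
Lemma near_neq0 c : ccont n c p -> c p != 0 -> nearpt n p (fun u => c u != 0).
Proof.
move=> cc c0; apply: nearpt_mono (cc (cabs (c p)) _); last by rewrite cabs_gt0.
by move=> u hu; apply/eqP => cu; rewrite cu sub0r cabsN ltxx in hu.
Qed.
Lemma nearholV c : c p != 0 -> nearhol c -> nearhol (fun u => (c u)^-1).
Proof.
move=> c0 h; have [e e0 he] := near_neq0 (nearhol_ccont h) c0.
have [d d0 hd] := h; exists (Num.min d e); first by rewrite lt_min d0.
apply: holCV => [u /pd_min [_ /he]//|].
by apply: holC_sub hd => u /pd_min [].
Qed.
Lemma nearholX c k : nearhol c -> nearhol (fun u => c u ^+ k).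
Proof. by move=> [d d0 hd]; exists d => //; exact: holCX. Qed.
Lemma nearhol_sum (J : Type) (s : seq J) (P : pred J) (F : J -> (nat -> C) -> C) :
  (forall j, P j -> nearhol (F j)) -> nearhol (fun u => \sum_(j <- s | P j) F j u).
Proof.
move=> h; elim: s => [|a s IH].
  under [X in nearhol X]eq_fun do rewrite big_nil; exact: nearhol_cst.
under [X in nearhol X]eq_fun do rewrite big_cons.
by case Pa: (P a) => //; apply: nearholD => //; exact: h.
Qed.
Lemma nearhol_prod (J : Type) (s : seq J) (P : pred J) (F : J -> (nat -> C) -> C) :
  (forall j, P j -> nearhol (F j)) -> nearhol (fun u => \prod_(j <- s | P j) F j u).
Proof.
move=> h; elim: s => [|a s IH].
  under [X in nearhol X]eq_fun do rewrite big_nil; exact: nearhol_cst.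
under [X in nearhol X]eq_fun do rewrite big_cons.
by case Pa: (P a) => //; apply: nearholM => //; exact: h.
Qed.

Lemma ugeoD f g : ugeo f -> ugeo g -> ugeo (fun M u => f M u + g M u).
Proof.
move=> [B [r [B0 hr h]]] [B' [r' [B'0 hr' h']]].
exists (B + B'), (Num.max r r'); split; first lra.
  by rewrite le_max gt_max; lra.
apply: nearpt_mono (nearptI h h') => u [h1 h2] M.
rewrite opprD addrACA; apply: le_trans (cabsD _ _) _; rewrite mulrDl; apply: lerD.
  apply: le_trans (h1 M) _; apply: ler_wpM2l => //.
  by apply: lerXn2r; rewrite ?nnegrE ?le_max ?lexx //; lra.
apply: le_trans (h2 M) _; apply: ler_wpM2l => //.
by apply: lerXn2r; rewrite ?nnegrE ?le_max ?lexx ?orbT //; lra.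
Qed.

Lemma ugeoM c f : ccont n c p -> ugeo f -> ugeo (fun M u => c u * f M u).
Proof.
move=> cc [B [r [B0 hr h]]]; have c0 := cabs_ge0 (c p).
exists ((cabs (c p) + 1) * B), r; split=> //; first by rewrite mulr_ge0 //; lra.
apply: nearpt_mono (nearptI h (cc 1 ltr01)) => u [h1 h2] M.
rewrite -mulrBr cabsM -mulrA; apply: ler_pM; rewrite ?cabs_ge0 //.
have := cabsB_ge (c u) (c p); lra.
Qed.

Lemma nseqD f g : nseq f -> nseq g -> nseq (fun M u => f M u + g M u).
Proof.
move=> [[d d0 hd] gf] [[e e0 he] gg]; split; last exact: ugeoD.
exists (Num.min d e) => [|M]; first by rewrite lt_min d0.
by apply: holCD; [apply: holC_sub (hd M) | apply: holC_sub (he M)] => u /pd_min [].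
Qed.
Lemma nseqM c f : nearhol c -> nseq f -> nseq (fun M u => c u * f M u).
Proof.
move=> hc [[e e0 he] gf]; split; last by apply: ugeoM => //; exact: nearhol_ccont.
have [d d0 hd] := hc; exists (Num.min d e) => [|M]; first by rewrite lt_min d0.
by apply: holCM; [apply: holC_sub hd | apply: holC_sub (he M)] => u /pd_min [].
Qed.
Lemma nseq_sum (J : Type) (s : seq J) (P : pred J) (F : J -> nat -> (nat -> C) -> C) :
  (forall j, P j -> nseq (F j)) -> nseq (fun M u => \sum_(j <- s | P j) F j M u).
Proof.
move=> h; elim: s => [|a s IH].
  have -> : (fun M u => \sum_(j <- [::] | P j) F j M u) = (fun _ _ => 0).
    by apply/funext => M; apply/funext => u; rewrite big_nil.
  split; first by exists 1 => // M; exact: holC_cst.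
  exists 0, 0; split=> //; first lra.
  by exists 1 => // u _ M; rewrite subrr cabs0 mul0r.
have -> : (fun M u => \sum_(j <- a :: s | P j) F j M u) = if P a then
  (fun M u => F a M u + \sum_(j <- s | P j) F j M u) else (fun M u => \sum_(j <- s | P j) F j M u).
  by apply/funext => M; apply/funext => u; rewrite big_cons; case: (P a).
by case Pa: (P a) => //; apply: nseqD => //; exact: h.
Qed.

Lemma nseq_limit f : nseq f -> exists2 d : R, 0 < d &
  holC n (pd n p d) (fun u => climit (fun M => f M u)) /\
  forall u, pd n p d u -> ccvg (fun M => f M u) (climit (fun M => f M u)).
Proof.
move=> [[d d0 hd] [B [r [B0 hr [e e0 he]]]]].
exists (Num.min d e); first by rewrite lt_min d0.
split=> [|u /pd_min [_ /he h]]; last exact: (@climitP R (fun M => f M u) B r hr h).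
apply: (@holC_limit R n _ f _ (B / (1 - r)) r) => //.
- by move=> u; exact: pd_open.
- by move=> M; apply: holC_sub (hd M) => u /pd_min [].
- by move=> M u /pd_min [_ /he h]; exact: (@climit_dist R (fun M => f M u) B r M hr h).
Qed.

Lemma nseq_Phi q (I : finType) (x : (nat -> C) -> C) (t : I -> (nat -> C) -> C)
    (S : {set I}) : cabs q < 1 -> nearhol x -> (forall a, nearhol (t a)) ->
  (forall a, 1 < cabs (t a p)) ->
  (forall h (A : {set I}), (0 < h)%N -> A \subset S ->
     q ^+ h * x p * \prod_(a in A) t a p != 1) ->
  nseq (fun M u => Phi q (x u) (fun a => t a u) M S).
Proof.
move=> q1 hx ht t1 hne.
have [B [r [hr hreg]]] := regular_near q1 (nearhol_ccont hx)
  (fun a => nearhol_ccont (ht a)) t1 hne.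
split; last first.
  exists B, r; split=> //; last by apply: nearpt_mono hreg => u [].
  have [h _] := nearpt_at hreg; have := h 0%N; rewrite expr0 mulr1.
  by apply: le_trans; exact: cabs_ge0.
have ht0 : nearpt n p (fun u => forall a, t a u != 0).
  apply: nearpt_all => a; apply: near_neq0; first exact: nearhol_ccont.
  by rewrite -cabs_gt0; have := t1 a; lra.
have hth : exists2 d : R, 0 < d & forall a, holC n (pd n p d) (t a).
  suff H (s : seq I) : exists2 d : R, 0 < d & forall a, a \in s -> holC n (pd n p d) (t a).
    by have [d d0 h] := H (enum I); exists d => // a; apply: h; rewrite mem_enum.
  elim: s => [|a s [d d0 IH]]; first by exists 1.
  have [e e0 he] := ht a; exists (Num.min d e); first by rewrite lt_min d0.
  move=> b; rewrite in_cons => /orP[/eqP ->|/IH hb].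
    by apply: holC_sub he => u /pd_min [].
  by apply: holC_sub hb => u /pd_min [].
have [d1 d10 h1] := hx; have [d2 d20 h2] := hth.
have [d3 d30 h3] := nearptI ht0 hreg.
exists (Num.min d1 (Num.min d2 d3)) => [|M]; first by rewrite !lt_min d10 d20.
have split3 u : pd n p (Num.min d1 (Num.min d2 d3)) u ->
    [/\ pd n p d1 u, pd n p d2 u & pd n p d3 u] by move=> /pd_min [? /pd_min []].
apply: holC_Phi.
- by apply: holC_sub h1 => u /split3 [].
- by move=> a; apply: holC_sub (h2 a) => u /split3 [].
- by move=> a u /split3 [_ _ /h3 []].
- by move=> h A u k0 AS /split3 [_ _ /h3 [_ [_]]]; apply.
Qed.

(* By the Cauchy bound in the variable [u 0], dividing by a function vanishing simply
   along a hypersurface transverse to that variable preserves geometric convergence. *)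
Lemma nseq_divide (b : (nat -> C) -> C) f g : (0 < n)%N -> ccont n b p ->
  (forall u z, b (upd u 0%N z) = b u) -> b p * p 0%N = 1 ->
  (exists2 d : R, 0 < d & forall M, holC n (pd n p d) (f M)) ->
  nearpt n p (fun u => forall M, g M u = (b u * u 0%N - 1) * f M u) ->
  ugeo g -> nseq f.
Proof.
move=> n0 cb bupd bp1 hf [d1 d10 hg] [B [r [B0 hr [d2 d20 hgeo]]]].
have [d3 d30 hd3] := hf.
split=> //; pose beta := cabs (b p).
have beta0 : 0 < beta.
  by rewrite cabs_gt0; apply/eqP => b0; move/eqP: bp1; rewrite b0 mul0r eq_sym oner_eq0.
(* A point within [s] of [p], with its first coordinate moved by at most [2 * s], stays within
   [4 * s], hence in all three polydiscs. *)
pose s := Num.min d1 (Num.min d2 d3) / 4.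
have s0 : 0 < s by rewrite divr_gt0 // !lt_min d10 d20.
have s1 : 4 * s <= d1 by rewrite /s mulrC divfK // ge_min lexx.
have s2 : 4 * s <= d2 by rewrite /s mulrC divfK // !ge_min lexx orbT.
have s3 : 4 * s <= d3 by rewrite /s mulrC divfK // !ge_min lexx !orbT.
pose ep u := b u * u 0%N - 1.
have cep : ccont n ep p.
  apply: ccontD; last exact: ccont_cst.
  by apply: ccontM => //; exact: ccont_coord.
have e1 : 0 < beta / 2 by lra.
(* For [z] at distance at least [s] from [u 0], the linear part of [ep] has modulus at least
   [beta * s / 2]; with [ep u] below half of this, [ep] is at least [beta * s / 4] where the Cauchy
   bound samples it. *)
have e2 : 0 < beta * s / 4 by rewrite divr_gt0 // mulr_gt0.
exists (2 * (B / (beta * s / 4))), r; split=> //; first by rewrite mulr_ge0 // divr_ge0 // ltW.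
have hs : nearpt n p (pd n p s) by exists s.
apply: nearpt_mono (nearptI hs (nearptI (cb _ e1) (cep _ e2))) => u [hu [hb hep]] M.
have bu : beta / 2 <= cabs (b u).
  have := cabsB_ge (b p) (b u); rewrite cabsC -/beta; lra.
have epu : cabs (ep u) <= beta * s / 4.
  have : ep p = 0 by rewrite /ep bp1 subrr.
  by move=> ep0; rewrite ep0 subr0 in hep; exact: ltW.
have epz z : ep (upd u 0%N z) = b u * (z - u 0%N) + ep u.
  by rewrite /ep bupd upd_at; ring.
have zin z : cabs (z - u 0%N) <= 2 * s -> pd n p (4 * s) (upd u 0%N z).
  move=> hz i iN; rewrite /upd; case: eqP => [->|_].
    have := cabs_tri (u 0%N) z (p 0%N); have := hu 0%N n0; lra.
  have := hu i iN; lra.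
pose G z := f M.+1 (upd u 0%N z) - f M (upd u 0%N z).
have -> : f M.+1 u - f M u = G (u 0%N) by rewrite /G upd_id.
rewrite -mulrA; apply: (@cauchy_bound R G (u 0%N) s) => // z.
  move=> hz; have hW : pd n p d3 (upd u 0%N z) by apply: pd_le (zin z hz).
  have E c : (fun z0 : C => c (upd (upd u 0%N z) 0%N z0)) = (fun z0 => c (upd u 0%N z0)) :> (C -> C).
    by apply/funext => y; rewrite upd_upd.
  have [_ /(_ 0%N n0)] := hd3 M.+1 _ hW; rewrite upd_at E => dM1.
  have [_ /(_ 0%N n0)] := hd3 M _ hW; rewrite upd_at E => dM.
  exact: cdiffB.
move=> /andP[hz1 hz2].
have low : beta * s / 4 <= cabs (ep (upd u 0%N z)).
  rewrite epz; have := cabsB_ge (b u * (z - u 0%N)) (- ep u).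
  rewrite opprK cabsN cabsM; have : beta / 2 * s <= cabs (b u) * cabs (z - u 0%N).
    by apply: ler_pM => //; lra.
  lra.
have W1 : pd n p d1 (upd u 0%N z) by apply: pd_le (zin z hz2).
have W2 : pd n p d2 (upd u 0%N z) by apply: pd_le (zin z hz2).
have := hgeo _ W2 M; rewrite !hg // -mulrBr cabsM -/(ep _) -/(G z) => hle.
rewrite mulrAC ler_pdivlMr // mulrC; apply: le_trans hle.
by apply: ler_wpM2r => //; exact: cabs_ge0.
Qed.

End NearSequences.

(** * Continuation of the series *)

Section Continuation.
Variable R : realType.
Local Notation C := (Cx R).
Implicit Types (u v p : nat -> C) (q : C).

(** Without factors to place, the row sum is the product of the [(1 - q ^+ h)^-1], and its limit is
    the generating series of partitions, the denominator of the bracket. *)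
Definition normalizer q : C := PhiL q 1 (fun _ : 'I_0 => 1) finset.setT.
Definition Fprod q r u : C :=
  (\prod_(a < r) u a) * PhiL q 1 (fun a : 'I_r => u a ^+ 2) finset.setT / normalizer q.

Lemma Fseries_Fprod q r u : cabs q < 1 -> (forall a : 'I_r, 1 < cabs (u a)) ->
  cabs q * \prod_(a < r) cabs (u a) ^+ 2 < 1 -> Fseries q r u = Fprod q r u.
Proof.
move=> q1 hu hrho; rewrite /Fseries.
have -> : limn (series (fun N => q ^+ N * pcoef r u N)) = (\prod_(a < r) u a) *
    PhiL q 1 (fun a : 'I_r => u a ^+ 2) finset.setT.
  by apply: ccvg_lim; exact: partition_series.
have -> // : limn (series (fun N => q ^+ N * pcoef 0 u N)) = normalizer q.
have := @partition_series R q 0 u q1.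
rewrite !big_ord0 mulr1 mul1r => /(_ _ q1) h; apply: ccvg_lim.
have -> : normalizer q = PhiL q 1 (fun a : 'I_0 => u a ^+ 2) finset.setT.
  by rewrite /normalizer (_ : (fun _ => 1) = (fun a : 'I_0 => u a ^+ 2)) //; apply/funext => -[].
by apply: h => -[].
Qed.

Lemma near_gt1 n u (i : nat) : (i < n)%N -> 1 < cabs (u i) ->
  nearpt n u (fun v => 1 < cabs (v i)).
Proof.
move=> iN ui; exists (cabs (u i) - 1) => [|v /(_ i iN) hv]; first lra.
by have := cabsB_ge (u i) (v i); rewrite cabsC in hv; lra.
Qed.

Lemma qX_neq1 q h : cabs q < 1 -> (0 < h)%N -> q ^+ h != 1.
Proof.
move=> q1 h0; apply/eqP => /(congr1 (@cabs R)); rewrite cabsX cabs1 => e.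
have : cabs q ^+ h < 1 by rewrite exprn_ilt1 ?cabs_ge0 // lt0n_neq0.
by rewrite e ltxx.
Qed.

Lemma good_domainP q r u : cabs q < 1 -> good_domain q r u <->
  (forall i, (i < r)%N -> 1 < cabs (u i)) /\
  (forall h (A : {set 'I_r}), (0 < h)%N -> q ^+ h * \prod_(a in A) u a ^+ 2 != 1).
Proof.
move=> q1; split=> -[h1 h2]; split.
- by move=> i /h1; rewrite -norm_gt.
- move=> h A h0; apply/eqP => e; apply: h2; exists h; split=> //; exists A; split=> //.
  rewrite lt0n; apply/eqP => /cards0_eq A0; move: e; rewrite A0 big_set0 mulr1.
  by apply/eqP; exact: qX_neq1.
- by move=> i /h1; rewrite -norm_gt.
- by move=> [h [h0 [A [_ e]]]]; move/eqP: e; apply/negP; exact: h2.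
Qed.

Lemma sqr_gt1 (z : C) : 1 < cabs z -> 1 < cabs (z ^+ 2).
Proof. by rewrite cabsX expr2 => h; nra. Qed.

Lemma good_nseq q r u : cabs q < 1 -> good_domain q r u ->
  nseq r u (fun M v => Phi q 1 (fun a : 'I_r => v a ^+ 2) M finset.setT).
Proof.
move=> q1 /(good_domainP _ _ q1) [h1 h2].
apply: (@nseq_Phi R r u q 'I_r (fun=> 1) (fun a v => v a ^+ 2)) => //.
- exact: nearhol_cst.
- by move=> a; apply: nearholX; exact: nearhol_coord.
- by move=> a; apply: sqr_gt1; exact: h1.
- by move=> h A h0 _; rewrite mulr1; exact: h2.
Qed.

Lemma good_cvg q r u : cabs q < 1 -> good_domain q r u ->
  ccvg (fun M => Phi q 1 (fun a : 'I_r => u a ^+ 2) M finset.setT)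
    (PhiL q 1 (fun a : 'I_r => u a ^+ 2) finset.setT).
Proof.
move=> q1 gu; have [d d0 [_ h]] := nseq_limit (good_nseq q1 gu).
exact: h (@pd_refl R r u d d0).
Qed.

Lemma near_good q r u : cabs q < 1 -> good_domain q r u -> nearpt r u (good_domain q r).
Proof.
move=> q1 /(good_domainP _ _ q1) [h1 h2].
have ct (a : 'I_r) : ccont r (fun v : nat -> C => v a ^+ 2) u.
  by apply: ccontX; exact: ccont_coord.
have [||B [s [_ hreg]]] :=
  @regular_near R r u q 'I_r (fun=> 1) (fun (a : 'I_r) (v : nat -> C) => v a ^+ 2) finset.setT q1
   (@ccont_cst R r 1 u) ct.
- by move=> a; apply: sqr_gt1; exact: h1.
- by move=> h A h0 _; rewrite mulr1; exact: h2.
have h3 := nearpt_nat (fun j jr => near_gt1 jr (h1 j jr)).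
apply: nearpt_mono (nearptI h3 hreg) => v [g1 [_ g2]].
apply/(good_domainP _ _ q1); split=> // h A h0.
by have := g2 h A h0 (finset.subsetT A); rewrite mulr1 subr_eq0 eq_sym.
Qed.

Lemma Fprod_near q r u : cabs q < 1 -> good_domain q r u -> nearhol r u (Fprod q r).
Proof.
move=> q1 gu; have [d d0 [hL _]] := nseq_limit (good_nseq q1 gu).
apply: nearholM; last exact: nearhol_cst.
by apply: nearholM; [apply: nearhol_prod => a _; exact: nearhol_coord | exists d].
Qed.

Lemma avoid_seq (L : seq R) (eta : R) : 0 < eta -> exists2 x, 0 < x < eta & x \notin L.
Proof.
move=> eta0; suff [e e0 he] : exists2 e : R, 0 < e <= eta & forall x, 0 < x < e -> x \notin L.
  by exists (e / 2); [lra | apply: he; lra].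
elim: L => [|y L [e e0 IH]]; first by exists eta => //; lra.
have [y0|y0] := ltP 0 y.
  exists (Num.min e y); first by rewrite lt_min ge_min y0; lra.
  move=> x; rewrite lt_min => /andP[x0 /andP[xe xy]].
  rewrite in_cons negb_or IH ?x0 // andbT; apply/eqP; lra.
exists e => // x hx; rewrite in_cons negb_or IH // andbT; apply/eqP; lra.
Qed.

(** Provides a thin product of annuli inside the domain of convergence, from which the continuation
    starts. *)
Lemma small_radius q r : cabs q < 1 -> exists2 d : R, 0 < d &
  forall u, (forall a : 'I_r, 1 < cabs (u a) < 1 + d) ->
    cabs q * \prod_(a < r) cabs (u a) ^+ 2 < 1.
Proof.
move=> q1; pose f (u : nat -> C) := q * \prod_(a < r) u a ^+ 2.
have cf : ccont r f (fun=> 1).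
  apply: ccontM; first exact: ccont_cst.
  by apply: ccont_prod => a; apply: ccontX; exact: ccont_coord.
have e0 : 0 < 1 - cabs q by lra.
have [d d0 hd] := cf _ e0; exists d => // u hu.
pose v i : C := rc (cabs (u i)).
have := hd v; have -> : f (fun=> 1) = q.
  by rewrite /f big1 ?mulr1 // => a _; rewrite expr1n.
move=> /(_ _) h; have {}h : cabs (f v - q) < 1 - cabs q.
  apply: h => i ir; rewrite /v -rc1 -rcB cabs_rc; have := hu (Ordinal ir) => /= hi.
  by rewrite gtr0_norm; lra.
have -> : cabs q * \prod_(a < r) cabs (u a) ^+ 2 = cabs (f v).
  rewrite /f cabsM cabs_prod; congr (_ * _); apply: eq_bigr => a _.
  by rewrite cabsX /v cabs_rc ger0_norm ?cabs_ge0.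
have := cabsB_ge (f v) q; lra.
Qed.

Lemma prod_upd r u (j : nat) (jr : (j < r)%N) z (A : {set 'I_r}) :
  \prod_(a in A) upd u j z a ^+ 2 =
  if Ordinal jr \in A then z ^+ 2 * \prod_(a in A | a != Ordinal jr) u a ^+ 2
  else \prod_(a in A) u a ^+ 2.
Proof.
case: ifP => jA.
  rewrite (bigD1 (Ordinal jr)) //= upd_at; congr (_ * _).
  by apply: eq_bigr => a /andP[_ aj]; rewrite upd_ne //; apply: contra aj => /eqP e; apply/eqP/val_inj.
apply: eq_bigr => a aA; rewrite upd_ne //; apply/eqP => e.
by move: jA; rewrite (_ : Ordinal jr = a) ?aA //; apply/val_inj.
Qed.

(** Induction on the number [j] of coordinates released from the thin annulus. Coordinate [j] is
    moved from [u j] back into the annulus along a segment that avoids the divisors, and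
    [identity_segment] carries the equality along it. *)
Lemma is_F_Fprod q r (F : (nat -> C) -> C) u : 0 < cabs q < 1 -> is_F q r F ->
  good_domain q r u -> F u = Fprod q r u.
Proof.
move=> /andP[q0 q1] [_ [/holomorphic_onP hF hser]].
have qn0 : q != 0 by rewrite -cabs_gt0.
have [del del0 hdel] := small_radius r q1.
suff main j : (j <= r)%N -> forall u, good_domain q r u ->
    (forall i, (j <= i < r)%N -> cabs (u i) < 1 + del) -> F u = Fprod q r u.
  move=> gu; apply: (main r (leqnn r) u gu) => i; lia.
elim: j => [_ {}u gu hu|j IH jr {}u gu hu].
  have [h1 _] := (good_domainP r u q1).1 gu.
  have hr : cabs q * \prod_(a < r) cabs (u a) ^+ 2 < 1.
    by apply: hdel => a; rewrite h1 ?hu ?ltn_ord.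
  rewrite hser; [|by case: gu|].
    by apply: Fseries_Fprod => // a; exact: h1.
  rewrite normE -[1]/(rc 1); under eq_bigr do rewrite normE -rcX.
  by rewrite -(big_morph _ (@rcM R) (@rc1 R)) -rcM rc_lt.
have {}IH := IH (ltnW jr).
have [h1 h2] := (good_domainP r u q1).1 gu.
pose v := u j; have v1 : 1 < cabs v := h1 j jr.
have vn0 : v != 0 by rewrite -cabs_gt0; lra.
have [vs|vb] := ltP (cabs v) (1 + del).
  apply: IH => // i /andP[ji ir]; have [->//|ij] := eqVneq i j.
  by apply: hu; rewrite ltn_neqAle eq_sym ij ji.
(* Scales [v] to modulus [1 + del / 2], the middle of the annulus. *)
pose eps := (1 + del / 2) / cabs v.
have epsv : eps * cabs v = 1 + del / 2 by rewrite divfK // gt_eqF //; lra.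
have eps0 : 0 < eps by rewrite divr_gt0 //; lra.
have eps1 : eps < 1 by rewrite /eps ltr_pdivrMr; lra.
pose T := \prod_(a < r) cabs (u a) ^+ 2.
have hq : 0 <= cabs q < 1 by lra.
(* Multipliers [zeta] on the segment have modulus at most 2, whence the 4; for [h >= h0] the divisor
   equation fails by size, so only finitely many divisors have to be avoided. *)
have [h0 hh0] := geo_small (4 * T) hq ltr01.
pose g h (A : {set 'I_r}) : C := q ^+ h * \prod_(a in A) u a ^+ 2.
have un0 a : u (a : 'I_r) != 0 by rewrite -cabs_gt0; have := h1 a (ltn_ord a); lra.
have gn0 h A : g h A != 0.
  by rewrite mulf_neq0 ?expf_neq0 //; apply/prodf_neq0 => a _; rewrite expf_neq0.
pose root h A : C := sqrtc (g h A)^-1.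
have rootE h A : root h A ^+ 2 = (g h A)^-1 by exact: sqr_sqrtc.
(* The one slope [tau] for which the segment from [eps + i tau] to 1 passes through [om]. The points
   to avoid are the two square roots of each inverse of [g h A]. *)
pose tau0 (om : C) : R := complex.Im om * (1 - eps) / (1 - complex.Re om).
pose L := [seq tau0 (root hA.1 hA.2) | hA <- allpairs pair (iota 0 h0) (enum {set 'I_r})]
  ++ [seq tau0 (- root hA.1 hA.2) | hA <- allpairs pair (iota 0 h0) (enum {set 'I_r})].
(* [tau < 1] bounds the multipliers, and [tau * cabs v < del / 2] keeps the starting point in the
   annulus. *)
have eta0 : 0 < Num.min 1 (del / 2 / cabs v).
  by rewrite lt_min ltr01 !divr_gt0 //; lra.
have [tau] := avoid_seq L eta0; rewrite lt_min => /andP[tau0' /andP[tau1 tauv]] tauL.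
rewrite ltr_pdivlMr in tauv; last lra.
pose zeta (s : R) : C := rc (eps + s * (1 - eps)) + ci R * rc (tau * (1 - s)).
have Rez s : complex.Re (zeta s) = eps + s * (1 - eps).
  by rewrite /zeta !RIE !(mul0r, mulr0, mul1r, addr0, subr0).
have Imz s : complex.Im (zeta s) = tau * (1 - s).
  by rewrite /zeta !RIE !(mul0r, mulr0, mul1r, addr0, add0r, subr0).
pose a0 := v * zeta 0; pose dir := v * (1 - zeta 0).
have segE s : a0 + rc s * dir = v * zeta s.
  have -> : zeta s = zeta 0 + rc s * (1 - zeta 0).
    by rewrite /zeta !(rcD, rcM, rcN) rc0 rc1; ring.
  by rewrite /a0 /dir; ring.
have zgood s : 0 <= s <= 1 -> good_domain q r (upd u j (v * zeta s)).
  move=> hs; have ze : eps <= cabs (zeta s).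
    apply: le_trans (le_trans (ler_norm _) (Re_le_cabs _)); rewrite Rez; nra.
  have z2 : cabs (zeta s) <= 2.
    apply: le_trans (cabs_le_ReIm _) _; rewrite Rez Imz.
    have w1 : 0 <= eps + s * (1 - eps) <= 1 by nra.
    have w2 : 0 <= tau * (1 - s) <= 1 by nra.
    rewrite !ger0_norm; lra.
  apply/(good_domainP _ _ q1); split=> [i ir|h A hp].
    rewrite /upd; case: eqP => _; last exact: h1.
    rewrite cabsM; nra.
  rewrite (prod_upd u jr); case: ifP => jA; last exact: h2.
  have -> : q ^+ h * ((v * zeta s) ^+ 2 * \prod_(a in A | a != Ordinal jr) u a ^+ 2) =
      zeta s ^+ 2 * g h A.
    by rewrite /g [in RHS](bigD1 (Ordinal jr)) //= -/v; ring.
  apply/eqP => e.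
  have [hlarge|hsmall] := leqP h0 h.
    have := hh0 h hlarge; have := congr1 (@cabs R) e; rewrite cabs1 cabsM cabsX => e' hT.
    have gT : cabs (g h A) <= cabs q ^+ h * T.
      rewrite /g cabsM cabsX cabs_prod; apply: ler_wpM2l; first by rewrite exprn_ge0 // cabs_ge0.
      rewrite /T big_mkcond; apply: ler_prod => a _; rewrite -cabsX.
      case: ifP => _; rewrite ?cabs_ge0 ?lexx ?ler01 //=.
      by rewrite cabsX expr2; have := h1 a (ltn_ord a); nra.
    have z0 := cabs_ge0 (zeta s); have g0 := cabs_ge0 (g h A).
    have : cabs (zeta s) ^+ 2 * cabs (g h A) <= 4 * cabs (g h A).
      by apply: ler_wpM2r => //; rewrite expr2; nra.
    lra.
  have zr : zeta s ^+ 2 = root h A ^+ 2.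
    by rewrite rootE; apply: (mulIf (gn0 h A)); rewrite e mulVf.
  have mem : (h, A) \in allpairs pair (iota 0 h0) (enum {set 'I_r}).
    by apply/allpairsP; exists (h, A); rewrite /= mem_iota mem_enum /= add0n hsmall.
  have tauE om : zeta s = om -> tau0 om = tau.
    move=> zom; rewrite /tau0 -zom Rez Imz.
    have s1 : s != 1.
      apply/eqP => s1; move: e; rewrite /zeta s1 !mul1r subrr mulr0 rc0 mulr0 addr0 addrC subrK rc1.
      by rewrite expr1n mul1r; apply/eqP; exact: h2.
    have -> : 1 - (eps + s * (1 - eps)) = (1 - s) * (1 - eps) by ring.
    have s2 : 1 - s != 0 by rewrite subr_eq0 eq_sym.
    have e2 : 1 - eps != 0 by rewrite subr_eq0 gt_eqF.
    by field; rewrite s2 e2.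
  move/eqP: zr; rewrite eqf_sqr => /orP[/eqP /tauE te|/eqP /tauE te]; move/negP: tauL; apply.
    by rewrite mem_cat; apply/orP; left; apply/mapP; exists (h, A).
  by rewrite mem_cat; apply/orP; right; apply/mapP; exists (h, A).
pose f z := F (upd u j z) - Fprod q r (upd u j z).
have zdiff z : good_domain q r (upd u j z) -> cdiff f z.
  move=> gz; have [_ /(_ j jr)] := hF _ gz; rewrite upd_at => dF.
  have [d d0 hd] := Fprod_near q1 gz.
  have [_ /(_ j jr)] := hd _ (@pd_refl R r (upd u j z) d d0); rewrite upd_at => dE.
  have E G : (fun z0 : C => G (upd (upd u j z) j z0)) = (fun z0 => G (upd u j z0)) :> (C -> C).
    by apply/funext => w; rewrite upd_upd.
  by rewrite E in dF; rewrite E in dE; exact: cdiffB.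
have opn z : good_domain q r (upd u j z) -> exists2 d : R, 0 < d &
    forall w, cabs (w - z) < d -> good_domain q r (upd u j w).
  move=> gz; have [d d0 hd] := near_good q1 gz; exists d => // w wz.
  by apply: hd; rewrite -(upd_upd u j z w); apply: pd_upd; rewrite ?upd_at.
have : f (a0 + dir) = 0.
  apply: identity_segment => [s hs|].
    rewrite segE; have [d d0 hd] := opn _ (zgood s hs).
    by exists d => // z /hd /zdiff.
  have hz0 : (0 <= (0 : R) <= 1) by lra.
  have [d d0 hd] := opn _ (zgood 0 hz0).
  have a0s : cabs a0 < 1 + del.
    rewrite /a0 cabsM; have : cabs (zeta 0) <= eps + tau.
      apply: le_trans (cabs_le_ReIm _) _; rewrite Rez Imz.
      have -> : eps + 0 * (1 - eps) = eps by ring.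
      have -> : tau * (1 - 0) = tau by ring.
      by rewrite !gtr0_norm.
    move=> hz; apply: (@le_lt_trans _ _ (cabs v * (eps + tau))).
      by apply: ler_wpM2l => //; exact: cabs_ge0.
    lra.
  exists (Num.min d (1 + del - cabs a0)); first by rewrite lt_min d0 subr_gt0.
  move=> z; rewrite lt_min => /andP[/hd gz zs].
  rewrite /f IH ?subrr // => i /andP[ji ir]; rewrite /upd; case: eqP => ij.
    have := cabsB_ge z a0; lra.
  by apply: hu; rewrite ltn_neqAle ji ir !andbT eq_sym; apply/eqP.
have -> : a0 + dir = v by rewrite /a0 /dir; ring.
by rewrite /f /v upd_id => /eqP; rewrite subr_eq0 => /eqP.
Qed.

End Continuation.

(** * The polar part *)

Section Pole.
Variable R : realType.
Local Notation C := (Cx R).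
Implicit Types (u v : nat -> C).
Variables (q qh : C) (n k m' : nat) (p : nat -> C).
Hypothesis hqh : qh ^+ 2 = q.
Hypothesis q01 : 0 < cabs q < 1.
Hypothesis k0 : (0 < k)%N.
Hypothesis kn : (k <= n)%N.
Hypothesis hp : forall i, (i < n)%N -> 1 < cabs (p i).
Let m := m'.+1.
Let K : {set 'I_n} := finset (fun i : 'I_n => (i < k)%N).
Let S := finset.setD finset.setT K.
Let t (a : 'I_n) u : C := u a ^+ 2.
Hypothesis hbranch : qh ^+ m * \prod_(i < k) p i = 1.
Hypothesis hgen : forall h (A : {set 'I_n}), (0 < h)%N ->
  q ^+ h * \prod_(a in A) p a ^+ 2 = 1 -> h = m /\ A = K.

Let q1 : cabs q < 1. Proof. by case/andP: q01. Qed.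
Let n0 : (0 < n)%N. Proof. exact: leq_trans k0 kn. Qed.
Let qh0 : qh != 0.
Proof.
apply/eqP => e; move: hqh q01; rewrite e expr0n => <- /=; rewrite cabs0 ltxx //.
Qed.
Let pn0 (a : 'I_n) : p a != 0.
Proof. by rewrite -cabs_gt0; have := hp (ltn_ord a); lra. Qed.

(** Free of [u 0], so that [transv u * u 0 = 1], the branch of the divisor through [p], is affine in
    [u 0]. With [V = transv u * u 0] the equation [q ^+ m * T_K - 1] factors as [(V - 1) * (V + 1)],
    and [V + 1] is 2 at [p]. *)
Definition transv u : C := qh ^+ m * \prod_(1 <= i < k) u i.
Definition onto_pole u : nat -> C := upd u 0%N (transv u)^-1.
Definition weight_K u : C := q ^+ m * 1 * \prod_(a in K) u a ^+ 2.
(** The value on the branch of minus [u_1 ... u_k] times the row sum of [residue_identity]; the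
    minus sign comes from writing the denominator as [q ^+ m * T_K - 1]. *)
Definition res_const : C := (-1) ^+ m * qh ^+ (m ^ 2) * (m ^ (k - 1))%:R.
Definition rest_coef u : C :=
  (\prod_(a in S) u a) * (\prod_(a in S) u a ^+ 2) ^- m.
(** Numerator of the term [A = K] minus that of the announced polar part. On the branch [weight_K]
    is 1, so both then involve the same tail. *)
Definition pole_numer M u : C := rest_coef u *
  (- (\prod_(a in K) u a) * rowsum q 1 (fun a => t a u) m' K *
      Phi q (weight_K u) (fun a => t a u) M S
   - res_const * Phi q 1 (fun a => t a u) M S).

Lemma prodK (f : nat -> C) : \prod_(a in K) f a = \prod_(i < k) f i.
Proof. by rewrite (big_ord_widen n f kn); apply: eq_bigl => a; rewrite finset.inE. Qed.

Lemma prodS (f : nat -> C) : \prod_(a in S) f a = \prod_(k <= i < n) f i.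
Proof.
rewrite big_geq_mkord; apply: eq_bigl => a.
by rewrite !finset.inE andbT -leqNgt.
Qed.

Lemma transv_prod u : transv u * u 0%N = qh ^+ m * \prod_(a in K) u a.
Proof.
rewrite prodK -(big_mkord xpredT u) (big_ltn k0) /transv; ring.
Qed.

Lemma weight_KE u : weight_K u = (transv u * u 0%N) ^+ 2.
Proof.
rewrite transv_prod /weight_K mulr1 exprMn -hqh -prodrXl -!exprM; congr (_ * _).
by rewrite mulnC.
Qed.

Lemma transv_upd u z : transv (upd u 0%N z) = transv u.
Proof.
rewrite /transv; congr (_ * _); rewrite !big_nat; apply: eq_bigr => i /andP[i0 _].
by rewrite upd_ne // -lt0n.
Qed.

Lemma transv_p : transv p * p 0%N = 1.
Proof. by rewrite transv_prod prodK. Qed.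

Lemma transv_p0 : transv p != 0.
Proof.
by apply/eqP => e; have := transv_p; rewrite e mul0r => /eqP; rewrite eq_sym oner_eq0.
Qed.

Lemma nearhol_transv : nearhol n p transv.
Proof.
apply: nearholM; first exact: nearhol_cst.
suff H N : (N <= n)%N -> nearhol n p (fun u => \prod_(1 <= i < N) u i) by exact: H.
elim: N => [|N IH] Nn.
  rewrite (_ : (fun u => _) = fun=> 1); first exact: nearhol_cst.
  by apply/funext => u; rewrite big_geq.
have [N0|N0] := posnP N.
  rewrite (_ : (fun u => _) = fun=> 1); first exact: nearhol_cst.
  by apply/funext => u; rewrite N0 big_geq.
rewrite (_ : (fun u => _) = fun u => \prod_(1 <= i < N) u i * u N); last first.
  by apply/funext => u; rewrite big_nat_recr.
by apply: nearholM; [apply: IH; exact: ltnW | exact: nearhol_coord].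
Qed.

Lemma nearhol_t a : nearhol n p (t a).
Proof. by apply: nearholX; exact: nearhol_coord. Qed.

Lemma t1p a : 1 < cabs (t a p).
Proof. by apply: sqr_gt1; exact: hp. Qed.

Lemma K0 : Ordinal n0 \in K. Proof. by rewrite finset.inE. Qed.

Lemma divisor_ne h (A : {set 'I_n}) : (0 < h)%N -> h != m \/ A != K ->
  q ^+ h * \prod_(a in A) t a p != 1.
Proof.
by move=> h0 [] /eqP hA; apply/eqP => /(hgen h0) [].
Qed.

Lemma subS (A : {set 'I_n}) : A \subset S -> A != K.
Proof.
move=> /fintype.subsetP AS; apply/eqP => AK; have := AS (Ordinal n0).
by rewrite AK K0 finset.inE K0 => /(_ isT).
Qed.

(* Where all denominators other than [q^m t_1 .. t_k - 1] stay away from 0. *)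
Definition regular u :=
  [/\ transv u != 0, forall a, t a u != 0,
   forall h (A : {set 'I_n}), (0 < h)%N -> A \subset S ->
     1 - q ^+ h * weight_K u * \prod_(a in A) t a u != 0,
   forall h (A : {set 'I_n}), (0 < h)%N -> A \subset S ->
     1 - q ^+ h * 1 * \prod_(a in A) t a u != 0 &
   forall h (A : {set 'I_n}), (0 < h <= m')%N ->
     1 - q ^+ h * 1 * \prod_(a in A) t a u != 0].

(** As [A] and [K] are disjoint, this is the divisor expression with power [h + m] and set
    [K :|: A]; the power exceeds [m], which genericity forbids. *)
Lemma weight_p h (A : {set 'I_n}) : (0 < h)%N -> A \subset S ->
  q ^+ h * weight_K p * \prod_(a in A) t a p != 1.
Proof.
move=> h0 AS; rewrite /weight_K mulr1.
have dis : fintype.disjoint (mem K) (mem A).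
  rewrite fintype.disjoint_sym finset.disjoints_subset; apply/fintype.subsetP => a /(fintype.subsetP AS).
  by rewrite !finset.inE andbT.
have -> : q ^+ h * (q ^+ m * \prod_(a in K) p a ^+ 2) * \prod_(a in A) t a p =
   q ^+ (h + m) * \prod_(a in finset.setU K A) t a p.
  have -> : \prod_(a in finset.setU K A) t a p = \prod_(a in [predU K & A]) t a p.
    by apply: eq_bigl => a; rewrite finset.in_setU.
  by rewrite exprD bigU // /= /t; ring.
by apply: divisor_ne; [rewrite addn_gt0 h0 | left; apply/eqP; rewrite /m; lia].
Qed.

Lemma nearhol_weight : nearhol n p weight_K.
Proof.
apply: nearholM; first exact: nearhol_cst.
by apply: nearhol_prod => a _; exact: nearhol_t.
Qed.

Lemma regular_p : nearpt n p regular.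
Proof.
have cx1 : nearhol n p (fun=> 1) := nearhol_cst n p 1.
have [B [r [_ h1]]] := regular_near q1 (nearhol_ccont nearhol_weight)
  (fun a => nearhol_ccont (nearhol_t a)) t1p weight_p.
have [|B' [r' [_ h2]]] := @regular_near R n p q _ (fun=> 1) t S q1 (nearhol_ccont cx1)
  (fun a => nearhol_ccont (nearhol_t a)) t1p.
  by move=> h A h0 AS; rewrite mulr1; apply: divisor_ne => //; right; exact: subS.
have h3 := near_neq0 (nearhol_ccont nearhol_transv) transv_p0.
have h4 : nearpt n p (fun u => forall a, t a u != 0).
  apply: nearpt_all => a; apply: near_neq0; first exact: nearhol_ccont (nearhol_t a).
  by rewrite expf_neq0.
have h5 : nearpt n p (fun u => forall h, (h < m)%N -> forall A : {set 'I_n}, (0 < h)%N ->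
    1 - q ^+ h * 1 * \prod_(a in A) t a u != 0).
  apply: nearpt_nat => h hm; apply: nearpt_all => A.
  have [->|h0] := posnP h; first exact: nearptT.
  have hne : 1 - q ^+ h * 1 * \prod_(a in A) t a p != 0.
    rewrite mulr1 subr_eq0 eq_sym; apply: divisor_ne => //; left; lia.
  apply: (@nearpt_mono R n p _ _ (fun u hu _ => hu)); apply: near_neq0 hne.
  apply: nearhol_ccont; under [X in nearhol _ _ X]eq_fun do rewrite -mulN1r.
  apply: nearholD; first exact: nearhol_cst.
  apply: nearholM; first exact: nearhol_cst.
  apply: nearholM; first exact: nearhol_cst.
  by apply: nearhol_prod => a _; exact: nearhol_t.
apply: nearpt_mono (nearptI h3 (nearptI h4 (nearptI h5 (nearptI h1 h2)))).
move=> u [g3 [g4 [g5 [[_ g1] [_ g2]]]]]; split=> // h A /andP[h0 hm].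
by apply: g5.
Qed.

Lemma onto_pole_near (d : R) : 0 < d -> nearpt n p (fun u => pd n p d (onto_pole u)).
Proof.
move=> d0; have cV := nearhol_ccont (nearholV transv_p0 nearhol_transv).
have e : (transv p)^-1 = p 0%N.
  by apply: (mulfI transv_p0); rewrite mulfV ?transv_p0 // transv_p.
have hd : nearpt n p (pd n p d) by exists d.
apply: nearpt_mono (nearptI hd (cV d d0)) => u [hu hv] i iN.
rewrite /onto_pole /upd; case: eqP => [->|_]; last exact: hu.
by rewrite e in hv.
Qed.

Section DividedNumerator.
Variable d : R.
Hypothesis d0 : 0 < d.
Hypothesis hW : forall u, pd n p d u -> regular u /\ regular (onto_pole u).
Hypothesis hb : holC n (pd n p d) transv.
Let W := pd n p d.
Let ep u : C := transv u * u 0%N - 1.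

Let hep : holC n W ep.
Proof.
apply: (@holCD R n W (fun u => transv u * u 0%N) (fun=> -1)); last exact: holC_cst.
by apply: holCM => //; exact: holC_coord.
Qed.

Local Notation dd := (divdiff n W onto_pole ep).

(** Only the coordinate 0 is changed by [onto_pole], and there [u 0 - (transv u)^-1] is [ep u]
    divided by [transv u]. *)
Lemma dd_coord i : (i < n)%N -> dd (fun u => u i).
Proof.
move=> iN; split; first exact: holC_coord.
have [->|i0] := eqVneq i 0%N; last first.
  exists (fun=> 0) => [|u _]; first exact: holC_cst.
  by rewrite /onto_pole upd_ne // subrr mulr0.
exists (fun u => (transv u)^-1) => [|u Wu].
  by apply: holCV => // u /hW [[]].
have [[b0 _ _ _ _] _] := hW Wu.
by rewrite /onto_pole upd_at /ep mulrBl mul1r mulrAC mulfV // mul1r.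
Qed.

Lemma dd_t a : dd (t a).
Proof. by apply: ddX => //; exact: dd_coord. Qed.

Lemma dd_prod_t (A : {set 'I_n}) : dd (fun u => \prod_(a in A) t a u).
Proof. by apply: dd_prod => // a _; exact: dd_t. Qed.

Lemma dd_invprod_t (A : {set 'I_n}) j : dd (fun u => (\prod_(a in A) t a u) ^- j).
Proof.
apply: ddV => //; last by apply: ddX => //; exact: dd_prod_t.
  by move=> u /hW [[_ ht _ _ _] _]; rewrite expf_neq0 //; apply/prodf_neq0 => a _.
by move=> u /hW [_ [_ ht _ _ _]]; rewrite expf_neq0 //; apply/prodf_neq0 => a _.
Qed.

Let ht0 a u : W u -> t a u != 0 /\ t a (onto_pole u) != 0.
Proof. by move=> /hW [[_ h _ _ _] [_ h' _ _ _]]. Qed.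

Lemma dd_pole_numer M : dd (pole_numer M).
Proof.
have dw : dd weight_K by apply: ddM => //; [exact: dd_cst | exact: dd_prod_t].
apply: ddM => //.
  apply: ddM => //; last exact: dd_invprod_t.
  by apply: dd_prod => // a _; exact: dd_coord.
have -> : (fun u => - (\prod_(a in K) u a) * rowsum q 1 (fun a => t a u) m' K *
      Phi q (weight_K u) (fun a => t a u) M S
   - res_const * Phi q 1 (fun a => t a u) M S) =
   (fun u => (-1) * (\prod_(a in K) u a) * rowsum q 1 (fun a => t a u) m' K *
      Phi q (weight_K u) (fun a => t a u) M S
   + (- res_const) * Phi q 1 (fun a => t a u) M S).
  by apply/funext => u; rewrite mulN1r [- res_const * _]mulNr.
apply: ddD => //; last first.
  apply: ddM => //; first exact: dd_cst.
  apply: (@dd_Phi R n W onto_pole ep hep _ q (fun=> 1) t) => //; [exact: dd_cst|exact: dd_t|].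
  by move=> h A u /andP[h0 _] AS /hW [[_ _ _ g _] [_ _ _ g' _]]; split; [exact: g|exact: g'].
apply: ddM => //; last first.
  apply: (@dd_Phi R n W onto_pole ep hep _ q weight_K t) => //; first exact: dd_t.
  by move=> h A u /andP[h0 _] AS /hW [[_ _ g _ _] [_ _ g' _ _]]; split; [exact: g|exact: g'].
apply: ddM => //.
  apply: ddM => //; first exact: dd_cst.
  by apply: dd_prod => // a _; exact: dd_coord.
apply: dd_sum => // A AK; apply: ddM => //; last exact: dd_invprod_t.
apply: (@dd_Phi R n W onto_pole ep hep _ q (fun=> 1) t) => //; [exact: dd_cst|exact: dd_t|].
by move=> h B u hh _ /hW [[_ _ _ _ g] [_ _ _ _ g']]; split; [exact: g|exact: g'].
Qed.

(** On the branch [q ^+ m * T_K = 1], so [residue_identity] evaluates the row sum, once [K] is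
    identified with the full set of ['I_k]. *)
Lemma pole_numer0 M u : W u -> pole_numer M (onto_pole u) = 0.
Proof.
move=> /hW [[b0 _ _ _ _] [_ ht _ _ hK]]; set s := onto_pole u in ht hK *.
have vs : transv s * s 0%N = 1.
  by rewrite /s /onto_pole transv_upd upd_at mulfV.
have ws : weight_K s = 1 by rewrite weight_KE vs expr1n.
have UK : \prod_(a in K) s a = qh ^- m.
  apply: (mulfI (expf_neq0 m qh0)); rewrite mulfV ?expf_neq0 //.
  by rewrite -transv_prod.
have rs : rowsum q 1 (fun a => t a s) m' K = (-1) ^+ m' * q ^+ 'C(m'.+2, 2) * (m ^ (k - 1))%:R.
  pose e : 'I_k -> 'I_n := widen_ord kn.
  have eI : injective e by move=> i j /(congr1 val) /= /val_inj.
  have eK : finset.imset e (mem finset.setT) = K.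
    apply/finset.setP => a; rewrite [in RHS]finset.inE; apply/finset.imsetP/idP => [[i _ ->]|ak].
      by rewrite /= ltn_ord.
    by exists (Ordinal ak) => //; apply/val_inj.
  have prE (B : {set 'I_k}) : \prod_(i in B) ((fun a => t a s) \o e) i =
      \prod_(a in finset.imset e (mem B)) t a s.
    by rewrite big_imset // => x y _ _; exact: eI.
  rewrite -eK rowsum_inj // -[in RHS](card_ord k).
  apply: residue_identity => [|i||||]; rewrite ?card_ord //.
  - by rewrite -hqh expf_neq0.
  - exact: ht.
  - rewrite -[RHS]ws /weight_K mulr1; congr (_ * _).
    have -> : \prod_i ((fun a => t a s) \o e) i = \prod_(i in finset.setT) ((fun a => t a s) \o e) i.
      by apply: eq_bigl => i; rewrite finset.inE.
    by rewrite prE eK.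
  - move=> h B hh; rewrite prE; have := hK h (finset.imset e (mem B)) hh.
    by rewrite mulr1 subr_eq0 eq_sym.
rewrite /pole_numer rs UK ws -mulrBl /res_const.
(* Twice the exponent [m (m + 1) / 2] of [q] is [m + m ^ 2], and [qh ^+ m] cancels the value
   [qh ^- m] of the product of the [u_a]. *)
have -> : - qh ^- m * ((-1) ^+ m' * q ^+ 'C(m'.+2, 2) * (m ^ (k - 1))%:R) =
  (-1) ^+ m * qh ^+ (m ^ 2) * (m ^ (k - 1))%:R.
  have -> : q ^+ 'C(m'.+2, 2) = qh ^+ m * qh ^+ (m ^ 2).
    rewrite -hqh -exprM -exprD; congr (_ ^+ _).
    have := bin2odd; rewrite /m => _.
    rewrite -mulnn; elim: (m') => // j IH; rewrite !(binS, bin1, bin0) in IH *; lia.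
  rewrite [(-1) ^+ m]exprS.
  have -> : - qh ^- m * ((-1) ^+ m' * (qh ^+ m * qh ^+ (m ^ 2)) * (m ^ (k - 1))%:R) =
   (qh ^- m * qh ^+ m) * (-1 * (-1) ^+ m' * qh ^+ (m ^ 2) * (m ^ (k - 1))%:R) by ring.
  by rewrite mulVf ?expf_neq0 // mul1r.
by rewrite subrr mul0r mulr0.
Qed.

Lemma pole_quotient : exists f : nat -> (nat -> C) -> C,
  (forall M, holC n W (f M)) /\
  forall M u, W u -> pole_numer M u = ep u * f M u.
Proof.
have h M : exists f, holC n W f /\ forall u, W u -> pole_numer M u = ep u * f u.
  have [_ [f hf ef]] := dd_pole_numer M; exists f; split=> // u Wu.
  by rewrite -ef // pole_numer0 // subr0.
have [f hf] := choice h; exists f; split=> M; first by have [] := hf M.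
by have [_] := hf M.
Qed.

End DividedNumerator.

(** With at most [m'] rows, powers of [q] below [m] alone occur in the denominators, and none of
    these vanishes at [p]. *)
Lemma nearhol_Phi1 M (A : {set 'I_n}) : (M <= m')%N ->
  nearhol n p (fun u => Phi q 1 (fun a => t a u) M A).
Proof.
elim: M A => [|M IH] A Mm.
  rewrite (_ : (fun u => _) = fun=> (A == finset.set0)%:R); first exact: nearhol_cst.
  by apply/funext => u; rewrite Phi0.
rewrite (_ : (fun u => _) = fun u => (1 + (-1) * (q ^+ M.+1 * 1 * \prod_(a in A) t a u))^-1 *
  \sum_(B : {set 'I_n} | B \subset A) Phi q 1 (fun a => t a u) M B *
     (\prod_(a in finset.setD A B) t a u) ^- M.+1); last first.
  by apply/funext => u; rewrite PhiS mulN1r.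
have hT (B : {set 'I_n}) : nearhol n p (fun u => \prod_(a in B) t a u).
  by apply: nearhol_prod => a _; exact: nearhol_t.
apply: nearholM.
  apply: nearholV.
    by rewrite mulN1r; have [_ _ _ _] := nearpt_at regular_p; apply.
  apply: nearholD; first exact: nearhol_cst.
  apply: nearholM; first exact: nearhol_cst.
  by apply: nearholM => //; exact: nearhol_cst.
apply: nearhol_sum => B _; apply: nearholM; first exact: IH (ltnW Mm).
apply: nearholV; last exact: nearholX.
by rewrite expf_neq0 //; apply/prodf_neq0 => a _; rewrite /t expf_neq0.
Qed.

(** With [tail_seq] this splits a term of [Phi_comp], cut after row [m], into a part independent of
    [M] and the lower rows. *)
Definition coef (A : {set 'I_n}) u : C := (\prod_(a < n) u a) *
  Phi q 1 (fun a => t a u) m A * (\prod_(a in finset.setD finset.setT A) t a u) ^- m.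

Lemma nearhol_coef A : A != K -> nearhol n p (coef A).
Proof.
move=> AK.
have hT (B : {set 'I_n}) : nearhol n p (fun u => \prod_(a in B) t a u).
  by apply: nearhol_prod => a _; exact: nearhol_t.
have tp (B : {set 'I_n}) j : (\prod_(a in B) t a p) ^+ j != 0.
  by rewrite expf_neq0 //; apply/prodf_neq0 => a _; rewrite /t expf_neq0.
apply: nearholM; last by apply: nearholV => //; exact: nearholX.
apply: nearholM; first by apply: nearhol_prod => a _; exact: nearhol_coord.
rewrite (_ : (fun u => _) = fun u => (1 + (-1) * (q ^+ m * 1 * \prod_(a in A) t a u))^-1 *
  \sum_(B : {set 'I_n} | B \subset A) Phi q 1 (fun a => t a u) m' B *
     (\prod_(a in finset.setD A B) t a u) ^- m); last first.
  by apply/funext => u; rewrite PhiS mulN1r.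
apply: nearholM.
  apply: nearholV.
    by rewrite mulN1r mulr1 subr_eq0 eq_sym; apply: divisor_ne => //; right.
  apply: nearholD; first exact: nearhol_cst.
  apply: nearholM; first exact: nearhol_cst.
  by apply: nearholM => //; exact: nearhol_cst.
apply: nearhol_sum => B _; apply: nearholM; first exact: nearhol_Phi1.
by apply: nearholV => //; exact: nearholX.
Qed.

Definition tail_seq (A : {set 'I_n}) M u : C :=
  Phi q (q ^+ m * 1 * \prod_(a in A) t a u) (fun a => t a u) M (finset.setD finset.setT A).

Lemma nseq_tail A : nseq n p (tail_seq A).
Proof.
apply: (@nseq_Phi R n p q _ (fun u => q ^+ m * 1 * \prod_(a in A) t a u) t) => //.
- apply: nearholM; first exact: nearhol_cst.
  by apply: nearhol_prod => a _; exact: nearhol_t.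
- exact: nearhol_t.
- exact: t1p.
move=> h B h0 BA.
have dis : fintype.disjoint (mem A) (mem B).
  rewrite fintype.disjoint_sym finset.disjoints_subset; apply/fintype.subsetP => a /(fintype.subsetP BA).
  by rewrite !finset.inE andbT.
have -> : q ^+ h * (q ^+ m * 1 * \prod_(a in A) t a p) * \prod_(a in B) t a p =
   q ^+ (h + m) * \prod_(a in finset.setU A B) t a p.
  have -> : \prod_(a in finset.setU A B) t a p = \prod_(a in [predU A & B]) t a p.
    by apply: eq_bigl => a; rewrite finset.in_setU.
  by rewrite exprD bigU //= mulr1; ring.
by apply: divisor_ne; [rewrite addn_gt0 h0 | left; apply/eqP; rewrite /m; lia].
Qed.

(** The term [A = K] has denominator [1 - V ^ 2] with [V = transv u * u 0]. Its numerator differs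
    from that of the polar part by [(V - 1) * f M u], and dividing by [(V - 1) * (V + 1)] leaves the
    regular term [f M u / (V + 1)]. *)
Lemma pole_expansion (f : nat -> (nat -> C) -> C) M u : (forall a, t a u != 0) ->
  transv u * u 0%N - 1 != 0 -> transv u * u 0%N + 1 != 0 ->
  pole_numer M u = (transv u * u 0%N - 1) * f M u ->
  (\prod_(a < n) u a) * Phi q 1 (fun a => t a u) (m + M) finset.setT =
  \sum_(A : {set 'I_n} | A != K) coef A u * tail_seq A M u +
  (transv u * u 0%N + 1)^-1 * f M u +
  res_const / (weight_K u - 1) * (rest_coef u * Phi q 1 (fun a => t a u) M S).
Proof.
move=> t0 V1 V2 hf; rewrite Phi_comp // mulr_sumr (bigD1 K) /=; last exact: finset.subsetT.
rewrite -addrA addrC; congr (_ + _).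
  apply: eq_big => [A|A _]; first by rewrite finset.subsetT.
  by rewrite /coef /tail_seq; ring.
rewrite -/S PhiS -/(rowsum q 1 (fun a => t a u) m' K) -/(weight_K u).
have -> : \prod_(a < n) u a = (\prod_(a in K) u a) * \prod_(a in S) u a.
  rewrite -prod_setD ?finset.subsetT //; apply: eq_bigl => a.
  by rewrite finset.in_setT.
have Ew := weight_KE u; move: hf; rewrite /pole_numer /rest_coef.
rewrite -/(weight_K u) in Ew *.
set X := \prod_(a in K) u a; set Y := \prod_(a in S) u a.
rewrite -[\prod_(a in S) u a ^+ 2]/(\prod_(a in S) t a u).
set Z := (\prod_(a in S) t a u) ^- m; set P := rowsum _ _ _ _ _.
set Q := Phi q (weight_K u) _ M S; set Q1 := Phi q 1 _ M S.
rewrite {}Ew; move: (transv u * u 0%N) V1 V2 X Y Z P Q Q1 res_const => V V1 V2 X Y Z P Q Q1 c hf.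
have -> : f M u = (V - 1)^-1 * (Y * Z * (- X * P * Q - c * Q1)) by rewrite hf mulKf.
have V3 : 1 - V ^+ 2 != 0.
  have -> : 1 - V ^+ 2 = - ((V - 1) * (V + 1)) by ring.
  by rewrite oppr_eq0 mulf_neq0.
have V4 : V ^+ 2 - 1 != 0 by rewrite -opprB oppr_eq0.
by field; rewrite V1 V2 V3 V4.
Qed.

Let shift u j := u (k + j)%N.

Let ekn (a : 'I_(n - k)) : (k + a < n)%N.
Proof. by rewrite -ltn_subRL. Qed.
Let e (a : 'I_(n - k)) : 'I_n := Ordinal (ekn a).
Let eI : injective e.
Proof. by move=> i j /(congr1 val) /= /addnI /val_inj. Qed.
Let eS : finset.imset e (mem finset.setT) = S.
Proof.
apply/finset.setP => a; rewrite !finset.inE andbT -leqNgt.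
apply/finset.imsetP/idP => [[i _ ->]|ka]; first exact: leq_addr.
have h : (a - k < n - k)%N by have := ltn_ord a; lia.
by exists (Ordinal h) => //; apply/val_inj => /=; rewrite subnKC.
Qed.

Lemma shift_prod (f : nat -> C) (A : {set 'I_(n - k)}) :
  \prod_(a in A) f (k + a)%N = \prod_(a in finset.imset e (mem A)) f a.
Proof. by rewrite big_imset // => x y _ _; exact: eI. Qed.

Lemma Fprod_shift u : Fprod q (n - k) (shift u) =
  (\prod_(a in S) u a) * PhiL q 1 (fun a => t a u) S / normalizer q.
Proof.
rewrite /Fprod; congr (_ * _ / _).
  rewrite -eS -(shift_prod u); apply: eq_bigl => a; by rewrite finset.in_setT.
rewrite /PhiL; congr climit; apply/funext => M.
by rewrite -eS Phi_inj.
Qed.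

(** The regular terms of [pole_expansion] form an [nseq], so they converge on the whole polydisc,
    divisor included, and their limit is holomorphic. At good points the left side converges as
    well, and limits are unique. *)
Lemma pole_part : exists d : R, exists H : (nat -> C) -> C,
  [/\ 0 < d, holC n (pd n p d) H,
    forall u, pd n p d u -> good_domain q (n - k) (shift u) &
    forall u, pd n p d u -> good_domain q n u ->
      Fprod q n u = res_const / (weight_K u - 1) *
        (Fprod q (n - k) (shift u) / (\prod_(a in S) u a ^+ 2) ^+ m) + H u].
Proof.
have [db db0 hb] := nearhol_transv.
have [d1 d10 hreg] := regular_p.
have [d2 d20 hreg2] := onto_pole_near d10.
pose d := Num.min db (Num.min d1 d2).
have d0 : 0 < d by rewrite !lt_min db0 d10.
have splitd u : pd n p d u -> [/\ pd n p db u, pd n p d1 u & pd n p d2 u].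
  by move=> /pd_min [? /pd_min []].
have [|f [hf ef]] := @pole_quotient d d0 _ (holC_sub (fun u hu => let: And3 h _ _ := splitd u hu in h) hb).
  by move=> u /splitd [_ /hreg h /hreg2 /hreg].
have nS : nseq n p (fun M u => Phi q (weight_K u) (fun a => t a u) M S).
  apply: nseq_Phi => //; [exact: nearhol_weight | exact: nearhol_t | exact: t1p | exact: weight_p].
have nS1 : nseq n p (fun M u => Phi q 1 (fun a => t a u) M S).
  apply: (@nseq_Phi R n p q _ (fun=> 1) t) => //; [exact: nearhol_cst | exact: nearhol_t | exact: t1p |].
  by move=> h A h0 AS; rewrite mulr1; apply: divisor_ne => //; right; exact: subS.
have hT (B : {set 'I_n}) : nearhol n p (fun u => \prod_(a in B) t a u).
  by apply: nearhol_prod => a _; exact: nearhol_t.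
have hU (B : {set 'I_n}) : nearhol n p (fun u => \prod_(a in B) u a).
  by apply: nearhol_prod => a _; exact: nearhol_coord.
have tp (B : {set 'I_n}) j : (\prod_(a in B) t a p) ^+ j != 0.
  by rewrite expf_neq0 //; apply/prodf_neq0 => a _; rewrite /t expf_neq0.
have hrest : nearhol n p rest_coef.
  by apply: nearholM => //; apply: (nearholV (tp S m)); apply: nearholX; exact: hT.
have hsum : nearhol n p (fun u => rowsum q 1 (fun a => t a u) m' K).
  apply: nearhol_sum => B _; apply: nearholM; first exact: nearhol_Phi1.
  by apply: nearholV => //; exact: nearholX.
have nnum : nseq n p pole_numer.
  apply: nseqM => //.
  rewrite (_ : (fun M u => _) = fun M u =>
     ((-1) * (\prod_(a in K) u a) * rowsum q 1 (fun a => t a u) m' K) *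
       Phi q (weight_K u) (fun a => t a u) M S + (- res_const) * Phi q 1 (fun a => t a u) M S); last first.
    by apply/funext => M; apply/funext => u; rewrite mulN1r [- res_const * _]mulNr.
  apply: nseqD; last by apply: nseqM => //; exact: nearhol_cst.
  apply: nseqM => //; apply: nearholM => //; apply: nearholM => //; exact: nearhol_cst.
have nf : nseq n p f.
  (* Each [f M] is already holomorphic by algebra; only the rate of convergence, uniform up to the
     divisor, is at stake here. *)
  apply: (@nseq_divide R n p transv f pole_numer n0) => //.
  - exact: nearhol_ccont nearhol_transv.
  - exact: transv_upd.
  - exact: transv_p.
  - by exists d.
  - by exists d => // u hu M; exact: ef.
  - by case: nnum.
have hV : nearhol n p (fun u => transv u * u 0%N + 1).
  apply: nearholD; last exact: nearhol_cst.
  by apply: nearholM; [exact: nearhol_transv | exact: nearhol_coord].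
have V2 : transv p * p 0%N + 1 != 0.
  by rewrite transv_p -[1 + 1]/(2%:R) -rc_nat rc_eq0 pnatr_eq0.
have nHH : nseq n p (fun M u =>
   \sum_(A : {set 'I_n} | A != K) coef A u * tail_seq A M u +
   (transv u * u 0%N + 1)^-1 * f M u).
  apply: nseqD; last by apply: nseqM => //; exact: nearholV.
  apply: nseq_sum => A AK; apply: nseqM; [exact: nearhol_coef | exact: nseq_tail].
have [d3 d30 [holH cvgH]] := nseq_limit nHH.
have [d4 d40 [_ cvgS]] := nseq_limit nS1.
have [dd dd0 hdd] : nearpt n p (fun u => [/\ pd n p d u, pd n p d3 u, pd n p d4 u,
    transv u * u 0%N + 1 != 0 & forall j, (j < n)%N -> 1 < cabs (u j)]).
  have nd (d' : R) : 0 < d' -> nearpt n p (pd n p d') by exists d'.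
  apply: nearpt_mono (nearptI (nd d d0) (nearptI (nd d3 d30) (nearptI (nd d4 d40)
    (nearptI (near_neq0 (nearhol_ccont hV) V2)
      (nearpt_nat (fun j jn => near_gt1 jn (hp jn))))))).
  by move=> u [? [? [? [? ?]]]].
exists dd, (fun u => climit (fun M => \sum_(A : {set 'I_n} | A != K) coef A u * tail_seq A M u +
   (transv u * u 0%N + 1)^-1 * f M u) * (normalizer q)^-1); split=> //.
- by apply: holCM; [apply: holC_sub holH => u /hdd [] | exact: holC_cst].
- move=> u /hdd [/splitd [_ /hreg [_ _ _ hS _] _] _ _ _ h1].
  apply/(good_domainP _ _ q1); split=> [i ik|h A h0].
    by apply: h1; rewrite -ltn_subRL.
  rewrite (shift_prod (fun i => u i ^+ 2)).
  have := hS h (finset.imset e (mem A)) h0; rewrite mulr1 subr_eq0 eq_sym; apply.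
  by rewrite -eS; apply: finset.imsetS; exact: finset.subsetT.
move=> u /hdd [hu hu3 hu4 Vp _] gu; have [_ /hreg [_ t0 _ _ _] _] := splitd u hu.
have w1 : weight_K u != 1.
  have [_ /(_ m K isT)] := (good_domainP n u q1).1 gu.
  by rewrite /weight_K mulr1.
have V1 : transv u * u 0%N - 1 != 0.
  by apply: contra w1; rewrite subr_eq0 weight_KE => /eqP ->; rewrite expr1n.
have E := fun M => @pole_expansion f M u t0 V1 Vp (ef M u hu).
have lim1 : ccvg (fun M => (\prod_(a < n) u a) * Phi q 1 (fun a => t a u) (m + M) finset.setT)
   ((\prod_(a < n) u a) * PhiL q 1 (fun a => t a u) finset.setT).
  apply: ccvgM; first exact: ccvg_cst.
  exact: ccvg_shift (good_cvg q1 gu).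
rewrite (funext E) in lim1.
have lim2 := ccvgD (cvgH u hu3)
   (ccvgM (ccvg_cst (res_const / (weight_K u - 1)))
     (ccvgM (ccvg_cst (rest_coef u)) (cvgS u hu4))).
have E3 := ccvg_unique lim1 lim2.
rewrite Fprod_shift /Fprod -/(t _ u).
rewrite -[X in _ * X / _ = _]/(PhiL q 1 (fun a => t a u) finset.setT) E3 -/(PhiL q 1 (fun a => t a u) S).
rewrite /rest_coef mulrDl addrC; congr (_ + _).
ring.
Qed.

End Pole.

Theorem theorem9p1 (R : realType) (q qh : Cx R)
  (hqh : qh ^+ 2 = q) (hq0 : 0 < `|q|) (hq1 : `|q| < 1)
  (n k m : nat) (hn : (1 <= n)%N) (hk1 : (1 <= k)%N) (hkn : (k <= n)%N)
  (hm : (1 <= m)%N)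
  (F : nat -> (nat -> Cx R) -> Cx R) (hF : forall r, is_F q r (F r))
  (p : nat -> Cx R) (hp : outside_disc n p)
  (hpD : q ^+ m * \prod_(i < k) (p i) ^+ 2 = 1)
  (hbranch : qh ^+ m * \prod_(i < k) p i = 1)
  (hgen : forall (m' : nat) (S : {set 'I_n}), (0 < m')%N -> (0 < #|S|)%N ->
            q ^+ m' * \prod_(i in S) (p i) ^+ 2 = 1 ->
            m' = m /\ S = finset (fun i : 'I_n => (i < k)%N)) :
  exists d : Cx R, 0 < d /\
  exists H : (nat -> Cx R) -> Cx R,
    holomorphic_on n (polydisc n p d) H /\
    forall t : nat -> Cx R, polydisc n p d t -> good_domain q n t ->
      F n t =
        (-1) ^+ m * qh ^+ (m ^ 2) * (m ^ (k - 1))%:R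
          / (q ^+ m * \prod_(i < k) (t i) ^+ 2 - 1)
        * (F (n - k)%N (fun j => t (k + j)%N)
           / (\prod_(k <= i < n) (t i) ^+ 2) ^+ m)
        + H t.
Proof.
have q01 : 0 < cabs q < 1.
  by move: hq0 hq1; rewrite normE -[0]/(rc 0) -[1]/(rc 1) !rc_lt => -> ->.
case: m hm hpD hbranch hgen => // m' _ _ hbranch hgen.
have hp' i : (i < n)%N -> 1 < cabs (p i) by move=> /hp; rewrite -norm_gt.
(* For the empty set the equation would read [q ^+ h = 1], impossible as [cabs q < 1], so genericity
   extends to all subsets. *)
have hgen' h (A : {set 'I_n}) : (0 < h)%N -> q ^+ h * \prod_(a in A) p a ^+ 2 = 1 ->
    h = m'.+1 /\ A = finset (fun i : 'I_n => (i < k)%N).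
  move=> h0; have [->|A0] := eqVneq A finset.set0; last first.
    by apply: hgen => //; rewrite finset.card_gt0.
  rewrite finset.big_set0 mulr1 => /eqP e; case/andP: q01 => _ q1.
  by rewrite (negbTE (qX_neq1 q1 h0)) in e.
have [d [H [d0 holH hsh expand]]] := pole_part hqh q01 hk1 hkn hp' hbranch hgen'.
exists (rc d); split; first by rewrite (rc_lt 0 d).
exists H; split; first by apply/holomorphic_onP; apply: holC_sub holH => u /pd_polydisc.
move=> t /pd_polydisc ht gt.
rewrite (is_F_Fprod q01 (hF n) gt) (is_F_Fprod q01 (hF (n - k)%N) (hsh t ht)) (expand t ht gt).
by rewrite /weight_K /res_const mulr1 (prodK hkn (fun i => t i ^+ 2)) (prodS n k (fun i => t i ^+ 2)).
Qed.
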